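(* (i) Let $\Delta\subset\mathbb{R}^2$ be any triangle. For every $T\in\mathcal{T}_\Delta$ one has $\mathrm{vol}(\Delta\times T)=\frac{c_{EHZ}(\Delta\times T)^2}{2}$. Moreover, for a convex body $T\subset\mathbb{R}^2$, equality $\mathrm{vol}(\Delta\times T)=\frac{c_{EHZ}(\Delta\times T)^2}{2}$ holds if and only if $T=\lambda T^*+s$ for some $\lambda>0$, $s\in\mathbb{R}^2$ and $T^*\in\mathcal{T}_\Delta$. (ii) Let $\square\subset\mathbb{R}^2$ be any square whose sides are parallel to the coordinate axes. For all $a_1,a_2\in[0,1]$ one has $\mathrm{vol}(\square\times\diamondsuit(a_1,a_2))=\frac{c_{EHZ}(\square\times\diamondsuit(a_1,a_2))^2}{2}$. Moreover, for a convex body $T\subset\mathbb{R}^2$, equality $\mathrm{vol}(\square\times T)=\frac{c_{EHZ}(\square\times T)^2}{2}$ holds if and only if $T=\lambda\diamondsuit(a_1,a_2)+s$ for some $\lambda>0$, $s\in\mathbb{R}^2$, $a_1,a_2\in[0,1]$. (iii) Let $Q\subset\mathbb{R}^2$ be a trapezoid which is neither a triangle nor a parallelogram, and write $Q=M(\diamondsuit(a_1,a_2))+c$ with $M\in GL_2(\mathbb{R})$, $c\in\mathbb{R}^2$, $a_1,a_2\in[0,1]$. Let $P=(M^T)^{-1}([0,1]^2)$. Then $\mathrm{vol}(Q\times P)=\frac{c_{EHZ}(Q\times P)^2}{2}$, and for a convex body $T\subset\mathbb{R}^2$ equality $\mathrm{vol}(Q\times T)=\frac{c_{EHZ}(Q\times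 T)^2}{2}$ holds if and only if $T=\lambda P+s$ for some $\lambda>0$, $s\in\mathbb{R}^2$.
   Context: Identify $\mathbb{R}^4=\mathbb{R}^2(x)\times\mathbb{R}^2(y)$ with the standard symplectic form $\omega=dx_1\wedge dy_1+dx_2\wedge dy_2$ and let $J=\begin{pmatrix}0&I_2\\-I_2&0\end{pmatrix}$. A convex body is a compact convex set with nonempty interior. For a convex body $C\subset\mathbb{R}^4$ with $0$ in its interior let $\mu_C(z)=\min\{t\ge 0: z\in tC\}$ and $\partial\mu_C$ its subdifferential. A closed characteristic on $\partial C$ is an absolutely continuous loop $x:\mathbb{R}/\mathbb{Z}\to\mathbb{R}^4$ with $\mu_C(x(t))=1$ for all $t$ and $\dot x(t)\in\mathbb{R}_{>0}J\partial\mu_C(x(t))$ for a.e. $t$; its action is $\mathbb{A}(x)=-\frac12\int_0^1\langle J\dot x,x\rangle dt$, and $c_{EHZ}(C)$ is the minimal action of a closed characteristic on $\partial C$ (translation invariant, hence defined for all convex bodies). $\mathrm{vol}$ is Lebesgue measure. On $\mathbb{R}^2$, $J$ also denotes the linear map $J(a,b)=(b,-a)$. For a triangle $\Delta\subset\mathbb{R}^2$, $\mathcal{T}_\Delta$ is the set of convex bodies $\mathrm{conv}(J\Delta\cup(-J\Delta+t))$ where $t\in\mathbb{R}^2$ ranges over the minimizers of $t\mapsto\mathrm{vol}(\mathrm{conv}(J\Delta\cup(-J\Delta+t)))$. For $a_1,a_2\in[0,1]$, $\diamondsuit(a_1,a_2)=\mathrm{conv}(([0,1]\times\{a_2\})\cup(\{a_1\}\times[0,1]))\subset\mathbb{R}^2$.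 A trapezoid is a convex quadrilateral with at least one pair of parallel sides (triangles counted as degenerate trapezoids). Every convex quadrilateral can be written as $M(\diamondsuit(a_1,a_2))+c$ as in (iii). *)

(* Defs.v *)
From HB Require Import structures.
From mathcomp Require Import all_boot all_order all_algebra.
From mathcomp Require Import all_classical all_reals all_analysis.
Import Order.TTheory GRing.Theory Num.Theory numFieldNormedType.Exports.

Set Implicit Arguments.
Unset Strict Implicit.
Unset Printing Implicit Defensive.

Local Open Scope classical_set_scope.
Local Open Scope ring_scope.

Section Defs.
Context {R : realType}.

Section Generic.
Context {V : normedModType R}.

Definition convex_set (C : set V) : Prop :=
  forall x y, C x -> C y -> forall t : R, 0 <= t <= 1 ->
    C (t *: x + (1 - t) *: y).

Definition convex_body (C : set V) : Prop :=
  [/\ convex_set C, compact C & (C°) !=set0].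

Definition conv_hull (S : set V) : set V :=
  \bigcap_(C in [set C : set V | convex_set C /\ S `<=` C]) C.

Definition scale_set (t : R) (C : set V) : set V := [set t *: c | c in C].
Definition translate (C : set V) (s : V) : set V := [set c + s | c in C].

Definition gauge (C : set V) (z : V) : R :=
  inf [set t : R | 0 <= t /\ scale_set t C z].

Definition abs_cont_on (a b : R) (f : R -> V) : Prop :=
  forall e : R, 0 < e -> exists2 d : R, 0 < d &
    forall (n : nat) (u v : nat -> R),
      (forall i, (i < n)%N -> a <= u i /\ u i <= v i /\ v i <= b) ->
      (forall i j, (i < n)%N -> (j < n)%N -> i <> j ->
         v i <= u j \/ v j <= u i) ->
      \sum_(i < n) (v i - u i) < d ->
      \sum_(i < n) `|f (v i) - f (u i)| < e.
End Generic.

Definition dot2 (p q : R * R) : R := p.1 * q.1 + p.2 * q.2.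
Definition det2 (p q : R * R) : R := p.1 * q.2 - p.2 * q.1.
Definition J2 (p : R * R) : R * R := (p.2, - p.1).

Definition vol2 : set (R * R) -> \bar R :=
  ((@lebesgue_measure R) \x (@lebesgue_measure R))%E.
Definition vol4 : set ((R * R) * (R * R)) -> \bar R := (vol2 \x vol2)%E.

Definition dot4 (z w : (R * R) * (R * R)) : R := dot2 z.1 w.1 + dot2 z.2 w.2.
Definition J4 (z : (R * R) * (R * R)) : (R * R) * (R * R) := (z.2, - z.1).

Definition subdiff (f : (R * R) * (R * R) -> R) (z : (R * R) * (R * R))
  : set ((R * R) * (R * R)) :=
  [set v | forall w, f z + dot4 v (w - z) <= f w].

(* closed characteristic on the boundary of C (0 in the interior of C):
   an absolutely continuous loop R/Z -> R^4 (1-periodic map R -> R^4,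
   absolutely continuous on [0,1]) with mu_C(x t) = 1 for all t and
   x'(t) in R_{>0} J (subdiff mu_C (x t)) for a.e. t. *)
Definition closed_characteristic (C : set ((R * R) * (R * R)))
    (x : R -> (R * R) * (R * R)) : Prop :=
  [/\ (forall t, x (t + 1) = x t),
      abs_cont_on 0 1 x,
      (forall t, gauge C (x t) = 1) &
      {ae @lebesgue_measure R, forall t,
         derivable x t 1 /\
         exists2 r : R, 0 < r &
           exists2 v, subdiff (gauge C) (x t) v & 'D_1 x t = r *: J4 v}].

Definition action (x : R -> (R * R) * (R * R)) : R :=
  - (1 / 2) * \int[@lebesgue_measure R]_(t in `[0, 1]) dot4 (J4 ('D_1 x t)) (x t).

(* c_EHZ(C): minimal action of a closed characteristic on the boundary of
   C - p, for p in the interior of C (translation invariance: all interior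
   base points give the same set of actions). *)
Definition cEHZ (C : set ((R * R) * (R * R))) : R :=
  inf [set a : R | exists p, exists x, [/\ (C°) p,
          closed_characteristic (translate C (- p)) x & a = action x]].

Definition is_triangle (D : set (R * R)) : Prop :=
  exists a b c : R * R, det2 (b - a) (c - a) != 0 /\
    D = conv_hull [set p | p = a \/ p = b \/ p = c].

Definition conv_JD (D : set (R * R)) (t : R * R) : set (R * R) :=
  conv_hull ((J2 @` D) `|` [set - J2 d + t | d in D]).

Definition T_family (D : set (R * R)) : set (set (R * R)) :=
  [set K | exists t, K = conv_JD D t /\
      forall t', (vol2 (conv_JD D t) <= vol2 (conv_JD D t'))%E].

Definition is_axis_square (S : set (R * R)) : Prop :=
  exists (a b s : R), 0 < s /\
    S = [set p | (a <= p.1 <= a + s) /\ (b <= p.2 <= b + s)].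

Definition diamond (a1 a2 : R) : set (R * R) :=
  conv_hull ([set p | 0 <= p.1 <= 1 /\ p.2 = a2] `|`
             [set p | p.1 = a1 /\ 0 <= p.2 <= 1]).

Definition unit_square : set (R * R) :=
  [set p | 0 <= p.1 <= 1 /\ 0 <= p.2 <= 1].

Definition orient (a b c : R * R) : R := det2 (b - a) (c - b).

Definition convex_quad (v0 v1 v2 v3 : R * R) : Prop :=
  (0 < orient v0 v1 v2 /\ 0 < orient v1 v2 v3 /\
   0 < orient v2 v3 v0 /\ 0 < orient v3 v0 v1) \/
  (orient v0 v1 v2 < 0 /\ orient v1 v2 v3 < 0 /\
   orient v2 v3 v0 < 0 /\ orient v3 v0 v1 < 0).

Definition quad (v0 v1 v2 v3 : R * R) : set (R * R) :=
  conv_hull [set p | p = v0 \/ p = v1 \/ p = v2 \/ p = v3].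

Definition is_trapezoid (Q : set (R * R)) : Prop :=
  is_triangle Q \/
  exists v0 v1 v2 v3, [/\ convex_quad v0 v1 v2 v3, Q = quad v0 v1 v2 v3 &
     det2 (v1 - v0) (v3 - v2) = 0 \/ det2 (v2 - v1) (v0 - v3) = 0].

Definition is_parallelogram (Q : set (R * R)) : Prop :=
  exists v0 v1 v2 v3, [/\ convex_quad v0 v1 v2 v3, Q = quad v0 v1 v2 v3 &
     v1 - v0 = v2 - v3].

Definition mx_apply (M : 'M[R]_2) (p : R * R) : R * R :=
  (M 0 0 * p.1 + M 0 1 * p.2, M 1 0 * p.1 + M 1 1 * p.2).

End Defs.

(* Main.v *)
(** Choose affine coordinates (X, Y) in which the first factor K is the region 0 <= X <= 1,
    |Y| <= 1/2 - e X; the square is e = 0, the triangle e = 1/2, and the other trapezoids lie in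
    between. The capacity of K x T is the largest scale c at which T contains translates of three
    configurations: a segment conormal to the parallel sides X = 0 and X = 1, and two triangles
    whose edges, in one or the other cyclic order, are the conormals of the other sides.

    For the lower bound, the position q of a closed characteristic cannot be translated into the
    interior of K, so it meets both parallel sides or all the others; the action is the integral
    of the support function of T along the velocity of q, hence it is bounded below by inserting
    points of T between the times of contact. For the upper bound, Hahn-Banach provides, for a
    configuration of maximal scale, normals of T at its vertices with sum zero; they are the
    edges of a billiard trajectory, which fits into K because the other configurations of the
    same scale fit into T.

    Adding up the areas of the trapezoids between parallel chords of T gives
    vol T * vol K >= c^2 / 2, and the cases of equality of this planar inequality are those of
    the theorem. *)

(* The speed of a closed characteristic is neither bounded nor integrable in advance, and its
   derivative exists only almost everywhere. So no chain rule is applied under an integral: all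
   estimates are about increments and come from one monotonicity lemma for functions controlled by
   an absolutely continuous path. The pairing of position and momentum has increments that cancel
   around the loop; this turns the action into the integral of the support function of T.

   The capacity is an infimum, but no existence theorem for minimizers is invoked: the lower bound c
   holds for every closed characteristic, and a polygonal loop of action c is written down.

   In the chart of T dual to that of K and scaled by c, the determinants of the two charts cancel.
   The volume inequality then says that a planar convex set containing the three configurations at
   unit scale has area at least 1 / (2 (1 - e)), where 1 - e is the area of the model trapezoid. The
   minimization over t in the family of a triangle is not carried out: the same inequality bounds
   the area of every hull from below, and one explicit hull attains the bound. *)
From HB Require Import structures.
From mathcomp Require Import all_boot all_order all_algebra.
From mathcomp Require Import ring lra.
From mathcomp Require Import all_classical all_reals all_analysis.
From mathcomp Require Import measurable_realfun.
Require Import Defs.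
Import Order.TTheory GRing.Theory Num.Theory numFieldNormedType.Exports.

Set Implicit Arguments.
Unset Strict Implicit.
Unset Printing Implicit Defensive.

Local Open Scope classical_set_scope.
Local Open Scope ring_scope.

(** * Absolutely continuous functions *)

Section Calculus.
Context {R : realType}.
Local Notation mu := (@lebesgue_measure R).

(** Continuous induction: the supremum of the points reachable from [a] is itself reachable and, if
    it is below [b], can be passed. It replaces a compactness argument when a property of intervals
    holds locally and is additive. *)
Lemma step_induction (P : R -> R -> Prop) (a b : R) :
  (forall u v w, u <= v -> v <= w -> P u v -> P v w -> P u w) ->
  (forall t, a <= t <= b -> exists2 d : R, 0 < d &
     forall u v, a <= u -> v <= b -> u <= t -> t <= v -> v - u < d -> P u v) ->
  a <= b -> P a b.
Proof.
move=> Ptr Ploc ab.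
pose S := [set t | a <= t <= b /\ P a t].
have Sa : S a.
  have aab : a <= a <= b by rewrite lexx.
  split=> //; have [d d0 H] := Ploc a aab; apply: H => //; lra.
have supS : has_sup S.
  by split; [exists a | exists b => t [/andP[_ ->]]].
have c1 : a <= sup S by apply: ub_le_sup => //; case: supS.
have c2 : sup S <= b by apply: ge_sup; [exists a | move=> t [/andP[]]].
have cab : a <= sup S <= b by rewrite c1 c2.
have [d d0 H] := Ploc _ cab.
have d20 : 0 < d / 2 by lra.
have [s [/andP[as_ sb] Pas] sc] := sup_adherent d20 supS.
have sc' : s <= sup S by apply: ub_le_sup; [case: supS | split=> //; rewrite as_ sb].
have key v : sup S <= v -> v <= b -> v < sup S + d / 2 -> P a v.
  move=> cv vb vd; apply: (Ptr _ s) => //; first lra.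
  by apply: H => //; lra.
case: (ltP (sup S) b) => [cb|bc]; last first.
  have -> : b = sup S by lra.
  apply: key; lra.
pose v := Num.min b (sup S + d / 4).
have vb : v <= b by rewrite /v ge_min lexx.
have vd : v <= sup S + d / 4 by rewrite /v ge_min lexx orbT.
have cv : sup S < v by rewrite /v lt_min cb /=; lra.
have : S v by split; [rewrite vb andbT; lra | apply: key; lra].
move=> /(ub_le_sup (proj2 supS)); lra.
Qed.

(** Ordered lists of intervals can be concatenated, which is how the covering in [ae_nondecreasing]
    grows. *)
Lemma abs_cont_seq (V : normedModType R) (x : R -> V) (a b : R) :
  abs_cont_on a b x -> forall e : R, 0 < e -> exists2 d : R, 0 < d &
    forall s : seq (R * R),
      (forall i, i \in s -> [/\ a <= i.1, i.1 <= i.2 & i.2 <= b]) ->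
      pairwise (fun i j : R * R => i.2 <= j.1) s ->
      \sum_(i <- s) (i.2 - i.1) < d ->
      \sum_(i <- s) `|x i.2 - x i.1| < e.
Proof.
move=> ac e e0; have [d d0 H] := ac e e0; exists d => // s sab sdis sd.
have := H (size s) (fun i => (nth (0, 0) s i).1) (fun i => (nth (0, 0) s i).2).
rewrite (big_nth (0, 0)) big_mkord => -> //.
- by move=> i ilt; have [] := sab _ (mem_nth (0, 0) ilt).
- move=> i j ilt jlt ij.
  have := pairwiseP (0, 0) sdis.
  have /orP[lij|lji] : (i < j)%N || (j < i)%N by rewrite -neq_ltn; apply/eqP.
  + by move=> /(_ _ _ ilt jlt lij) h; left.
  + by move=> /(_ _ _ jlt ilt lji) h; right.
by rewrite (big_nth (0, 0)) big_mkord in sd.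
Qed.

(** Straddle estimate: both ends of the interval are compared with [t], so no continuity of the
    derivative enters. *)
Lemma derivable_ge0_slope (f : R -> R) (t e : R) :
  derivable f t 1 -> 0 <= 'D_1 f t -> 0 < e -> exists2 d : R, 0 < d &
  forall u v, u <= t -> t <= v -> v - u < d -> - e * (v - u) <= f v - f u.
Proof.
move=> df D0 e0.
have /cvgrPdist_lt/(_ e e0) : (fun h => h^-1 *: (f (h *: 1 + t) - f t)) @ 0^' --> 'D_1 f t by exact: df.
rewrite near_withinE => -[d /= d0 H]; exists d => // u v ut tv vud.
have sl h : h != 0 -> `|h| < d -> - e < (f (h + t) - f t) / h.
  move=> h0 hd; have := H h; rewrite /ball /= sub0r normrN => /(_ hd h0).
  rewrite ltr_distlC /= [h *: 1]mulr1 -[_ *: _]/(_ * _) [_^-1 * _]mulrC => /andP[+ _].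
  set q := (f _ - f t) / h; lra.
have h1 : - e * (v - t) <= f v - f t.
  have [->|vt] := eqVneq v t; first by rewrite !subrr mulr0.
  have vt0 : 0 < v - t by rewrite subr_gt0 lt_neqAle eq_sym vt tv.
  have := sl (v - t); rewrite subr_eq0 vt gtr0_norm // => /(_ isT).
  rewrite subrK ltr_pdivlMr // => h; apply: ltW; apply: h; lra.
have h2 : - e * (t - u) <= f t - f u.
  have [->|tu] := eqVneq u t; first by rewrite !subrr mulr0.
  have tu0 : 0 < t - u by rewrite subr_gt0 lt_neqAle tu ut.
  have := sl (u - t); rewrite subr_eq0 tu ltr0_norm; last lra.
  rewrite subrK ltr_ndivlMr; last lra.
  move=> /(_ isT) h; have : - (u - t) < d by lra.
  by move=> /h; lra.
lra.
Qed.

End Calculus.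

Section AlmostEverywhere.
Context {R : realType}.
Local Notation mu := (@lebesgue_measure R).

(** The exceptional null set is covered by an open set of small measure. On intervals inside it [f]
    loses little because [x] is absolutely continuous; around all other points the straddle estimate
    applies. Only the decrease of [f] is controlled, so that [f] may involve a primitive known
    merely to be Lipschitz or monotone. *)
Lemma ae_nondecreasing (V : normedModType R) (x : R -> V) (f : R -> R) (C a b : R) :
  a <= b -> 0 <= C -> abs_cont_on a b x ->
  (forall u v, a <= u -> u <= v -> v <= b ->
     f u - f v <= C * (`|x v - x u| + (v - u))) ->
  {ae mu, forall t, a < t < b -> derivable f t 1 /\ 0 <= 'D_1 f t} ->
  f a <= f b.
Proof.
move=> ab C0 ac ctl good.
suff key (e : R) : 0 < e -> f a - f b <= e * ((b - a) + C * 2).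
  rewrite leNgt; apply/negP => fba.
  have k0 : 0 < (b - a) + C * 2 + 1 by nra.
  have e0 : 0 < (f a - f b) / 2 / ((b - a) + C * 2 + 1) by apply: divr_gt0; lra.
  have := key _ e0; set e := (f a - f b) / 2 / _ => h.
  have : e * ((b - a) + C * 2 + 1) = (f a - f b) / 2 by rewrite /e mulfVK //; lra.
  nra.
move=> e0.
have : mu.-negligible (~` [set t | a < t < b -> derivable f t 1 /\ 0 <= 'D_1 f t] `|` ([set a] `|` [set b])).
  apply: negligibleU => //; apply: negligibleU; apply/negligibleP => //; exact: lebesgue_measure_set1.
move=> [A [mA A0 subA]].
have [d0 d00 Hd] := abs_cont_seq ac e0.
pose d := Num.min d0 e.
have d_gt0 : 0 < d by rewrite lt_min d00.
have [U [oU AU muU]] : exists U : set R, [/\ open U, A `<=` U & (mu (U `\` A) < d%:E)%E].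
  by apply: lebesgue_regularity_outer => //; rewrite -[X in (X < _)%E]/(mu A) A0 ltry.
have mU : measurable U by exact: open_measurable.
have muUd : (mu U < d%:E)%E.
  rewrite (_ : U = (U `\` A) `|` A); last first.
    by rewrite setUC setDUK.
  rewrite measureU//; last by rewrite setDE -setIA setICl setI0.
    rewrite -[X in (_ + X < _)%E]/(mu A) A0 adde0 //.
  exact: measurableD.
(* The list [s] collects the intervals used at exceptional points. Half-open intervals make the
   measure bound additive under concatenation. *)
pose P u v := exists s : seq (R * R),
  [/\ forall i, i \in s -> [/\ u <= i.1, i.1 <= i.2 & i.2 <= v],
     pairwise (fun i j : R * R => i.2 <= j.1) s,
     ((\sum_(i <- s) (i.2 - i.1))%:E <= mu (U `&` `[u, v[%classic))%E &
     f u - f v <= e * (v - u) + \sum_(i <- s) C * (`|x i.2 - x i.1| + (i.2 - i.1))].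
have [s [sab sdis smu sf]] : P a b.
  apply: step_induction => //.
  - move=> u v w uv vw [s1 [s1b s1p s1m s1f]] [s2 [s2b s2p s2m s2f]].
    exists (s1 ++ s2); split.
    + move=> i; rewrite mem_cat => /orP[/s1b[k1 k2 k3]|/s2b[k1 k2 k3]]; split=> //.
        exact: le_trans k3 vw.
      exact: le_trans uv k1.
    + rewrite pairwise_cat s1p s2p !andbT; apply/allrelP => i j /s1b[_ _ h1] /s2b[h2 _ _].
      exact: le_trans h1 h2.
    + rewrite big_cat EFinD (_ : U `&` _ = (U `&` `[u, v[%classic) `|` (U `&` `[v, w[%classic)).
        rewrite measureU; [exact: leeD| exact: measurableI| exact: measurableI|].
        apply/seteqP; split => // t [[_ /=]]; rewrite !in_itv /= => /andP[_ h1] [_] /= /andP[h2 _]; lra.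
      rewrite -setIUr; congr (_ `&` _); apply/seteqP; split => t /=; rewrite !in_itv /=.
        move=> /andP[h1 h2]; case: (ltP t v) => h; [left|right]; lra.
      move=> [] /andP[h1 h2]; lra.
    + rewrite big_cat /=; lra.
  - move=> t /andP[at_ tb]; have [At|nAt] := pselect (A t).
      have /nbhs_ballP[r /= r0 rU] : nbhs t U by apply: open_nbhs_nbhs; split => //; exact: AU.
      exists r => // u v au vb ut tv vur; exists [:: (u, v)]; split.
      + move=> i; rewrite inE => /eqP -> /=; split; lra.
      + by [].
      + rewrite big_seq1 /= (_ : U `&` _ = `[u, v[%classic); last first.
          apply: setIidr => z /=; rewrite in_itv /= => /andP[h1 h2]; apply: rU.
          rewrite /ball /= ltr_norml; lra.
        rewrite lebesgue_measure_itv /= lte_fin; case: ltP => // h.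
        rewrite lee_fin; lra.
      + rewrite big_seq1 /=; have := ctl u v au (le_trans ut tv) vb; nra.
    have tgood : a < t < b /\ (a < t < b -> derivable f t 1 /\ 0 <= 'D_1 f t).
      split; last by apply: contrapT => h; apply: nAt; apply: subA; left.
      rewrite !lt_neqAle at_ tb !andbT; apply/andP; split; apply/eqP => h.
        by apply: nAt; apply: subA; right; left.
      by apply: nAt; apply: subA; right; right.
    have [tab /(_ tab) [df Df]] := tgood.
    have [r r0 H] := derivable_ge0_slope df Df e0.
    exists r => // u v au vb ut tv vur; exists [::]; split => //.
      by rewrite big_nil.
    rewrite big_nil addr0; have := H u v ut tv vur; lra.
have slen : \sum_(i <- s) (i.2 - i.1) < d.
  rewrite -lte_fin; apply: le_lt_trans smu _; apply: le_lt_trans muUd.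
  apply: le_measure; rewrite ?inE //; exact: measurableI.
have : \sum_(i <- s) `|x i.2 - x i.1| < e.
  by apply: Hd => //; apply: lt_le_trans slen _; rewrite ge_min lexx.
have : \sum_(i <- s) (i.2 - i.1) < e.
  by apply: lt_le_trans slen _; rewrite ge_min lexx orbT.
move: sf; rewrite -mulr_sumr big_split /=.
set S1 := \sum_(i <- s) _; set S2 := \sum_(i <- s) _; nra.
Qed.

Lemma ae_derivable_primitive (g : R -> R) :
  mu.-integrable setT (EFin \o g) ->
  let F x := \int[mu]_(t in `]-oo, x]) g t in
  {ae mu, forall t, derivable F t 1 /\ 'D_1 F t = g t}.
Proof.
move=> ig F; have : {ae mu, forall x, derivable F x 1 /\ derive1 F x = g x}.
  apply: FTC1Ny.
    by move=> y; apply: integrableS ig.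
  split; [apply/measurable_EFinP; exact: measurable_int ig | exact: openT |].
  move=> K _ cK; have /integrableP[_] : mu.-integrable K (EFin \o g).
    by apply: integrableS ig => //; exact: compact_measurable.
  by [].
by apply: filterS; [exact: (ae_filter_ringOfSetsType mu) | move=> t; rewrite derive1E].
Qed.

Lemma primitive_sub (g : R -> R) (u v : R) : u <= v ->
  mu.-integrable setT (EFin \o g) ->
  \int[mu]_(t in `]-oo, v]) g t - \int[mu]_(t in `]-oo, u]) g t =
  \int[mu]_(t in `]u, v]) g t.
Proof.
move=> uv ig; rewrite Rintegral_itvB //.
by apply: integrableS ig.
Qed.

End AlmostEverywhere.

(** * Comparison of increments with integrals *)

Section Integrals.
Context {R : realType}.
Local Notation mu := (@lebesgue_measure R).

Import HBNNSimple.

(* Neither function is assumed measurable: an integral is a supremum over simple functions,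
   and these can be set to zero on the null set. *)
Lemma ge0_integral_eq_off_null (N : set R) (f g : R -> \bar R) :
  measurable N -> mu N = 0%E -> (forall x, 0 <= f x)%E -> (forall x, 0 <= g x)%E ->
  (forall x, ~ N x -> f x = g x) ->
  (\int[mu]_x f x = \int[mu]_x g x)%E.
Proof.
move=> mN N0.
suff half (f' g' : R -> \bar R) : (forall x, 0 <= f' x)%E -> (forall x, 0 <= g' x)%E ->
    (forall x, ~ N x -> f' x = g' x) -> (\int[mu]_x f' x <= \int[mu]_x g' x)%E.
  move=> f0 g0 fg; apply/eqP; rewrite eq_le !half //.
  by move=> x /fg ->.
move=> f0 g0 fg; rewrite ge0_integralTE //; apply: ge_ereal_sup => _ [h hf <-].
rewrite ge0_integralTE //; apply: ereal_sup_ubound => /=.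
have mNC : measurable (~` N) by exact: measurableC.
exists (proj_nnsfun h mNC).
  move=> x; rewrite /= mindicE; have [|_] := boolP (x \in _); last by rewrite mulr0 g0.
  by rewrite inE => nx; rewrite mulr1 -fg.
rewrite -!integralT_nnsfun; apply: ge0_ae_eq_integral => //.
- by apply/measurable_EFinP.
- by apply/measurable_EFinP.
- by move=> x _; rewrite lee_fin.
- by move=> x _; rewrite lee_fin.
exists N; split => // x; apply: contra_notP => nx _ /=.
by rewrite mindicE mem_set ?mulr1.
Qed.

(** The integrand of the action contains a derivative that is not known to be measurable. The
    positive and negative parts are compared separately, since nonnegative integrals agree off a
    null set without measurability. *)
Lemma Rintegral_eq_ae (a b : R) (f g : R -> R) :
  {ae mu, forall t, a < t < b -> f t = g t} ->
  \int[mu]_(t in `[a, b]) f t = \int[mu]_(t in `[a, b]) g t.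
Proof.
move=> fg; have : mu.-negligible (~` [set t | a < t < b -> f t = g t] `|` ([set a] `|` [set b])).
  apply: negligibleU => //; apply: negligibleU; apply/negligibleP => //; exact: lebesgue_measure_set1.
move=> [N [mN N0 subN]].
have E t : ~ N t -> (EFin \o f \_ `[a, b]) t = (EFin \o g \_ `[a, b]) t.
  move=> nt; rewrite /= !patchE; case: ifPn => //; rewrite inE /= in_itv /= => /andP[at_ tb].
  congr EFin; have : a < t < b -> f t = g t by apply: contrapT => h; apply: nt; apply: subN; left.
  apply; rewrite !lt_neqAle at_ tb !andbT; apply/andP; split; apply/eqP => h.
    by apply: nt; apply: subN; right; left.
  by apply: nt; apply: subN; right; right.
have EP (h : R -> R) : (fun t => (h t)%:E) \_ `[a, b] = EFin \o h \_ `[a, b].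
  by apply/funext => t; rewrite /= !patchE; case: ifP.
rewrite /Rintegral integral_mkcond [in RHS]integral_mkcond !EP integralE [in RHS]integralE.
congr (fine (_ - _)); apply: (ge0_integral_eq_off_null mN N0) => // t /E.
  by rewrite !funeposE => ->.
by rewrite !funenegE => ->.
Qed.

(** This is a source of integrability: [p] is only measurable and nonnegative. Its truncations are
    bounded, so their primitives are Lipschitz and [ae_nondecreasing] applies; monotone convergence
    removes the truncation. *)
Lemma integral_le_increment (V : normedModType R) (x : R -> V) (f p : R -> R) (C a b : R) :
  a <= b -> 0 <= C -> abs_cont_on a b x ->
  (forall u v, a <= u -> u <= v -> v <= b ->
     f u - f v <= C * (`|x v - x u| + (v - u))) ->
  measurable_fun setT p -> (forall t, 0 <= p t) ->
  {ae mu, forall t, a < t < b -> derivable f t 1 /\ p t <= 'D_1 f t} ->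
  (\int[mu]_(t in `[a, b]) (p t)%:E <= (f b - f a)%:E)%E.
Proof.
move=> ab C0 ac ctl mp p0 good.
pose q (n : nat) t := Num.min (p t) n%:R.
have q0 n t : 0 <= q n t by rewrite /q le_min p0 ler0n.
have qn n t : q n t <= n%:R by rewrite /q ge_min lexx orbT.
have qp n t : q n t <= p t by rewrite /q ge_min lexx.
have mq n : measurable_fun setT (q n) by apply: measurable_minr.
suff key n : (\int[mu]_(t in `[a, b]) (q n t)%:E <= (f b - f a)%:E)%E.
  have cvq t : (fun n => (q n t)%:E) @ \oo --> (p t)%:E.
    apply: cvg_near_cst; near=> n; rewrite /q min_l //; near: n; exact: nbhs_infty_ger.
  have -> : (\int[mu]_(t in `[a, b]) (p t)%:E = \int[mu]_(t in `[a, b]) limn (fun n => (q n t)%:E))%E.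
    by apply: eq_integral => t _; apply/esym/cvg_lim.
  rewrite monotone_convergence //.
  - apply: lime_le; last by apply: nearW => n; exact: key.
    apply: ereal_nondecreasing_is_cvgn => n m nm; apply: ge0_le_integral => //.
    + by move=> t _; rewrite lee_fin.
    + by apply/measurable_EFinP; apply: measurable_funS (mq n).
    + by apply/measurable_EFinP; apply: measurable_funS (mq m).
    + by move=> t _; rewrite lee_fin /q le_min ge_min lexx /= ge_min ler_nat nm orbT.
  - by move=> n; apply/measurable_EFinP; apply: measurable_funS (mq n).
  - by move=> n t _; rewrite lee_fin.
  - by move=> t _ n m nm; rewrite lee_fin /q le_min ge_min lexx /= ge_min ler_nat nm orbT.
pose g := (q n) \_ `[a, b].
have iq : mu.-integrable `[a, b] (EFin \o q n).
  apply: measurable_bounded_integrable => //.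
  - by rewrite [X in (X < _)%E]lebesgue_measure_itv /=; case: ifP => _; rewrite ?ltry.
  - by apply: measurable_funS (mq n).
  - exists n%:R; split; first exact: num_real.
    by move=> M nM t _; rewrite /= ger0_norm //; apply: le_trans (qn n t) (ltW nM).
have ig : mu.-integrable setT (EFin \o g).
  rewrite (_ : EFin \o g = (EFin \o q n) \_ `[a, b]).
    by rewrite -integrable_mkcond //; exact: measurable_itv.
  by apply/funext => t; rewrite /= /g !patchE; case: ifP.
have g0 t : 0 <= g t by rewrite /g patchE; case: ifP.
have gn t : g t <= n%:R by rewrite /g patchE; case: ifP.
have gp t : g t <= p t by rewrite /g patchE; case: ifP.
pose F t := \int[mu]_(s in `]-oo, t]) g s.
have dF : {ae mu, forall t, derivable F t 1 /\ 'D_1 F t = g t} by exact: ae_derivable_primitive ig.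
have FB u v : u <= v -> F v - F u <= n%:R * (v - u).
  move=> uv; rewrite /F primitive_sub //.
  have -> : n%:R * (v - u) = \int[mu]_(s in `]u, v]) (n%:R : R).
    rewrite Rintegral_cst // [X in fine X]lebesgue_measure_itv /= lte_fin.
    case: ltP => [//|h].
    have -> : v = u by apply: le_anti; rewrite h uv.
    by rewrite subrr mulr0.
  apply: le_Rintegral => //; first exact: integrableS ig.
  apply/measurable_bounded_integrable => //.
    by rewrite [X in (X < _)%E]lebesgue_measure_itv /=; case: ifP => _; rewrite ?ltry.
  by exists n%:R; split; [exact: num_real | move=> M nM t _ /=; rewrite ger0_norm // ltW].
have : f a - F a <= f b - F b.
  clearbody F.
  apply: (@ae_nondecreasing _ _ x (fun t => f t - F t) (C + n%:R)) => //; first by rewrite addr_ge0.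
    move=> u v au uv vb; have := ctl u v au uv vb; have := FB u v uv.
    have := ler0n R n; have := normr_ge0 (x v - x u); nra.
  apply: filterS2 good dF; first exact: (ae_filter_ringOfSetsType mu).
  move=> t gt [dFt DFt] /gt[dft Dft]; split; first exact: (derivableB dft dFt).
  by have /= -> := deriveB dft dFt; rewrite DFt; have := gp t; lra.
have -> : (\int[mu]_(t in `[a, b]) (q n t)%:E = (F b - F a)%:E)%E.
  rewrite /F primitive_sub // Rintegral_itv_obnd_cbnd; last first.
    by apply: integrableS ig.
  transitivity (fine (\int[mu]_(t in `[a, b]) (q n t)%:E)%E)%:E.
    by apply/esym/fineK; apply: integrable_fin_num.
  congr EFin; apply: eq_Rintegral => t; rewrite inE => tab; rewrite /g patchE mem_set //.
by rewrite lee_fin; lra.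
Unshelve. all: by end_near. Qed.

Lemma increment_le_integral (V : normedModType R) (x : R -> V) (f p : R -> R) (C a b : R) :
  a <= b -> 0 <= C -> abs_cont_on a b x ->
  (forall u v, a <= u -> u <= v -> v <= b ->
     f v - f u <= C * (`|x v - x u| + (v - u))) ->
  mu.-integrable setT (EFin \o p) -> (forall t, 0 <= p t) ->
  {ae mu, forall t, a < t < b -> derivable f t 1 /\ 'D_1 f t <= p t} ->
  f b - f a <= \int[mu]_(t in `[a, b]) p t.
Proof.
move=> ab C0 ac ctl ip p0 good.
pose F t := \int[mu]_(s in `]-oo, t]) p s.
have dF : {ae mu, forall t, derivable F t 1 /\ 'D_1 F t = p t} by exact: ae_derivable_primitive ip.
have F_nd u v : u <= v -> 0 <= F v - F u.
  by move=> uv; rewrite /F primitive_sub //; apply: Rintegral_ge0.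
have : F a - f a <= F b - f b.
  clearbody F.
  apply: (@ae_nondecreasing _ _ x (fun t => F t - f t) C) => //.
    by move=> u v au uv vb; have := ctl u v au uv vb; have := F_nd u v uv; lra.
  apply: filterS2 good dF; first exact: (ae_filter_ringOfSetsType mu).
  move=> t gt [dFt DFt] /gt[dft Dft]; split; first exact: (derivableB dFt dft).
  by have /= -> := deriveB dFt dft; rewrite DFt; lra.
have : F b - F a = \int[mu]_(t in `[a, b]) p t.
  rewrite /F primitive_sub // Rintegral_itv_obnd_cbnd //.
  by apply: integrableS ip.
lra.
Qed.

(** The upper limit is measurable and defined everywhere; [fine] and the absolute value supply a
    finite nonnegative value where the sequence misbehaves. *)
Lemma measurable_ae_limit (a b : R) (pn : nat -> R -> R) (p : R -> R) :
  (forall n, measurable_fun setT (pn n)) ->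
  {ae mu, forall t, a < t < b -> pn ^~ t @ \oo --> p t /\ 0 <= p t} ->
  exists q : R -> R, [/\ measurable_fun setT q, forall t, 0 <= q t &
    {ae mu, forall t, a < t < b -> p t = q t}].
Proof.
move=> mpn good; pose q t := `|fine (limn_esup (fun n => (pn n t)%:E))|.
exists q; split.
- apply: measurableT_comp => //; apply: measurableT_comp => //.
  by apply: measurable_fun_limn_esup => n; apply/measurable_EFinP.
- by move=> t; rewrite /q.
apply: filterS good; first exact: (ae_filter_ringOfSetsType mu).
move=> t gt /gt[pt pt0]; rewrite /q.
have cv : (fun n => (pn n t)%:E) @ \oo --> (p t)%:E by apply: cvg_EFin => //; exact: nearW.
by rewrite is_cvg_limn_esupE; [rewrite (cvg_lim _ cv) //= ger0_norm | apply/cvg_ex; exists (p t)%:E].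
Qed.

End Integrals.

(** * Closed characteristics *)

Section Gauge.
Context {R : realType} {V : normedModType R}.
Implicit Types (C : set V) (z : V) (s t : R).

Lemma gauge_le C z t : 0 <= t -> scale_set t C z -> gauge C z <= t.
Proof. by move=> t0 Cz; apply: ge_inf => //; exists 0 => ? -[]. Qed.

Lemma gauge_le1 C z : C z -> gauge C z <= 1.
Proof. by move=> Cz; apply: gauge_le => //; exists z => //; rewrite scale1r. Qed.

Lemma gauge_absorbing C z : (C°) 0 -> exists2 t, 0 <= t & scale_set t C z.
Proof.
move=> /nbhs_ballP[e /= e0 eC].
pose t := 2 * (`|z| + 1) / e.
have z0 := normr_ge0 z.
have t0 : 0 < t by rewrite /t; apply: divr_gt0 => //; lra.
exists t; first exact: ltW.
exists (t^-1 *: z); last by rewrite scalerA divff ?scale1r ?gt_eqF.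
apply: eC; rewrite -ball_normE /= sub0r normrN normrZ gtr0_norm ?invr_gt0 //.
rewrite mulrC ltr_pdivrMr // /t mulrCA divff ?gt_eqF // mulr1; lra.
Qed.

Lemma gauge_ge C z s : (C°) 0 ->
  (forall t, 0 <= t -> scale_set t C z -> s <= t) -> s <= gauge C z.
Proof.
move=> C0 H; apply: lb_le_inf; last by move=> t [t0 /H]; apply.
by have [t t0 Ct] := gauge_absorbing z C0; exists t.
Qed.

Lemma gauge0 C : (C°) 0 -> gauge C 0 = 0.
Proof.
move=> C0; apply/eqP; rewrite eq_le gauge_ge // andbT gauge_le //.
by exists 0; [exact: interior_subset | rewrite scaler0].
Qed.

Lemma gauge_scale_le C z s : (C°) 0 -> 0 < s -> gauge C (s *: z) <= s * gauge C z.
Proof.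
move=> C0 s0; rewrite mulrC -ler_pdivrMr //; apply: gauge_ge => // t t0 [c Cc ctz].
rewrite ler_pdivrMr // mulrC; apply: gauge_le; first by rewrite mulr_ge0 // ltW.
by exists c => //; rewrite -ctz scalerA.
Qed.

(** Admissible factors slightly above 1 give points of [C] arbitrarily close to [z], and [C] is
    closed. *)
Lemma gauge_le1_mem C z : convex_set C -> closed C -> (C°) 0 -> gauge C z <= 1 -> C z.
Proof.
move=> cC clC C0 gz; apply: contrapT => nCz.
have /nbhs_ballP[e /= e0 eC] : nbhs z (~` C).
  by apply: open_nbhs_nbhs; split => //; exact: closed_openC.
have z0 := normr_ge0 z.
have d0 : 0 < e / 2 / (`|z| + 1) by apply: divr_gt0; lra.
have [|t [t0 [c Cc tcz]] td] := @inf_adherent _ [set t : R | 0 <= t /\ scale_set t C z] _ d0.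
  split; last by exists 0 => ? -[].
  by have [t t0 Ct] := gauge_absorbing z C0; exists t.
have Cz0 : C 0 by exact: interior_subset.
have [t1|t1] := leP t 1.
  apply: nCz; rewrite -tcz; have := cC c 0 Cc Cz0 t; rewrite scaler0 addr0; apply.
  by rewrite t0.
have : (~` C) c; last by [].
apply: eC; rewrite -ball_normE /=.
have -> : z - c = (t - 1) *: c by rewrite scalerBl tcz scale1r.
have : `|z| = t * `|c| by rewrite -tcz normrZ gtr0_norm //; lra.
rewrite normrZ gtr0_norm; last lra.
have c0 := normr_ge0 c.
move: td; rewrite -/(gauge C z) => td zc.
have td' : t - 1 < e / 2 / (`|z| + 1) by lra.
have : (t - 1) * (`|z| + 1) < e / 2 by rewrite -ltr_pdivlMr //; lra.
nra.
Qed.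

End Gauge.

Section Coordinates.
Context {R : realType}.
Local Notation R2 := (R * R)%type.
Local Notation R4 := ((R * R) * (R * R))%type.

Lemma norm_coord1 (p : R2) : `|p.1| <= `|p|.
Proof. by rewrite prod_normE le_max lexx. Qed.

Lemma norm_coord2 (p : R2) : `|p.2| <= `|p|.
Proof. by rewrite prod_normE le_max lexx orbT. Qed.

Lemma norm_part1 (z : R4) : `|z.1| <= `|z|.
Proof. by rewrite prod_normE le_max lexx. Qed.

Lemma norm_part2 (z : R4) : `|z.2| <= `|z|.
Proof. by rewrite [leRHS]prod_normE le_max lexx orbT. Qed.

Lemma dot2_le_norm (u v : R2) : `|dot2 u v| <= (`|u.1| + `|u.2|) * `|v|.
Proof.
rewrite /dot2 (le_trans (ler_normD _ _)) // !normrM mulrDl.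
by rewrite lerD // ler_wpM2l // ?norm_coord1 ?norm_coord2.
Qed.

Lemma dot2C (u v : R2) : dot2 u v = dot2 v u.
Proof. by rewrite /dot2; ring. Qed.
Lemma dot2Dl (u v w : R2) : dot2 (u + v) w = dot2 u w + dot2 v w.
Proof. by rewrite /dot2 /=; ring. Qed.
Lemma dot2Dr (u v w : R2) : dot2 w (u + v) = dot2 w u + dot2 w v.
Proof. by rewrite /dot2 /=; ring. Qed.
Lemma dot2Nl (u w : R2) : dot2 (- u) w = - dot2 u w.
Proof. by rewrite /dot2 /=; ring. Qed.
Lemma dot2Nr (u w : R2) : dot2 w (- u) = - dot2 w u.
Proof. by rewrite /dot2 /=; ring. Qed.
Lemma dot2Bl (u v w : R2) : dot2 (u - v) w = dot2 u w - dot2 v w.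
Proof. by rewrite dot2Dl dot2Nl. Qed.
Lemma dot2Br (u v w : R2) : dot2 w (u - v) = dot2 w u - dot2 w v.
Proof. by rewrite dot2Dr dot2Nr. Qed.
Lemma dot2Zl (c : R) (u w : R2) : dot2 (c *: u) w = c * dot2 u w.
Proof. by rewrite /dot2 /= /GRing.scale /=; ring. Qed.
Lemma dot2Zr (c : R) (u w : R2) : dot2 w (c *: u) = c * dot2 w u.
Proof. by rewrite dot2C dot2Zl dot2C. Qed.
Lemma dot20l (w : R2) : dot2 0 w = 0.
Proof. by rewrite /dot2 /= !mul0r addr0. Qed.
Lemma dot20r (w : R2) : dot2 w 0 = 0.
Proof. by rewrite dot2C dot20l. Qed.

Definition dot2E := (dot2Dl, dot2Dr, dot2Bl, dot2Br, dot2Nl, dot2Nr, dot2Zl, dot2Zr, dot20l, dot20r).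

Lemma is_derive_linear (V : normedModType R) (l : V -> R) (x : R -> V) (t : R) :
  continuous l -> (forall u v, l (u - v) = l u - l v) ->
  (forall c u, l (c *: u) = c * l u) -> derivable x t 1 ->
  is_derive t 1 (l \o x) (l ('D_1 x t)).
Proof.
move=> cl lB lZ dx.
have cv : (fun h => h^-1 *: ((l \o x) (h *: 1 + t) - (l \o x) t)) @ 0^' --> l ('D_1 x t).
  have -> : (fun h => h^-1 *: ((l \o x) (h *: 1 + t) - (l \o x) t)) =
            l \o (fun h => h^-1 *: (x (h *: (1 : R) + t) - x t)).
    by apply/funext => h /=; rewrite lZ lB.
  exact: (cvg_comp _ _ dx (cl _)).
apply: DeriveDef; first by apply/cvg_ex; exists (l ('D_1 x t)).
by apply/cvg_lim.
Qed.

Lemma is_derive_coord (x : R -> R4) (t : R) : derivable x t 1 ->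
  [/\ is_derive t 1 (fun s => (x s).1.1) ('D_1 x t).1.1,
      is_derive t 1 (fun s => (x s).1.2) ('D_1 x t).1.2,
      is_derive t 1 (fun s => (x s).2.1) ('D_1 x t).2.1 &
      is_derive t 1 (fun s => (x s).2.2) ('D_1 x t).2.2].
Proof.
move=> dx; split.
- apply: (@is_derive_linear _ (fun z : R4 => z.1.1)) => // z.
  by apply: (@cvg_comp _ _ _ (fst : R4 -> R2) fst); exact: cvg_fst.
- apply: (@is_derive_linear _ (fun z : R4 => z.1.2)) => // z.
  by apply: (@cvg_comp _ _ _ (fst : R4 -> R2) snd); [exact: cvg_fst|exact: cvg_snd].
- apply: (@is_derive_linear _ (fun z : R4 => z.2.1)) => // z.
  by apply: (@cvg_comp _ _ _ (snd : R4 -> R2) fst); [exact: cvg_snd|exact: cvg_fst].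
- apply: (@is_derive_linear _ (fun z : R4 => z.2.2)) => // z.
  by apply: (@cvg_comp _ _ _ (snd : R4 -> R2) snd); exact: cvg_snd.
Qed.

(** A sequence of difference quotients, rather than a filter, is what the measurability of limits
    needs. *)
Lemma derive_seq_cvg (c : R -> R) (t : R) : derivable c t 1 ->
  (fun n => n.+1%:R * (c (t + n.+1%:R^-1) - c t)) @ \oo --> 'D_1 c t.
Proof.
move=> dc.
have cv : (fun n : nat => n.+1%:R^-1 : R) @ \oo --> 0^'.
  move=> A [e /= e0 eA]; have := @cvg_harmonic R.
  move=> /cvgrPdist_lt/(_ e e0); apply: filterS => n; rewrite /= => he.
  by apply: eA => //=; rewrite ?gt_eqF // invr_gt0.
have := cvg_comp _ _ cv dc; apply: cvg_trans; apply: near_eq_cvg; apply: nearW => n /=.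
by rewrite invrK [_%:A]mulr1 [_^-1 + t]addrC.
Qed.

End Coordinates.

Section Characteristics.
Context {R : realType}.
Local Notation R2 := (R * R)%type.
Local Notation R4 := ((R * R) * (R * R))%type.
Local Notation mu := (@lebesgue_measure R).

Definition normal_cone (C : set R2) (z n : R2) : Prop :=
  forall w, C w -> dot2 n w <= dot2 n z.

(** Homogeneity of the gauge, tested at [2 *: z] and at 0, gives Euler's identity; subgradients at
    boundary points are thus normals in the polar body. *)
Lemma subdiff_gauge (C : set R4) (z v : R4) : (C°) 0 -> gauge C z = 1 ->
  subdiff (gauge C) z v -> dot4 v z = 1 /\ forall w, C w -> dot4 v w <= 1.
Proof.
move=> C0 gz sv.
have vz : dot4 v z = 1.
  apply/eqP; rewrite eq_le; apply/andP; split.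
    have := sv (2 *: z); have : gauge C (2 *: z) <= 2 * gauge C z by apply: gauge_scale_le.
    rewrite gz; have -> : 2 *: z - z = z by rewrite scaler_nat mulr2n addrK.
    lra.
  have := sv 0; rewrite gauge0 // gz sub0r.
  have -> : dot4 v (- z) = - dot4 v z by rewrite /dot4 /= !dot2Nr; ring.
  lra.
split=> // w Cw; have := sv w; have := gauge_le1 Cw; rewrite gz.
have -> : dot4 v (w - z) = dot4 v w - dot4 v z by rewrite /dot4 /= !dot2Br; ring.
rewrite vz; lra.
Qed.

Lemma continuous_dot4 (u : R4) : continuous (dot4 u).
Proof.
move=> z; apply: cvgD; apply: cvgD; apply: cvgMr.
- by apply: (@cvg_comp _ _ _ (fst : R4 -> R2) fst); exact: cvg_fst.
- by apply: (@cvg_comp _ _ _ (fst : R4 -> R2) snd); [exact: cvg_fst|exact: cvg_snd].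
- by apply: (@cvg_comp _ _ _ (snd : R4 -> R2) fst); [exact: cvg_snd|exact: cvg_fst].
- by apply: (@cvg_comp _ _ _ (snd : R4 -> R2) snd); exact: cvg_snd.
Qed.

Lemma dot4B (u v w : R4) : dot4 u (v - w) = dot4 u v - dot4 u w.
Proof. by rewrite /dot4 /= !dot2Br; ring. Qed.

Lemma dot4Z (u v : R4) (c : R) : dot4 u (c *: v) = c * dot4 u v.
Proof. by rewrite /dot4 /= !dot2Zr; ring. Qed.

Lemma dot4_le_norm (u v : R4) :
  `|dot4 u v| <= (`|u.1.1| + `|u.1.2| + `|u.2.1| + `|u.2.2|) * `|v|.
Proof.
have h1 := dot2_le_norm u.1 v.1; have h2 := dot2_le_norm u.2 v.2.
have k1 := norm_part1 v; have k2 := norm_part2 v.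
rewrite /dot4; apply: le_trans (ler_normD _ _) _.
have a1 := normr_ge0 u.1.1; have a2 := normr_ge0 u.1.2.
have a3 := normr_ge0 u.2.1; have a4 := normr_ge0 u.2.2.
apply: le_trans (lerD h1 h2) _; rewrite -!addrA [leRHS]mulrDl addrA.
rewrite [leRHS](_ : _ = (`|u.1.1| + `|u.1.2|) * `|v| + (`|u.2.1| + `|u.2.2|) * `|v|); last by ring.
by rewrite lerD // ler_wpM2l // addr_ge0.
Qed.

Lemma is_derive_dot4 (x : R -> R4) (t : R) (u : R4) : derivable x t 1 ->
  is_derive t 1 (fun s => dot4 u (x s)) (dot4 u ('D_1 x t)).
Proof.
apply: (@is_derive_linear _ _ (dot4 u)) => [|v w|c v].
- exact: continuous_dot4.
- exact: dot4B.
- exact: dot4Z.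
Qed.

Lemma is_derive_dot2 (x : R -> R4) (t : R) : derivable x t 1 ->
  is_derive t 1 (fun s => dot2 (x s).1 (x s).2)
    (dot2 ('D_1 x t).1 (x t).2 + dot2 (x t).1 ('D_1 x t).2).
Proof.
move=> /is_derive_coord[d1 d2 d3 d4].
have H := is_deriveD (is_deriveM d1 d3) (is_deriveM d2 d4).
by refine (is_derive_eq H _); rewrite /dot2 /= /GRing.scale /=; ring.
Qed.

Lemma abs_cont_uniform (V : normedModType R) (x : R -> V) (a b e : R) :
  abs_cont_on a b x -> 0 < e -> exists2 d : R, 0 < d &
  forall u v, a <= u <= b -> a <= v <= b -> `|u - v| < d -> `|x u - x v| < e.
Proof.
move=> ac e0; have [d d0 H] := ac e e0; exists d => // u v uab vab.
wlog uv : u v uab vab / u <= v.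
  move=> W; have [/W|/ltW/W] := leP u v; first exact.
  by move=> /(_ vab uab); rewrite [`|v - u|]distrC [`|x v - x u|]distrC.
rewrite distrC ger0_norm ?subr_ge0 // => uvd.
have := H 1%N (fun=> u) (fun=> v); rewrite !big_ord1 distrC; apply => //.
  by move=> i _; split; [lra|split; lra].
by move=> [|//] [|//].
Qed.

Variables (K T : set R2) (x : R -> R4) (M : R).
Hypothesis cC : convex_set (K `*` T).
Hypothesis clC : closed (K `*` T).
Hypothesis C0 : ((K `*` T)°) 0.
Hypothesis CM : forall z, (K `*` T) z -> `|z| <= M.
Hypothesis ch : closed_characteristic (K `*` T) x.

Lemma characteristic_mem t : K (x t).1 /\ T (x t).2.
Proof.
have [_ _ g1 _] := ch; apply: (@gauge_le1_mem _ _ (K `*` T)) => //.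
by rewrite g1.
Qed.

(** For a product the subgradient splits into a normal of [K] and one of [T]. The normals are
    bounded because the body contains a ball around 0, on which the subgradient is at most 1; the
    speed [r] has no such bound. *)
Lemma characteristic_ae : exists2 B : R, 0 <= B &
  {ae mu, forall t, derivable x t 1 /\ exists r n m,
    [/\ 0 < r, normal_cone K (x t).1 n, normal_cone T (x t).2 m,
        dot2 n (x t).1 + dot2 m (x t).2 = 1 &
        `|n.1| + `|n.2| + `|m.1| + `|m.2| <= B /\
        'D_1 x t = r *: (m, - n)]}.
Proof.
have [per ac g1 ae] := ch.
have /nbhs_ballP[e /= e0 eC] := C0.
(* Testing with vectors of size [e / 2] along the axes bounds each of the four coordinates by
   [2 / e]. *)
exists (8 / e); first by rewrite divr_ge0 // ltW.
apply: filterS ae; first exact: (ae_filter_ringOfSetsType mu).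
move=> t [dx [r r0 [[n m] /(subdiff_gauge C0 (g1 t))[vz vC] Dx]]]; split=> //.
have [Kq Tp] := characteristic_mem t.
exists r, n, m; split=> //.
- by move=> w Kw; have := vC (w, (x t).2) (conj Kw Tp); move: vz; rewrite /dot4 /=; lra.
- by move=> w Tw; have := vC ((x t).1, w) (conj Kq Tw); move: vz; rewrite /dot4 /=; lra.
have bnd (a1 a2 a3 a4 : R) : `|a1| < e -> `|a2| < e -> `|a3| < e -> `|a4| < e ->
    n.1 * a1 + n.2 * a2 + (m.1 * a3 + m.2 * a4) <= 1.
  move=> h1 h2 h3 h4; apply: (vC ((a1, a2), (a3, a4))); apply: eC.
  by rewrite -ball_normE /= sub0r normrN !prod_normE /= !gt_max h1 h2 h3 h4.
have z0 : `|0 : R| < e by rewrite normr0.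
have p0 : `|e / 2| < e by rewrite gtr0_norm; lra.
have n0 : `|- (e / 2)| < e by rewrite normrN gtr0_norm; lra.
have aux (c : R) : c * (e / 2) <= 1 -> c * (- (e / 2)) <= 1 -> `|c| <= 2 / e.
  move=> h1 h2; rewrite ler_norml; apply/andP; split.
    rewrite lerNl ler_pdivlMr //; lra.
  rewrite ler_pdivlMr //; lra.
split=> //.
have -> : 8 / e = 2 / e + 2 / e + 2 / e + 2 / e by field; rewrite gt_eqF.
rewrite !lerD //; apply: aux.
- by have := bnd _ _ _ _ p0 z0 z0 z0; lra.
- by have := bnd _ _ _ _ n0 z0 z0 z0; lra.
- by have := bnd _ _ _ _ z0 p0 z0 z0; lra.
- by have := bnd _ _ _ _ z0 n0 z0 z0; lra.
- by have := bnd _ _ _ _ z0 z0 p0 z0; lra.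
- by have := bnd _ _ _ _ z0 z0 n0 z0; lra.
- by have := bnd _ _ _ _ z0 z0 z0 p0; lra.
- by have := bnd _ _ _ _ z0 z0 z0 n0; lra.
Qed.

End Characteristics.

Section CharacteristicAction.
Context {R : realType}.
Local Notation R2 := (R * R)%type.
Local Notation R4 := ((R * R) * (R * R))%type.
Local Notation mu := (@lebesgue_measure R).

Lemma abs_cont_onS (V : normedModType R) (x : R -> V) (a b u v : R) :
  a <= u -> v <= b -> abs_cont_on a b x -> abs_cont_on u v x.
Proof.
move=> au vb ac e e0; have [d d0 H] := ac e e0; exists d => // n s t st.
by apply: H => i /st [h1 [h2 h3]]; split; [exact: le_trans h1 | split => //; exact: le_trans vb].
Qed.

Lemma dot4_control (x : R -> R4) (w : R4) (u v : R) :
  dot4 w (x v) - dot4 w (x u) <=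
  (`|w.1.1| + `|w.1.2| + `|w.2.1| + `|w.2.2|) * `|x v - x u|.
Proof. by rewrite -dot4B; apply: le_trans (ler_norm _) (dot4_le_norm _ _). Qed.

Lemma dot2_control (x : R -> R4) (M u v : R) : `|x u| <= M -> `|x v| <= M ->
  `|dot2 (x v).1 (x v).2 - dot2 (x u).1 (x u).2| <= 4 * M * `|x v - x u|.
Proof.
move=> xu xv.
have -> : dot2 (x v).1 (x v).2 - dot2 (x u).1 (x u).2 =
  dot4 ((x v).2, (x u).1) (x v - x u) by rewrite /dot4 /dot2 /=; ring.
apply: le_trans (dot4_le_norm _ _) _; apply: ler_wpM2r => //=.
have h1 := le_trans (norm_part1 (x u)) xu; have h2 := le_trans (norm_part2 (x v)) xv.
have k1 := le_trans (norm_coord1 (x u).1) h1; have k2 := le_trans (norm_coord2 (x u).1) h1.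
have k3 := le_trans (norm_coord1 (x v).2) h2; have k4 := le_trans (norm_coord2 (x v).2) h2.
lra.
Qed.

(** A monotone function with equal end values is constant, so its derivative vanishes at every
    interior time and not only almost everywhere. *)
Lemma derive0_of_ae_ge0 (V : normedModType R) (x : R -> V) (f : R -> R) (C : R) :
  0 <= C -> abs_cont_on 0 1 x ->
  (forall u v, 0 <= u -> u <= v -> v <= 1 -> f u - f v <= C * (`|x v - x u| + (v - u))) ->
  {ae mu, forall t, 0 < t < 1 -> derivable f t 1 /\ 0 <= 'D_1 f t} ->
  f 0 = f 1 -> forall t, 0 < t < 1 -> 'D_1 f t = 0.
Proof.
move=> C0 ac ctl good f01 t t01.
have mono u v : 0 <= u -> u <= v -> v <= 1 -> f u <= f v.
  move=> u0 uv v1; apply: (@ae_nondecreasing _ _ x f C) => //.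
  - exact: abs_cont_onS ac.
  - by move=> a b ua ab bv; apply: ctl => //; [exact: le_trans ua | exact: le_trans v1].
  - apply: filterS good; first exact: (ae_filter_ringOfSetsType mu).
    by move=> s gs /andP[us sv]; apply: gs; rewrite (le_lt_trans u0 us) (lt_le_trans sv v1).
have fconst s : 0 <= s <= 1 -> f s = f 0.
  move=> /andP[s0 s1]; apply: le_anti; rewrite f01 mono //=.
  by rewrite -f01 mono.
have -> : 'D_1 f t = 'D_1 (cst (f 0)) t.
  apply: near_eq_derive.
  have : \forall s \near t, s \in `]0, 1[ by apply: near_in_itvoo; rewrite in_itv.
  apply: filterS => s; rewrite in_itv /= => /andP[s0 s1].
  by rewrite fconst // !ltW.
exact: derive_cst.
Qed.

Lemma ae_exists_itv (P : R -> Prop) : {ae mu, forall t, P t} -> exists2 t, 0 < t < 1 & P t.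
Proof.
move=> [N [mN N0 subN]]; apply: contrapT => H.
have : (mu `]0%R, 1%R[%classic <= mu N)%E.
  apply: le_measure; rewrite ?inE //.
  move=> t /=; rewrite in_itv /= => t01; apply: subN => Pt; apply: H; by exists t.
rewrite N0 lebesgue_measure_itv /= lte_fin ltr01 sube0 lee_fin; lra.
Qed.

Variables (K T : set R2) (x : R -> R4) (M : R).
Hypothesis cC : convex_set (K `*` T).
Hypothesis clC : closed (K `*` T).
Hypothesis C0 : ((K `*` T)°) 0.
Hypothesis CM : forall z, (K `*` T) z -> `|z| <= M.
Hypothesis ch : closed_characteristic (K `*` T) x.

Let mem := characteristic_mem cC clC C0 ch.
Let xM t : `|x t| <= M. Proof. by apply: CM; apply: mem. Qed.
Let M0 : 0 <= M. Proof. exact: le_trans (xM 0). Qed.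
Let ac : abs_cont_on 0 1 x. Proof. by have [] := ch. Qed.
Let x01 : x 0 = x 1. Proof. by have [/(_ 0) <-] := ch; rewrite add0r. Qed.

(** The position cannot be translated along [- w] into the interior of [K]. Otherwise every nonzero
    normal [n] along it pairs positively with [w], so the momentum component along [- w] never
    decreases; being periodic, it is constant, whence [n = 0] almost everywhere. Then the pairing of
    position and momentum grows strictly, against periodicity. *)
Lemma characteristic_touch (w : R2) :
  exists2 t, 0 <= t <= 1 & forall e, 0 < e -> ~ (K°) ((x t).1 - e *: w).
Proof.
apply: contrapT => H.
have inK t : 0 < t < 1 -> exists2 e : R, 0 < e & (K°) ((x t).1 - e *: w).
  move=> /andP[t0 t1]; apply: contrapT => h; apply: H; exists t; first by rewrite !ltW.
  by move=> e e0 Ke; apply: h; exists e.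
have [B B0 ae] := characteristic_ae cC clC C0 ch.
have npos t n : 0 < t < 1 -> normal_cone K (x t).1 n -> n != 0 -> 0 < dot2 n w.
  move=> /inK[e e0 /nbhs_ballP[d /= d0 dK]] nK n0.
  have nn : 0 < dot2 n n.
    rewrite /dot2 -!expr2 lt_neqAle addr_ge0 ?sqr_ge0 // andbT eq_sym.
    apply: contra n0; rewrite paddr_eq0 ?sqr_ge0 // !sqrf_eq0 => /andP[/eqP h1 /eqP h2].
    by rewrite (surjective_pairing n) h1 h2.
  pose c := d / 2 / (`|n| + 1).
  have c0 : 0 < c by rewrite /c; apply: divr_gt0; have := normr_ge0 n; lra.
  have : K ((x t).1 - e *: w + c *: n).
    apply: dK; rewrite -ball_normE /= opprD addNKr normrN normrZ gtr0_norm //.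
    have := normr_ge0 n => hn; rewrite /c mulrAC ltr_pdivrMr; last lra.
    have := mulr_ge0 (ltW d0) hn; nra.
  by move=> /nK; rewrite !dot2E; nra.
pose C := `|w.1| + `|w.2|.
have D0 : forall t, 0 < t < 1 -> 'D_1 (fun s => dot4 (0, - w) (x s)) t = 0.
  apply: (@derive0_of_ae_ge0 _ x _ C) => //.
  - by rewrite /C addr_ge0.
  - move=> u v u0 uv v1; have := dot4_control x (0, - w) v u.
    rewrite /= !normr0 !normrN !add0r distrC -/C.
    have : 0 <= C * (v - u) by rewrite mulr_ge0 ?subr_ge0 // /C addr_ge0.
    nra.
  - apply: filterS ae; first exact: (ae_filter_ringOfSetsType mu).
    move=> t [dx [r [n [m [r0 nK nT nm1 [_ Dx]]]]]] t01.
    have d := is_derive_dot4 (0, - w) dx.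
    split; first by case: d.
    rewrite (@derive_val _ _ _ _ _ _ _ d) Dx /dot4 /= !dot2E (dot2C w n).
    have [->|n0] := eqVneq n 0; first by rewrite dot20l; lra.
    by have := npos t n t01 nK n0; nra.
  - by rewrite x01.
have D1 : forall t, 0 < t < 1 -> 'D_1 (fun s => dot2 (x s).1 (x s).2) t = 0.
  apply: (@derive0_of_ae_ge0 _ x _ (4 * M)) => //.
  - by rewrite mulr_ge0.
  - move=> u v u0 uv v1; have := dot2_control (xM u) (xM v).
    rewrite ler_norml => /andP[h1 h2]; have : 0 <= 4 * M * (v - u) by rewrite !mulr_ge0 ?subr_ge0.
    nra.
  - apply: filterS ae; first exact: (ae_filter_ringOfSetsType mu).
    move=> t [dx [r [n [m [r0 nK nT nm1 [_ Dx]]]]]] t01.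
    have d := is_derive_dot2 dx.
    split; first by case: d.
    rewrite (@derive_val _ _ _ _ _ _ _ d) Dx /=.
    have [n0|n0] := eqVneq n 0; first by move: nm1; rewrite n0 !dot2E; nra.
    have := D0 t t01; rewrite (@derive_val _ _ _ _ _ _ _ (is_derive_dot4 (0, - w) dx)) Dx /dot4 /=.
    have := npos t n t01 nK n0; rewrite !dot2E (dot2C w n); nra.
  - by rewrite x01.
have [t t01 [dx [r [n [m [r0 nK nT nm1 [_ Dx]]]]]]] := ae_exists_itv ae.
have := D1 t t01; rewrite (@derive_val _ _ _ _ _ _ _ (is_derive_dot2 dx)) Dx /=.
have [n0|n0] := eqVneq n 0; first by move: nm1; rewrite n0 !dot2E; nra.
have := D0 t t01; rewrite (@derive_val _ _ _ _ _ _ _ (is_derive_dot4 (0, - w) dx)) Dx /dot4 /=.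
have := npos t n t01 nK n0; rewrite !dot2E (dot2C w n); nra.
Qed.

Let psi t := - dot4 (J4 ('D_1 x t)) (x t).

(** The density is almost everywhere a limit of expressions in difference quotients of continuous
    functions. *)
Let measurable_density : exists q : R -> R, [/\ measurable_fun setT q,
  forall t, 0 <= q t & {ae mu, forall t, 0 < t < 1 -> psi t = q t}].
Proof.
have [B B0 ae] := characteristic_ae cC clC C0 ch.
(* Absolute continuity is available on the unit interval; clamping the time gives functions that are
   continuous on the whole line. *)
pose cl (t : R) := Num.max 0 (Num.min t 1).
have cl01 t : 0 <= cl t <= 1.
  by rewrite /cl le_max lexx /= ge_max ler01 ge_min lexx orbT.
have clid t : 0 <= t <= 1 -> cl t = t.
  by move=> /andP[t0 t1]; rewrite /cl min_l // max_r.
have clL u v : `|cl u - cl v| <= `|u - v|.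
  have clE s : [\/ s <= 0 /\ cl s = 0, 0 <= s <= 1 /\ cl s = s | 1 <= s /\ cl s = 1].
    rewrite /cl; case: (leP s 0) => [s0|s0].
      by constructor 1; rewrite min_l ?max_l //; lra.
    case: (leP s 1) => [s1|s1]; [constructor 2 | constructor 3].
      by rewrite max_r ?(ltW s0).
    by rewrite max_r ?(ltW s1).
  have := ler_norm (u - v); have := ler_norm (v - u); rewrite (distrC v u) ler_norml.
  by case: (clE u) => -[h1 ->]; case: (clE v) => -[h2 ->]; lra.
have mcoord (l : R4 -> R) : (forall z z', `|l z - l z'| <= `|z - z'|) ->
    measurable_fun setT (fun t => l (x (cl t))).
  move=> lL; apply: continuous_measurable_fun => t; apply/cvgrPdist_lt => e e0.
  have [d d0 H] := abs_cont_uniform ac e0.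
  apply/nbhs_ballP; exists d => //= s ts.
  apply: le_lt_trans (lL _ _) _; apply: H => //.
  exact: le_lt_trans (clL _ _) ts.
have m1 := mcoord (fun z => z.1.1) (fun z z' => le_trans (norm_coord1 (z - z').1) (norm_part1 _)).
have m2 := mcoord (fun z => z.1.2) (fun z z' => le_trans (norm_coord2 (z - z').1) (norm_part1 _)).
have m3 := mcoord (fun z => z.2.1) (fun z z' => le_trans (norm_coord1 (z - z').2) (norm_part2 _)).
have m4 := mcoord (fun z => z.2.2) (fun z z' => le_trans (norm_coord2 (z - z').2) (norm_part2 _)).
pose dq (c : R -> R) (n : nat) t := n.+1%:R * (c (t + n.+1%:R^-1) - c t).
have mdq c n : measurable_fun setT c -> measurable_fun setT (dq c n).
  move=> mc; apply: measurable_funM => //; apply: measurable_funB => //.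
  by apply: (measurableT_comp mc); apply: measurable_funD.
pose pn n t := dq (fun t => (x (cl t)).1.1) n t * (x (cl t)).2.1 +
               dq (fun t => (x (cl t)).1.2) n t * (x (cl t)).2.2 -
               dq (fun t => (x (cl t)).2.1) n t * (x (cl t)).1.1 -
               dq (fun t => (x (cl t)).2.2) n t * (x (cl t)).1.2.
apply: (@measurable_ae_limit _ 0 1 pn).
  move=> n; apply: measurable_funB; last by apply: measurable_funM => //; exact: mdq.
  apply: measurable_funB; last by apply: measurable_funM => //; exact: mdq.
  by apply: measurable_funD; apply: measurable_funM => //; exact: mdq.
apply: filterS ae; first exact: (ae_filter_ringOfSetsType mu).
move=> t [dx [r [n [m [r0 nK nT nm1 [_ Dx]]]]]] /andP[t0 t1].
have clt : cl t = t by apply: clid; rewrite !ltW.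
split; last by rewrite /psi Dx /J4 /dot4 /= !dot2E; nra.
have cvdq (l : R4 -> R) D : is_derive t 1 (fun s => l (x s)) D ->
    (fun n => dq (fun s => l (x (cl s))) n t) @ \oo --> D.
  move=> d; have := derive_seq_cvg (@ex_derive _ _ _ _ _ _ _ d); rewrite (@derive_val _ _ _ _ _ _ _ d).
  apply: cvg_trans; apply: near_eq_cvg.
  have t10 : 0 < 1 - t by lra.
  near=> k; rewrite /dq clt clid //.
  have k0 : 0 < k.+1%:R^-1 :> R by rewrite invr_gt0.
  have : `|0 - k.+1%:R^-1 : R| < 1 - t.
    near: k; move: t10; move: (1 - t); apply/cvgrPdist_lt; exact: cvg_harmonic.
  by rewrite sub0r normrN gtr0_norm //; move: k0; set z := _^-1 => k0; lra.
have [d1 d2 d3 d4] := is_derive_coord dx.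
have -> : psi t = ('D_1 x t).1.1 * (x t).2.1 + ('D_1 x t).1.2 * (x t).2.2 -
   ('D_1 x t).2.1 * (x t).1.1 - ('D_1 x t).2.2 * (x t).1.2.
  by rewrite /psi /dot4 /dot2 /J4 /=; ring.
rewrite /pn clt; apply: cvgB; first apply: cvgB; first apply: cvgD; apply: cvgMl.
- exact: (cvdq (fun z => z.1.1)).
- exact: (cvdq (fun z => z.1.2)).
- exact: (cvdq (fun z => z.2.1)).
- exact: (cvdq (fun z => z.2.2)).
Unshelve. all: by end_near. Qed.

(** Write x = (q, p), so that q' = r m and p' = - r n, and [F] is a primitive of r, the density of
    twice the action. Then r + <q, p>' = 2 r <m, p>, which is twice the support function of [T] at
    q' and so at least 2 <P, q'> for every [P] in [T]. *)
Lemma characteristic_primitive : exists F : R -> R,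
  2 * action x = F 1 - F 0 /\
  forall a b P, 0 <= a -> a <= b -> b <= 1 -> T P ->
    2 * (dot2 P (x b).1 - dot2 P (x a).1) -
    (dot2 (x b).1 (x b).2 - dot2 (x a).1 (x a).2) <= F b - F a.
Proof.
have [B B0 ae] := characteristic_ae cC clC C0 ch.
have [q [mq q0 qpsi]] := measurable_density.
have psir t r n m : dot2 n (x t).1 + dot2 m (x t).2 = 1 -> 'D_1 x t = r *: (m, - n) -> psi t = r.
  by move=> nm Dx; rewrite /psi Dx /J4 /dot4 /= !dot2E; nra.
have mqi (D : set R) : measurable_fun D (EFin \o q).
  by apply/measurable_EFinP; apply: measurable_funS mq.
(* Integrability of the speed r is derived locally. Let [w] be the rotated point x(t0) and v = (n,
   m). Twice the pairing of [w] with x grows at rate 2 r (1 - <v, x - x(t0)>), which is at least r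
   as long as x stays so close to x(t0) that the inner product is at most 1/2. *)
have fin01 : (\int[mu]_(t in `[0%R, 1%R]) (q t)%:E < +oo)%E.
  apply: (@step_induction _ (fun u v => (\int[mu]_(t in `[u, v]) (q t)%:E < +oo)%E)) => //.
    move=> u v w uv vw h1 h2.
    have -> : [set` `[u, w]] = [set` `[u, v]] `|` [set` `]v, w]].
      apply/seteqP; split => t /=; rewrite !in_itv /=.
        by move=> /andP[ut tw]; case: (leP t v) => h; [left; rewrite ut | right].
      by move=> [] /andP[h3 h4]; apply/andP; split; lra.
    rewrite ge0_integral_setU //=.
    - apply: lte_add_pinfty => //; apply: le_lt_trans h2.
      apply: ge0_subset_integral => //.
      + exact: mqi.
      + by move=> t _; rewrite lee_fin.
      + by move=> t /=; rewrite !in_itv /= => /andP[h3 ->]; rewrite ltW.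
    - exact: mqi.
    - by move=> t _; rewrite lee_fin.
    - rewrite disj_set2E; apply/eqP; apply/seteqP; split => // t [] /=; rewrite !in_itv /=; lra.
  move=> t0 t01.
  have e0 : 0 < (2 * (B + 1))^-1 by rewrite invr_gt0; lra.
  have [d d0 Hd] := abs_cont_uniform ac e0.
  exists d => // u v u0 v1 ut tv vud.
  pose w : R4 := ((x t0).2, - (x t0).1).
  apply: (@le_lt_trans _ _ ((2 * dot4 w (x v) - 2 * dot4 w (x u))%:E)); last exact: ltry.
  pose C := 2 * (`|w.1.1| + `|w.1.2| + `|w.2.1| + `|w.2.2|).
  have C_ge0 : 0 <= C by rewrite /C mulr_ge0 // !addr_ge0.
  apply: (@integral_le_increment _ _ x (fun s => 2 * dot4 w (x s)) q C) => //.
  - lra.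
  - exact: abs_cont_onS ac.
  - move=> s s' us ss' s'v; have := dot4_control x w s' s.
    rewrite distrC; have := mulr_ge0 C_ge0 (_ : 0 <= s' - s); rewrite subr_ge0 => /(_ ss').
    rewrite /C; nra.
  apply: filterS2 ae qpsi; first exact: (ae_filter_ringOfSetsType mu).
  move=> s [dx [r [n [m [r0 nK nT nm1 [nmB Dx]]]]]] qs /andP[us sv].
  have s01 : 0 < s < 1 by lra.
  have d2 := @is_deriveZ _ _ _ _ 2 _ _ _ (is_derive_dot4 w dx).
  split; first by case: d2.
  rewrite (@derive_val _ _ _ _ _ _ _ d2) -qs // (psir _ _ _ _ nm1 Dx) Dx.
  have : dot4 (n, m) (x s - x t0) <= 1 / 2.
    apply: le_trans (ler_norm _) _; apply: le_trans (dot4_le_norm _ _) _ => /=.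
    have : `|x s - x t0| < (2 * (B + 1))^-1.
      by apply: Hd => //; [lra | rewrite ltr_norml; lra].
    have N0 := normr_ge0 (x s - x t0).
    rewrite -[_^-1]mul1r ltr_pdivlMr; last lra.
    nra.
  rewrite dot4B /dot4 /w /= !dot2E (dot2C (x t0).2 m) (dot2C (x t0).1 n) /GRing.scale /=.
  nra.
pose p := q \_ `[0, 1].
have ip : mu.-integrable setT (EFin \o p).
  have iq : mu.-integrable `[0, 1] (EFin \o q).
    apply/integrableP; split; first exact: mqi.
    by under eq_integral do rewrite /= ger0_norm //.
  rewrite (_ : EFin \o p = (EFin \o q) \_ `[0, 1]).
    by rewrite -integrable_mkcond //; exact: measurable_itv.
  by apply/funext => t; rewrite /= /p !patchE; case: ifP.
have p0 t : 0 <= p t by rewrite /p patchE; case: ifP.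
have ppsi : {ae mu, forall t, 0 < t < 1 -> psi t = p t}.
  apply: filterS qpsi; first exact: (ae_filter_ringOfSetsType mu).
  move=> t qt t01; rewrite qt // /p patchE mem_set //= in_itv /=.
  by move: t01 => /andP[? ?]; rewrite !ltW.
pose F t := \int[mu]_(s in `]-oo, t]) p s.
have FE a b : a <= b -> \int[mu]_(t in `[a, b]) p t = F b - F a.
  move=> ab; rewrite /F primitive_sub // Rintegral_itv_obnd_cbnd //.
  by apply: integrableS ip.
exists F; split.
  rewrite -FE // /action.
  have -> : \int[mu]_(t in `[0, 1]) dot4 (J4 ('D_1 x t)) (x t) =
            \int[mu]_(t in `[0, 1]) ((- 1) * p t).
    apply: Rintegral_eq_ae; apply: filterS ppsi; first exact: (ae_filter_ringOfSetsType mu).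
    by move=> t pt t01; rewrite -pt // /psi; ring.
  by rewrite RintegralZl //; [field | apply: integrableS ip].
move=> a b P a0 ab b1 TP; rewrite -FE //.
pose w : R4 := (2 *: P, 0).
pose C := (`|w.1.1| + `|w.1.2| + `|w.2.1| + `|w.2.2|) + 4 * M.
have C_ge0 : 0 <= C by rewrite /C addr_ge0 ?mulr_ge0 // !addr_ge0.
have := @increment_le_integral _ _ x (fun s => dot4 w (x s) - dot2 (x s).1 (x s).2) p C a b ab C_ge0.
have wE s : dot4 w (x s) = 2 * dot2 P (x s).1 by rewrite /dot4 /w /= !dot2E addr0.
rewrite !wE => H.
have -> : 2 * (dot2 P (x b).1 - dot2 P (x a).1) - (dot2 (x b).1 (x b).2 - dot2 (x a).1 (x a).2)
  = 2 * dot2 P (x b).1 - dot2 (x b).1 (x b).2 - (2 * dot2 P (x a).1 - dot2 (x a).1 (x a).2) by ring.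
apply: H => //.
- exact: abs_cont_onS ac.
- move=> u v au uv vb; have h1 := dot4_control x w u v.
  have := dot2_control (xM u) (xM v); rewrite ler_norml => /andP[h2 h3].
  have := mulr_ge0 C_ge0 (_ : 0 <= v - u); rewrite subr_ge0 => /(_ uv).
  rewrite /C; nra.
apply: filterS2 ae ppsi; first exact: (ae_filter_ringOfSetsType mu).
move=> s [dx [r [n [m [r0 nK nT nm1 [nmB Dx]]]]]] ps /andP[us sv].
have s01 : 0 < s < 1 by lra.
have d2 := is_deriveB (is_derive_dot4 w dx) (is_derive_dot2 dx).
split; first by case: d2.
rewrite (@derive_val _ _ _ _ _ _ _ d2) -ps // (psir _ _ _ _ nm1 Dx) Dx.
have := nT P TP; rewrite /dot4 /w /= !dot2E (dot2C P m) (dot2C (x s).1 n); nra.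
Qed.

End CharacteristicAction.

(** * Normals at the vertices of a maximal configuration *)

Section SublinearDomination.
Context {R : realType} {V : lmodType R}.

Definition sublinear (p : V -> R) : Prop :=
  (forall u v, p (u + v) <= p u + p v) /\ (forall (c : R) u, 0 < c -> p (c *: u) = c * p u).

Lemma sublinear0 (p : V -> R) : sublinear p -> p 0 = 0.
Proof.
move=> [_ h]; have := h 2 0 (ltr0n _ 2); rewrite scaler0 => e; lra.
Qed.

Lemma sublinearN (p : V -> R) u : sublinear p -> - p (- u) <= p u.
Proof.
by move=> hp; have := hp.1 u (- u); rewrite subrr (sublinear0 hp); lra.
Qed.

(* One step of the Hahn-Banach construction: the largest sublinear functional below [p]
   taking the value [- p e] at [- e]. *)
Definition straighten (e : V) (p : V -> R) (u : V) : R :=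
  inf [set r | exists2 t : R, 0 <= t & r = p (u + t *: e) - t * p e].

Lemma straighten_sublinear (e : V) (p : V -> R) : sublinear p ->
  [/\ sublinear (straighten e p), forall u, straighten e p u <= p u &
      straighten e p (- e) <= - p e].
Proof.
move=> hp; have [pD pZ] := hp.
pose S u := [set r | exists2 t : R, 0 <= t & r = p (u + t *: e) - t * p e].
have pZ0 (c : R) v : 0 <= c -> p (c *: v) = c * p v.
  rewrite le_eqVlt => /predU1P[<-|]; last exact: pZ.
  by rewrite scale0r mul0r sublinear0.
have lbS u : lbound (S u) (- p (- u)).
  move=> _ [t t0 ->]; have := pD (u + t *: e) (- u).
  rewrite addrC addKr pZ0 //; lra.
have leS u t : 0 <= t -> straighten e p u <= p (u + t *: e) - t * p e.
  by move=> t0; apply: ge_inf; [exists (- p (- u)); exact: lbS | exists t].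
have geS u r : (forall t, 0 <= t -> r <= p (u + t *: e) - t * p e) -> r <= straighten e p u.
  move=> H; apply: lb_le_inf; last by move=> _ [t t0 ->]; exact: H.
  by exists (p (u + 0 *: e) - 0 * p e); exists 0.
split.
- split.
    move=> u v; rewrite -lerBlDr; apply: (geS _ _) => s s0; rewrite lerBlDr -lerBlDl.
    apply: (geS _ _) => t t0; rewrite lerBlDl.
    apply: le_trans (leS _ _ (addr_ge0 s0 t0)) _.
    have := pD (u + s *: e) (v + t *: e); rewrite addrACA -scalerDl; lra.
  move=> c u c0; apply: le_anti; apply/andP; split.
    rewrite -ler_pdivrMl //; apply: (geS _ _) => t t0; rewrite ler_pdivrMl //.
    apply: le_trans (leS _ _ (mulr_ge0 (ltW c0) t0)) _.
    by rewrite -scalerA -scalerDr pZ // mulrBr mulrA.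
  apply: (geS _ _) => t t0.
  have ct : 0 <= c^-1 * t by rewrite mulr_ge0 // invr_ge0 ltW.
  have := leS u _ ct; rewrite -(ler_pM2l c0) => /le_trans; apply.
  rewrite mulrBr -pZ // scalerDr !scalerA !mulrA divff ?gt_eqF // mul1r //.
- by move=> u; have := leS u 0 (lexx 0); rewrite scale0r addr0; lra.
by have := leS (- e) 1 ler01; rewrite scale1r addNr sublinear0 //; lra.
Qed.

(** Linearity along a vector survives further lowering, because - q (- u) <= q u leaves no room
    there. Straightening along a finite basis therefore yields a linear functional, without Zorn's
    lemma. *)
Lemma sublinear_straighten_seq (s : seq V) (p : V -> R) : sublinear p ->
  exists q, [/\ sublinear q, forall u, q u <= p u, forall e, e \in s -> q (- e) = - q e &
    forall u, p (- u) = - p u -> q u = p u].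
Proof.
elim: s p => [|e s IH] p hp; first by exists p.
have [hs sp se] := straighten_sublinear e hp.
have [q [hq qs qlin qkeep]] := IH _ hs.
have keep (p1 p2 : V -> R) u : sublinear p2 -> (forall v, p2 v <= p1 v) ->
    p1 (- u) = - p1 u -> p2 u = p1 u /\ p2 (- u) = - p2 u.
  move=> h2 le12 l1; have := sublinearN u h2; have := le12 u; have := le12 (- u).
  rewrite l1 => *; split; lra.
have sel : straighten e p (- e) = - straighten e p e.
  have := sublinearN e hs; have := sp e; lra.
exists q; split=> //.
- by move=> u; exact: le_trans (qs u) (sp u).
- move=> v; rewrite inE => /predU1P[->|]; last exact: qlin.
  by have [] := keep _ _ _ hq qs sel.
- by move=> u pu; have [e1 e2] := keep _ _ _ hs sp pu; have [-> _] := keep _ _ _ hq qs (etrans e2 (congr1 _ erefl)).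
Qed.

Lemma sublinear_linear_along (q : V -> R) (e u : V) (c : R) : sublinear q -> q (- e) = - q e ->
  q (u + c *: e) = q u + c * q e.
Proof.
move=> hq qe; have [qD qZ] := hq.
have qc (d : R) : q (d *: e) = d * q e.
  have [d0|d0|->] := ltgtP d 0; last by rewrite scale0r mul0r sublinear0.
    have := qZ (- d) (- e); rewrite oppr_gt0 scaleNr scalerN opprK => -> //.
    by rewrite qe mulrNN.
  exact: qZ.
apply: le_anti; apply/andP; split; first by rewrite -qc.
have := qD (u + c *: e) ((- c) *: e); rewrite scaleNr addrK -scaleNr qc; lra.
Qed.

End SublinearDomination.

Section Normals.
Context {R : realType}.
Local Notation R2 := (R * R)%type.

(** Straightening first along [z] preserves the value at [z] and makes the functional linear there,
    so the later steps along the coordinate axes cannot lower it. *)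
Lemma sublinear_supported (p : R2 * R2 -> R) (z : R2 * R2) : sublinear p ->
  exists n m : R2, dot2 n z.1 + dot2 m z.2 = p z /\ forall w, dot2 n w.1 + dot2 m w.2 <= p w.
Proof.
move=> hp; pose e1 : R2 * R2 := ((1, 0), 0); pose e2 : R2 * R2 := ((0, 1), 0).
pose e3 : R2 * R2 := (0, (1, 0)); pose e4 : R2 * R2 := (0, (0, 1)).
have [hs sp se] := straighten_sublinear z hp.
have sz : straighten z p z = p z /\ straighten z p (- z) = - straighten z p z.
  have := sublinearN z hs; have := sp z; split; lra.
have [q [hq qs qlin qkeep]] := sublinear_straighten_seq [:: e1; e2; e3; e4] hs.
have qE w : q w = w.1.1 * q e1 + w.1.2 * q e2 + w.2.1 * q e3 + w.2.2 * q e4.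
  have {1}-> : w = 0 + w.1.1 *: e1 + w.1.2 *: e2 + w.2.1 *: e3 + w.2.2 *: e4.
    rewrite /e1 /e2 /e3 /e4; case: w => [[a b] [c d]] /=.
    by congr ((_, _), (_, _)); rewrite /= /GRing.scale /=; ring.
  by rewrite !sublinear_linear_along ?(sublinear0 hq) ?add0r //; apply: qlin; rewrite !inE eqxx ?orbT.
exists (q e1, q e2), (q e3, q e4).
have E w : dot2 (q e1, q e2) w.1 + dot2 (q e3, q e4) w.2 = q w.
  by rewrite (qE w) /dot2 /=; ring.
split; first by rewrite E qkeep; [exact: sz.1 | exact: sz.2].
by move=> w; rewrite E; exact: le_trans (qs w) (sp w).
Qed.

Lemma gaugeD (V : normedModType R) (C : set V) (u v : V) : convex_set C -> (C°) 0 ->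
  gauge C (u + v) <= gauge C u + gauge C v.
Proof.
move=> cC C0; rewrite -lerBlDr; apply: gauge_ge => // s s0 [c Cc <-].
rewrite lerBlDr -lerBlDl; apply: gauge_ge => // t t0 [d Cd <-]; rewrite lerBlDl.
have [st|st] := eqVneq (s + t) 0.
  have [-> ->] : s = 0 /\ t = 0 by split; lra.
  by rewrite !scale0r !addr0 gauge0.
apply: gauge_le; first exact: addr_ge0.
have st0 : 0 < s + t by rewrite lt_neqAle eq_sym st addr_ge0.
exists ((s / (s + t)) *: c + (1 - s / (s + t)) *: d).
  apply: cC => //; rewrite divr_ge0 ?(ltW st0) //= ler_pdivrMr // mul1r; lra.
rewrite scalerDr !scalerA mulrCA divff // mulr1; congr (_ + _ *: _).
by rewrite mulrBr mulr1 mulrCA divff // mulr1; lra.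
Qed.

(** The least scale of [T] at which a translate of a triple fits is a sublinear function of the
    triple. Maximality says that it equals 1 at the given triple, and a supporting linear functional
    consists of the normals. Degenerate triples are allowed, so chords are covered as well. *)
Lemma normals_of_maximal (T : set R2) (t0 P1 P2 P3 : R2) :
  convex_set T -> closed T -> (T°) t0 -> T P1 -> T P2 -> T P3 ->
  (forall (l : R) s, 1 < l -> T (l *: P1 + s) -> T (l *: P2 + s) -> T (l *: P3 + s) -> False) ->
  exists n1 n2 n3, [/\ normal_cone T P1 n1, normal_cone T P2 n2, normal_cone T P3 n3,
    n1 + n2 + n3 = 0 & dot2 n1 P1 + dot2 n2 P2 + dot2 n3 P3 = 1].
Proof.
move=> cT clT Tt0 T1 T2 T3 tmax.
pose C : set R2 := [set u | T (u + t0)].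
have cC : convex_set C.
  move=> u v Cu Cv t t01; rewrite /C /=.
  have -> : t *: u + (1 - t) *: v + t0 = t *: (u + t0) + (1 - t) *: (v + t0).
    by rewrite !scalerDr addrACA -scalerDl addrCA subrr addr0 scale1r.
  exact: cT.
have cont : continuous (fun u : R2 => u + t0) by move=> u; apply: cvgD => //; exact: cvg_cst.
have clC : closed C by apply: (closed_comp _ clT) => u _; exact: cont.
have C0 : (C°) 0.
  rewrite /interior /=; move: Tt0; rewrite /interior /= -{1}[t0]add0r => h.
  exact: (cont 0 _ h).
pose g := gauge C.
have g0 u : 0 <= g u by apply: gauge_ge.
have gT u : T u -> g (u - t0) <= 1 by move=> Tu; apply: gauge_le1; rewrite /C /= subrK.
have gZ (c : R) u : 0 < c -> g (c *: u) <= c * g u by exact: gauge_scale_le.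
pose h (x : R2 * R2) w := Num.max (g (x.1 + w)) (Num.max (g (x.2 + w)) (g w)).
have h0 x w : 0 <= h x w by rewrite /h le_max g0.
have hle x w r : h x w <= r <-> [/\ g (x.1 + w) <= r, g (x.2 + w) <= r & g w <= r].
  by rewrite /h !ge_max; split=> [/and3P[]|[-> -> ->]].
(* Translation invariance is built in by placing the third point at the free vector [w]; the triple
   is recorded by its two differences. *)
pose p x := inf [set r | exists w, r = h x w].
have ple x w : p x <= h x w.
  by apply: ge_inf; [exists 0 => _ [v ->] | exists w].
have pge x r : (forall w, r <= h x w) -> r <= p x.
  by move=> H; apply: lb_le_inf; [exists (h x 0); exists 0 | move=> _ [w ->]].
have pZle (c : R) x : 0 < c -> p (c *: x) <= c * p x.
  move=> c0; rewrite -ler_pdivrMl //; apply: (pge _ _) => w; rewrite ler_pdivrMl //.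
  apply: le_trans (ple _ (c *: w)) _; apply/hle.
  have [h1 h2 h3] := (hle x w _).1 (lexx _).
  by split; rewrite -?scalerDr; apply: le_trans (gZ _ _ c0) _; rewrite ler_pM2l.
have sp : sublinear p.
  split.
    move=> u v; rewrite -lerBlDr; apply: (pge _ _) => w; rewrite lerBlDr -lerBlDl.
    apply: (pge _ _) => w'; rewrite lerBlDl; apply: le_trans (ple _ (w + w')) _.
    have [a1 a2 a3] := (hle u w _).1 (lexx _); have [b1 b2 b3] := (hle v w' _).1 (lexx _).
    apply/hle; split.
    - rewrite [(u + v).1]/= addrACA; apply: le_trans (gaugeD _ _ cC C0) _; exact: lerD.
    - rewrite [(u + v).2]/= addrACA; apply: le_trans (gaugeD _ _ cC C0) _; exact: lerD.
    - apply: le_trans (gaugeD _ _ cC C0) _; exact: lerD.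
  move=> c u c0; apply: le_anti; rewrite pZle //= -ler_pdivlMl //.
  by rewrite -{1}[u](scalerK (lt0r_neq0 c0)); apply: pZle; rewrite invr_gt0.
pose z : R2 * R2 := (P1 - P3, P2 - P3).
have pT u v w : T u -> T v -> T w -> p (u - w, v - w) <= 1.
  move=> Tu Tv Tw; apply: le_trans (ple _ (w - t0)) _; apply/hle => /=.
  by split; rewrite ?addrA ?subrK; apply: gT.
have pz : p z = 1.
  apply: le_anti; rewrite pT //=; apply: (pge _ _) => w; rewrite leNgt; apply/negP => hw.
  (* The maximum with 1/2 keeps the scale positive, so that enlarging by its inverse makes sense. *)
  pose s := Num.max (h z w) (1 / 2).
  have s0 : 0 < s by rewrite /s lt_max; apply/orP; right; lra.
  have s1 : s < 1 by rewrite /s gt_max hw /=; lra.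
  have hs : h z w <= s by rewrite /s le_max lexx.
  have [a1 a2 a3] := (hle z w _).1 hs.
  have memC u : g u <= s -> T (s^-1 *: u + t0).
    move=> gu; apply: (gauge_le1_mem cC clC C0).
    apply: le_trans (gZ _ _ _) _; first by rewrite invr_gt0.
    by rewrite ler_pdivrMl // mulr1.
  apply: (tmax s^-1 (s^-1 *: (w - P3) + t0)).
  - by rewrite invf_gt1.
  - by rewrite addrA -scalerDr addrCA [w + _]addrC; apply: memC.
  - by rewrite addrA -scalerDr addrCA [w + _]addrC; apply: memC.
  - by rewrite addrA -scalerDr addrCA subrr addr0; apply: memC.
have [n1 [n2 [nz nle]]] := sublinear_supported z sp.
exists n1, n2, (- (n1 + n2)); split.
- move=> w Tw; have := nle (w - P3, P2 - P3); have := pT w P2 P3 Tw T2 T3.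
  by move: nz; rewrite pz /z /= !dot2E; lra.
- move=> w Tw; have := nle (P1 - P3, w - P3); have := pT P1 w P3 T1 Tw T3.
  by move: nz; rewrite pz /z /= !dot2E; lra.
- move=> w Tw; have := nle (P1 - w, P2 - w); have := pT P1 P2 w T1 T2 Tw.
  by move: nz; rewrite pz /z /= !dot2E; lra.
- by rewrite subrr.
- by move: nz; rewrite pz /z /= !dot2E; lra.
Qed.

End Normals.

(** * Piecewise linear loops *)

Section PiecewiseLinear.
Context {R : realType} {V : normedModType R}.
Local Notation mu := (@lebesgue_measure R).
Implicit Types (z w : V) (l : seq (R * V)) (s t d : R).

(* The path from [z] that moves with velocity [w] during time [d], for the successive pairs
   [(d, w)] of the list. *)
Fixpoint pl_path z l s : V :=
  if l is (d, w) :: l' then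
    if s < d then z + s *: w else pl_path (z + d *: w) l' (s - d)
  else z.

Fixpoint pl_length l : R := if l is (d, w) :: l' then d + pl_length l' else 0.

Fixpoint pl_end z l : V := if l is (d, w) :: l' then pl_end (z + d *: w) l' else z.

Fixpoint pl_breaks l : seq R :=
  if l is (d, w) :: l' then d :: [seq d + b | b <- pl_breaks l'] else [::].

(** A piece of zero duration carries no condition on its velocity, so loops with coinciding vertices
    need no separate treatment. *)
Fixpoint pl_good (P : V -> V -> Prop) z l : Prop :=
  if l is (d, w) :: l' then
    [/\ 0 <= d, 0 < d -> forall s, 0 <= s <= d -> P (z + s *: w) w &
        pl_good P (z + d *: w) l']
  else True.

Lemma pl_length_ge0 (P : V -> V -> Prop) z l : pl_good P z l -> 0 <= pl_length l.
Proof. by elim: l z => [//|[d w] l IH] z /= [d0 _ /IH]; exact: addr_ge0. Qed.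

Lemma pl_path_end (P : V -> V -> Prop) z l : pl_good P z l -> pl_path z l (pl_length l) = pl_end z l.
Proof.
elim: l z => [//|[d w] l IH] z /= [d0 _ gl].
have l0 := pl_length_ge0 gl.
have -> : (d + pl_length l < d) = false by apply/negbTE; rewrite -leNgt; lra.
by rewrite [d + _]addrC addrK IH.
Qed.

Lemma pl_path0 (P : V -> V -> Prop) z l : pl_good P z l -> pl_path z l 0 = z.
Proof.
elim: l z => [//|[d w] l IH] z /= [d0 _ gl].
case: ltP => h; first by rewrite scale0r addr0.
have d00 : d = 0 by lra.
by move: gl; rewrite d00 scale0r addr0 subrr => /IH.
Qed.

Lemma pl_path_good (P : V -> V -> Prop) z l s : pl_good P z l -> 0 <= s < pl_length l ->
  exists w, P (pl_path z l s) w.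
Proof.
elim: l z s => [|[d w] l IH] z s /=; first by move=> _; lra.
move=> [d0 gd gl] /andP[s0 sl]; case: ltP => h.
  exists w; apply: gd; lra.
by apply: IH => //; lra.
Qed.

Lemma pl_path_lipschitz (P : V -> V -> Prop) z l : pl_good P z l ->
  exists2 M, 0 <= M & forall s t, 0 <= s -> s <= t -> t <= pl_length l ->
    `|pl_path z l t - pl_path z l s| <= M * (t - s).
Proof.
elim: l z => [|[d w] l IH] z /=.
  by move=> _; exists 0 => // s t _ _ _; rewrite subrr normr0 mul0r.
move=> [d0 gd gl]; have [M M0 HM] := IH _ gl.
exists (M + `|w|); first exact: addr_ge0.
move=> s t s0 st tl; have w0 := normr_ge0 w.
have l0 := pl_length_ge0 gl.
case: (ltP t d) => td; case: (ltP s d) => sd; try lra.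
- rewrite opprD addrACA subrr add0r -scalerBl normrZ ger0_norm; nra.
- have := HM 0 (t - d) (lexx 0) _ _; rewrite (pl_path0 gl) subr0 => h.
  have {}h : `|pl_path (z + d *: w) l (t - d) - (z + d *: w)| <= M * (t - d) by apply: h; lra.
  have -> : pl_path (z + d *: w) l (t - d) - (z + s *: w) =
    (pl_path (z + d *: w) l (t - d) - (z + d *: w)) + (d - s) *: w.
    by rewrite scalerBl !opprD !addrA addrNK.
  apply: le_trans (ler_normD _ _) _; rewrite normrZ ger0_norm; last lra.
  nra.
- apply: le_trans (HM (s - d) (t - d) _ _ _) _; nra.
Qed.

Lemma pl_path_affine (P : V -> V -> Prop) z l s : pl_good P z l -> 0 < s < pl_length l ->
  s \notin pl_breaks l -> exists w, P (pl_path z l s) w /\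
    exists2 e : R, 0 < e & forall u, `|u - s| < e -> pl_path z l u = pl_path z l s + (u - s) *: w.
Proof.
elim: l z s => [|[d w] l IH] z s /=; first by move=> _; lra.
move=> [d0 gd gl] /andP[s0 sl]; rewrite inE negb_or => /andP[sd sb].
have [h|h] := ltP s d.
  exists w; split; first by apply: gd; lra.
  exists (d - s); first lra.
  move=> u; rewrite ltr_norml => /andP[u1 u2].
  have -> : u < d by lra.
  by rewrite -addrA -scalerDl; congr (_ + _ *: _); lra.
have sd' : d < s by rewrite lt_neqAle eq_sym sd h.
have sb' : s - d \notin pl_breaks l.
  by apply: contra sb => H; apply/mapP; exists (s - d) => //; lra.
have [|v [Pv [e e0 He]]] := IH _ (s - d) gl _ sb'; first by lra.
exists v; split=> //; exists (Num.min e (s - d)); first by rewrite lt_min e0 subr_gt0.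
move=> u; rewrite lt_min => /andP[u1 u2].
have /ltW/le_gtF -> : d < u by move: u2; rewrite ltr_norml; lra.
have -> : u - s = (u - d) - (s - d) by lra.
apply: He; by have -> : u - d - (s - d) = u - s by lra.
Qed.

Lemma is_derive_affine (f : R -> V) (t e : R) (w : V) : 0 < e ->
  (forall u, `|u - t| < e -> f u = f t + (u - t) *: w) -> is_derive t 1 f w.
Proof.
move=> e0 fE.
have cv : (fun h => h^-1 *: (f (h *: 1 + t) - f t)) @ 0^' --> w.
  apply: cvg_near_cst; rewrite near_withinE; exists e => //= h.
  rewrite /ball /= sub0r normrN => he h0.
  rewrite fE; last by rewrite [_%:A]mulr1 addrK.
  by rewrite [f t + _]addrC addrK addrK [_%:A]mulr1 scalerA mulVf // scale1r.
apply: DeriveDef; first by apply/cvg_ex; exists w.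
by apply/cvg_lim.
Qed.

Section Loop.
Variables (P : V -> V -> Prop) (z : V) (l : seq (R * V)).
Hypotheses (good : pl_good P z l) (len0 : 0 < pl_length l) (closed_l : pl_end z l = z).

Definition pl_loop (t : R) : V := pl_path z l (pl_length l * (t - (Num.floor t)%:~R)).

Let fl01 (t : R) : 0 <= t - (Num.floor t)%:~R < 1.
Proof. by have := floor_itv t; rewrite intrD => /andP[? ?]; lra. Qed.

Lemma pl_loop_periodic t : pl_loop (t + 1) = pl_loop t.
Proof.
rewrite /pl_loop; have -> : Num.floor (t + 1) = Num.floor t + 1.
  by apply/eqP; rewrite floor_eq !intrD; have := floor_itv t; rewrite intrD; lra.
by rewrite intrD; congr pl_path; congr (_ * _); lra.
Qed.

Lemma pl_loop_good t : exists w, P (pl_loop t) w.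
Proof.
apply: (pl_path_good good); have /andP[h1 h2] := fl01 t.
by rewrite mulr_ge0 ?(ltW len0) //= gtr_pMr.
Qed.

Lemma pl_loop_unit t : 0 <= t <= 1 -> pl_loop t = pl_path z l (pl_length l * t).
Proof.
move=> /andP[t0 t1]; have [->|t1'] := eqVneq t 1.
  rewrite mulr1 (pl_path_end good) closed_l /pl_loop.
  have -> : Num.floor (1 : R) = 1 by apply/eqP; rewrite floor_eq intrD; lra.
  by rewrite subrr mulr0 (pl_path0 good).
rewrite /pl_loop; have -> : Num.floor t = 0.
  have t2 : t < 1 by rewrite lt_neqAle t1' t1.
  by apply/eqP; rewrite floor_eq intrD; lra.
by rewrite subr0.
Qed.

Lemma pl_loop_abs_cont : abs_cont_on 0 1 pl_loop.
Proof.
have [M M0 HM] := pl_path_lipschitz good.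
move=> e e0; pose c := M * pl_length l + 1.
have c0 : 0 < c by rewrite /c; have := mulr_ge0 M0 (ltW len0); lra.
exists (e / c); first exact: divr_gt0.
move=> n u v uv _ s.
have /le_lt_trans -> // : \sum_(i < n) `|pl_loop (v i) - pl_loop (u i)| <= \sum_(i < n) c * (v i - u i).
  apply: ler_sum => i _; have [h1 [h2 h3]] := uv i (ltn_ord i).
  rewrite !pl_loop_unit; try lra.
  apply: le_trans (HM _ _ _ _ _) _.
  - by rewrite mulr_ge0 // ltW.
  - by rewrite ler_pM2l.
  - by rewrite ger_pMr.
  - rewrite -mulrBr mulrA /c mulrDl mul1r lerDl; lra.
by rewrite -mulr_sumr mulrC -ltr_pdivlMr.
Qed.

Lemma pl_loop_ae : {ae mu, forall t, exists w, P (pl_loop t) w /\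
  is_derive t 1 pl_loop (pl_length l *: w)}.
Proof.
(* The additional break 0 accounts for the integer times, at which the loop closes up. *)
pose B k : set R := [set (k%:~R + b / pl_length l : R) | b in [set` 0 :: pl_breaks l]].
have cB : countable (\bigcup_(k in [set: int]) B k).
  by apply: bigcup_countable => // k _; apply: finite_set_countable; apply: finite_image; exact: finite_seq.
exists (\bigcup_(k in [set: int]) B k); split.
- exact: countable_measurable.
- exact: countable_lebesgue_measure0.
move=> t; apply: contra_notP => nb.
set k := Num.floor t; set s := pl_length l * (t - k%:~R).
have /andP[f0 f1] := fl01 t.
have notin b : b \in 0 :: pl_breaks l -> s != b.
  move=> bl; apply/eqP => sb; apply: nb; exists k => //; exists b => //.
  by rewrite -sb /s mulrAC divff ?gt_eqF // mul1r addrC subrK.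
have s0 : 0 < s.
  by rewrite lt_neqAle eq_sym notin ?inE ?eqxx // mulr_ge0 // ltW.
have sl : s < pl_length l by rewrite gtr_pMr.
have sb : s \notin pl_breaks l.
  by apply/negP => H; have := notin s; rewrite inE H orbT eqxx => /(_ isT).
have [|w [Pw [e e0 He]]] := pl_path_affine good _ sb; first by rewrite s0.
exists w; split=> //.
have kt0 : 0 < t - k%:~R by move: s0; rewrite /s pmulr_rgt0.
have d0 : 0 < Num.min (e / pl_length l) (Num.min (t - k%:~R) (1 - (t - k%:~R))).
  by rewrite !lt_min divr_gt0 //= kt0 subr_gt0.
apply: (is_derive_affine d0) => u.
rewrite !lt_min => /and3P[]; rewrite !ltr_norml => u1 u2 u3.
have fu : Num.floor u = k by apply/eqP; rewrite floor_eq intrD; lra.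
have E : pl_length l * (u - k%:~R) - s = pl_length l * (u - t) by rewrite /s; ring.
rewrite /pl_loop fu -/k -/s He E; first by rewrite scalerA mulrC.
rewrite normrM gtr0_norm // mulrC -ltr_pdivlMr //.
by rewrite ltr_norml.
Qed.

End Loop.

End PiecewiseLinear.

(** * Polygonal closed characteristics *)

Section Loops.
Context {R : realType}.
Local Notation R2 := (R * R)%type.
Local Notation R4 := ((R * R) * (R * R))%type.
Local Notation mu := (@lebesgue_measure R).
Implicit Types (K T : set R2) (C : set R4).

Definition is_action C (a : R) : Prop := exists p x, [/\ (C°) p,
  closed_characteristic (translate C (- p)) x & a = action x].

Lemma cEHZ_eq C (c : R) : is_action C c -> (forall a, is_action C a -> c <= a) -> cEHZ C = c.
Proof.
move=> Ac Hc; apply: le_anti; apply/andP; split.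
  by apply: ge_inf => //; exists c.
by apply: lb_le_inf => //; exists c.
Qed.

Lemma translateE (V : normedModType R) (C : set V) (s z : V) : translate C s z <-> C (z - s).
Proof.
split=> [[c Cc <-]|Cz]; first by rewrite addrK.
by exists (z - s) => //; rewrite subrK.
Qed.

Lemma continuous_addr (V : normedModType R) (s : V) : continuous (fun u : V => u + s).
Proof. by move=> u; apply: cvgD => //; exact: cvg_cst. Qed.

Lemma translate_interior0 (V : normedModType R) (C : set V) (p : V) :
  (C°) p -> ((translate C (- p))°) 0.
Proof.
rewrite /interior /= -{1}[p]add0r => h; have h3 : nbhs 0 [set u | C (u + p)] := @continuous_addr _ p 0 _ h.
by apply: filterS h3 => u Cu; apply/translateE; rewrite opprK.
Qed.

Lemma translate_convex (V : normedModType R) (C : set V) (p : V) :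
  convex_set C -> convex_set (translate C p).
Proof.
move=> cC u v /translateE Cu /translateE Cv t t01; apply/translateE.
have -> : t *: u + (1 - t) *: v - p = t *: (u - p) + (1 - t) *: (v - p).
  by rewrite !scalerDr addrACA -scalerDl addrCA subrr addr0 scale1r.
exact: cC.
Qed.

Lemma interior_setX K T (k t : R2) : (K°) k -> (T°) t -> ((K `*` T)°) (k, t).
Proof. by move=> h1 h2; exists (K, T). Qed.

Lemma interior_setX_part K T (z : R4) : ((K `*` T)°) z -> (K°) z.1 /\ (T°) z.2.
Proof.
move=> [[A B] [/= hA hB] AB]; split.
  by apply: filterS hA => a Aa; have [] := AB (a, z.2) (conj Aa (nbhs_singleton hB)).
by apply: filterS hB => b Bb; have [] := AB (z.1, b) (conj (nbhs_singleton hA) Bb).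
Qed.

Lemma convex_setX K T : convex_set K -> convex_set T -> convex_set (K `*` T).
Proof. by move=> cK cT u v [? ?] [? ?] t t01; split; [exact: cK | exact: cT]. Qed.

Lemma gauge_subdiff_intro C (z v : R4) : (C°) 0 -> C z -> dot4 v z = 1 ->
  (forall w, C w -> dot4 v w <= 1) -> gauge C z = 1 /\ subdiff (gauge C) z v.
Proof.
move=> C0 Cz vz vC.
have le w : dot4 v w <= gauge C w.
  apply: gauge_ge => // t t0 [c Cc <-]; rewrite dot4Z -[leRHS]mulr1.
  by apply: ler_wpM2l => //; exact: vC.
have gz : gauge C z = 1 by apply: le_anti; rewrite gauge_le1 //= -vz.
by split=> // w; rewrite gz dot4B vz; have := le w; lra.
Qed.

(** The velocity is J v with factor 1. Since <v, u> = 1, action accrues at rate 1/2, so the duration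
    of a loop is twice its action. *)
Definition unit_velocity C (u w : R4) : Prop :=
  gauge C u = 1 /\ exists2 v, subdiff (gauge C) u v & w = J4 v.

Lemma pl_loop_characteristic C (z : R4) (l : seq (R * R4)) : (C°) 0 ->
  pl_good (unit_velocity C) z l -> 0 < pl_length l -> pl_end z l = z ->
  closed_characteristic C (pl_loop z l) /\ action (pl_loop z l) = pl_length l / 2.
Proof.
move=> C0 good len0 cl.
have ae := pl_loop_ae good len0.
split; first split.
- exact: pl_loop_periodic.
- exact: (pl_loop_abs_cont good).
- by move=> t; have [w []] := pl_loop_good good len0 t.
- apply: filterS ae; first exact: (ae_filter_ringOfSetsType mu).
  move=> t [w [[g1 [v sv ->]] d]]; split; first by case: d.
  exists (pl_length l) => //; exists v => //.
  exact: (@derive_val _ _ _ _ _ _ _ d).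
rewrite /action.
have -> : \int[mu]_(t in `[0, 1]) dot4 (J4 ('D_1 (pl_loop z l) t)) (pl_loop z l t) =
          \int[mu]_(t in `[0, 1]) (- pl_length l).
  apply: Rintegral_eq_ae; apply: filterS ae; first exact: (ae_filter_ringOfSetsType mu).
  move=> t [w [[g1 [v sv ->]] d]] _.
  rewrite (@derive_val _ _ _ _ _ _ _ d) /J4 /dot4 /= !dot2E.
  have [] := subdiff_gauge C0 g1 sv; rewrite /dot4; nra.
rewrite Rintegral_cst // [X in fine X]lebesgue_measure_itv /= lte_fin ltr01 /=; lra.
Qed.

Lemma normal_cone_dot0 (C : set R2) (z n : R2) : (C°) 0 -> normal_cone C z n ->
  dot2 n z <= 0 -> n = 0.
Proof.
move=> /nbhs_ballP[d /= d0 dC] nC nz.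
have n_ge0 := normr_ge0 n.
pose c := d / 2 / (`|n| + 1).
have c0 : 0 < c by rewrite /c; apply: divr_gt0; lra.
have : C (c *: n).
  apply: dC; rewrite -ball_normE /= sub0r normrN normrZ gtr0_norm //.
  rewrite /c mulrAC ltr_pdivrMr; last lra.
  have := mulr_ge0 (ltW d0) n_ge0; nra.
move=> /nC; rewrite dot2Zr => h.
have : dot2 n n <= 0 by rewrite -(pmulr_rle0 _ c0); lra.
rewrite /dot2 -!expr2 => h2.
have h3 : (n.1 ^+ 2 + n.2 ^+ 2 == 0) by rewrite eq_le h2 addr_ge0 ?sqr_ge0.
move: h3; rewrite paddr_eq0 ?sqr_ge0 // !sqrf_eq0 => /andP[/eqP h4 /eqP h5].
by rewrite (surjective_pairing n) h4 h5.
Qed.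

(** While the momentum rests at [P], the normal [q' - q] divided by its value [d] at [P] is a
    subgradient, and [d] is the time the move takes. If [d = 0] the normal vanishes, because 0 is
    interior to [T], and the move is empty. *)
Lemma move_position K T (q q' P : R2) : convex_set K -> (K°) 0 -> (T°) 0 ->
  K q -> K q' -> T P -> normal_cone T P (q' - q) ->
  let d := dot2 (q' - q) P in let w : R4 := (d^-1 *: (q' - q), 0) in
  [/\ 0 <= d, 0 < d -> forall s, 0 <= s <= d -> unit_velocity (K `*` T) ((q, P) + s *: w) w &
      (q, P) + d *: w = (q', P)].
Proof.
move=> cK K0 T0 Kq Kq' TP nP d w.
have d0 : 0 <= d by have := nP 0 (interior_subset T0); rewrite dot20r.
split=> //.
- move=> d_gt0 s /andP[s0 sd].
  have E : (q, P) + s *: w = ((s / d) *: q' + (1 - s / d) *: q, P).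
    congr (_, _); last by rewrite /= scaler0 addr0.
    by rewrite /= scalerA scalerBr scalerBl scale1r addrCA addrC.
  have [||||g sg] := @gauge_subdiff_intro (K `*` T) ((q, P) + s *: w) (0, d^-1 *: (q' - q)).
  + exact: (interior_setX K0 T0).
  + rewrite E; split=> //=; apply: cK => //.
    by rewrite divr_ge0 //= ler_pdivrMr // mul1r.
  + by rewrite E /dot4 /= dot20l add0r dot2Zl mulVf ?gt_eqF.
  + move=> u [Ku Tu]; rewrite /dot4 /= dot20l add0r dot2Zl ler_pdivrMl // mulr1.
    exact: nP.
  by split=> //; exists (0, d^-1 *: (q' - q)) => //; rewrite /J4 /= oppr0.
have [dz|dz] := eqVneq d 0.
  have n0 : q' - q = 0 by apply: (normal_cone_dot0 T0 nP); rewrite -/d dz.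
  by congr (_, _); rewrite /= ?n0 ?scaler0 ?addr0 //; apply/esym/eqP; rewrite -subr_eq0 n0.
by congr (_, _); rewrite /= ?scaler0 ?addr0 // scalerA divff // scale1r addrCA subrr addr0.
Qed.

Lemma move_momentum K T (q P P' : R2) : convex_set T -> (K°) 0 -> (T°) 0 ->
  K q -> T P -> T P' -> normal_cone K q (P - P') ->
  let d := dot2 (P - P') q in let w : R4 := (0, - (d^-1 *: (P - P'))) in
  [/\ 0 <= d, 0 < d -> forall s, 0 <= s <= d -> unit_velocity (K `*` T) ((q, P) + s *: w) w &
      (q, P) + d *: w = (q, P')].
Proof.
move=> cT K0 T0 Kq TP TP' nq d w.
have d0 : 0 <= d by have := nq 0 (interior_subset K0); rewrite dot20r.
split=> //.
- move=> d_gt0 s /andP[s0 sd].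
  have E : (q, P) + s *: w = (q, (s / d) *: P' + (1 - s / d) *: P).
    congr (_, _); first by rewrite /= scaler0 addr0.
    by rewrite /= scalerN scalerA scalerBr scalerBl scale1r opprB addrCA.
  have [||||g sg] := @gauge_subdiff_intro (K `*` T) ((q, P) + s *: w) (d^-1 *: (P - P'), 0).
  + exact: (interior_setX K0 T0).
  + rewrite E; split=> //=; apply: cT => //.
    by rewrite divr_ge0 //= ler_pdivrMr // mul1r.
  + by rewrite E /dot4 /= dot20l addr0 dot2Zl mulVf ?gt_eqF.
  + move=> u [Ku Tu]; rewrite /dot4 /= dot20l addr0 dot2Zl ler_pdivrMl // mulr1.
    exact: nq.
  by split=> //; exists (d^-1 *: (P - P'), 0).
have [dz|dz] := eqVneq d 0.
  have n0 : P - P' = 0 by apply: (normal_cone_dot0 K0 nq); rewrite -/d dz.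
  have PP : P = P' by apply/eqP; rewrite -subr_eq0 n0.
  by congr (_, _); rewrite /= ?n0 ?scaler0 ?oppr0 ?scaler0 ?addr0.
congr (_, _); rewrite /= ?scaler0 ?addr0 // scalerN scalerA divff // scale1r opprB.
by rewrite addrCA subrr addr0.
Qed.

(** A billiard trajectory: moves of the position along the edges alternate with moves of the
    momentum at the bounces. Vertices may coincide, which covers trajectories with two bounces. *)
Lemma triangle_loop0 K T (q1 q2 q3 P1 P2 P3 : R2) :
  convex_set K -> convex_set T -> (K°) 0 -> (T°) 0 ->
  K q1 -> K q2 -> K q3 -> T P1 -> T P2 -> T P3 ->
  normal_cone T P1 (q1 - q3) -> normal_cone T P2 (q2 - q1) -> normal_cone T P3 (q3 - q2) ->
  normal_cone K q1 (P1 - P2) -> normal_cone K q2 (P2 - P3) -> normal_cone K q3 (P3 - P1) ->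
  let a := dot2 (q1 - q3) P1 + dot2 (q2 - q1) P2 + dot2 (q3 - q2) P3 in
  0 < a -> exists x, closed_characteristic (K `*` T) x /\ action x = a.
Proof.
move=> cK cT K0 T0 Kq1 Kq2 Kq3 TP1 TP2 TP3 n1 n2 n3 m1 m2 m3 a a0.
have [d1 v1 e1] := move_position cK K0 T0 Kq3 Kq1 TP1 n1.
have [d2 v2 e2] := move_momentum cT K0 T0 Kq1 TP1 TP2 m1.
have [d3 v3 e3] := move_position cK K0 T0 Kq1 Kq2 TP2 n2.
have [d4 v4 e4] := move_momentum cT K0 T0 Kq2 TP2 TP3 m2.
have [d5 v5 e5] := move_position cK K0 T0 Kq2 Kq3 TP3 n3.
have [d6 v6 e6] := move_momentum cT K0 T0 Kq3 TP3 TP1 m3.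
pose l := [:: (dot2 (q1 - q3) P1, ((dot2 (q1 - q3) P1)^-1 *: (q1 - q3), 0) : R4);
  (dot2 (P1 - P2) q1, (0, - ((dot2 (P1 - P2) q1)^-1 *: (P1 - P2))));
  (dot2 (q2 - q1) P2, ((dot2 (q2 - q1) P2)^-1 *: (q2 - q1), 0));
  (dot2 (P2 - P3) q2, (0, - ((dot2 (P2 - P3) q2)^-1 *: (P2 - P3))));
  (dot2 (q3 - q2) P3, ((dot2 (q3 - q2) P3)^-1 *: (q3 - q2), 0));
  (dot2 (P3 - P1) q3, (0, - ((dot2 (P3 - P1) q3)^-1 *: (P3 - P1))))].
have good : pl_good (unit_velocity (K `*` T)) (q3, P1) l.
  by rewrite /=; split=> //; rewrite e1; split=> //; rewrite e2; split=> //; rewrite e3;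
    split=> //; rewrite e4; split=> //; rewrite e5; split=> //.
(* Summation by parts: in total the momentum moves last as long as the position moves. *)
have len : pl_length l = 2 * a.
  by rewrite /l /a /= /dot2 /=; ring.
have cl : pl_end (q3, P1) l = (q3, P1).
  by rewrite /l [LHS]/= e1 e2 e3 e4 e5 e6.
have len0 : 0 < pl_length l by rewrite len; lra.
have [ch ac] := pl_loop_characteristic (interior_setX K0 T0) good len0 cl.
exists (pl_loop (q3, P1) l); split=> //; rewrite ac len; lra.
Qed.

Lemma normal_cone_translate (C : set R2) (p z n : R2) :
  normal_cone C z n -> normal_cone (translate C (- p)) (z - p) n.
Proof.
move=> nC w /translateE; rewrite opprK => /nC; rewrite dot2Br dot2Dr; lra.
Qed.

Lemma triangle_loop K T (k t q1 q2 q3 P1 P2 P3 : R2) :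
  convex_set K -> convex_set T -> (K°) k -> (T°) t ->
  K q1 -> K q2 -> K q3 -> T P1 -> T P2 -> T P3 ->
  normal_cone T P1 (q1 - q3) -> normal_cone T P2 (q2 - q1) -> normal_cone T P3 (q3 - q2) ->
  normal_cone K q1 (P1 - P2) -> normal_cone K q2 (P2 - P3) -> normal_cone K q3 (P3 - P1) ->
  let a := dot2 (q1 - q3) P1 + dot2 (q2 - q1) P2 + dot2 (q3 - q2) P3 in
  0 < a -> is_action (K `*` T) a.
Proof.
move=> cK cT Kk Tt Kq1 Kq2 Kq3 TP1 TP2 TP3 n1 n2 n3 m1 m2 m3 a a0.
have mem (C : set R2) p z : C z -> translate C (- p) (z - p).
  by move=> Cz; apply/translateE; rewrite opprK subrK.
have shift (u v p : R2) : (u - p) - (v - p) = u - v by rewrite opprB addrA subrK.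
have [|||||||||||||x [ch ac]] := @triangle_loop0 (translate K (- k)) (translate T (- t))
  (q1 - k) (q2 - k) (q3 - k) (P1 - t) (P2 - t) (P3 - t)
  (translate_convex cK) (translate_convex cT) (translate_interior0 Kk) (translate_interior0 Tt);
  rewrite ?shift; try exact: mem; try exact: normal_cone_translate.
  by move: a0; rewrite /a !dot2E; lra.
exists (k, t), x; split.
- exact: interior_setX.
- have -> : translate (K `*` T) (- (k, t)) = translate K (- k) `*` translate T (- t); last by [].
  apply/seteqP; split => [z /translateE[/= h1 h2]|z [/translateE h1 /translateE h2]].
    by split; apply/translateE.
  by apply/translateE; split.
rewrite ac /a !dot2E; lra.
Qed.

End Loops.

(** * Bounds on the action *)

Section ActionBounds.
Context {R : realType}.
Local Notation R2 := (R * R)%type.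
Local Notation R4 := ((R * R) * (R * R))%type.
Implicit Types (K T : set R2).

Lemma action_witness K T (a : R) : convex_body K -> convex_body T -> is_action (K `*` T) a ->
  exists (q : R -> R2) (F B : R -> R),
  [/\ forall t, K (q t),
      forall w, exists2 t, 0 <= t <= 1 & forall e : R, 0 < e -> ~ (K°) (q t - e *: w),
      2 * a = F 1 - F 0, B 0 = B 1 /\ q 0 = q 1 &
      forall u v P, 0 <= u -> u <= v -> v <= 1 -> T P ->
        2 * (dot2 P (q v) - dot2 P (q u)) - (B v - B u) <= F v - F u].
Proof.
move=> [cK kK _] [cT kT _] [p [x [Kp ch ->]]].
have [Kp1 Tp2] := interior_setX_part Kp.
pose K' := translate K (- p.1); pose T' := translate T (- p.2).
have E : translate (K `*` T) (- p) = K' `*` T'.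
  apply/seteqP; split => [z /translateE[/= h1 h2]|z [/translateE h1 /translateE h2]].
    by split; apply/translateE.
  by apply/translateE; split.
have cmp : compact (translate (K `*` T) (- p)).
  apply: continuous_compact; last exact: compact_setX.
  by apply: continuous_subspaceT; exact: continuous_addr.
rewrite E in ch cmp.
have C0 : ((K' `*` T')°) 0 by rewrite -E; exact: translate_interior0.
have cC : convex_set (K' `*` T') by apply: convex_setX; exact: translate_convex.
have clC : closed (K' `*` T') by apply: compact_closed => //; exact: norm_hausdorff.
have [M CM] : exists M, forall z, (K' `*` T') z -> `|z| <= M.
  have [M [Mr HM]] := compact_bounded cmp; exists (M + 1) => z Cz.
  by apply: HM => //; lra.
have [F [F1 F2]] := characteristic_primitive cC clC C0 CM ch.
have [per _ _ _] := ch.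
have x01 : x 0 = x 1 by have := per 0; rewrite add0r.
(* Undoing the translation of [T] by [p.2] adds a term that is a function of the position alone; it
   joins the pairing among the increments that cancel around the loop. *)
exists (fun t => (x t).1 + p.1), F, (fun t => dot2 (x t).1 (x t).2 + 2 * dot2 p.2 (x t).1).
split.
- move=> t; have [/translateE] := characteristic_mem cC clC C0 ch t.
  by rewrite opprK.
- move=> w; have [t t01 H] := characteristic_touch cC clC C0 CM ch w.
  exists t => // e e0 Ke; apply: (H e e0).
  have : K° ((x t).1 - e *: w + p.1) by rewrite addrAC.
  rewrite /interior /= => h; have h3 : nbhs ((x t).1 - e *: w) [set u | K (u + p.1)] :=
    @continuous_addr _ _ p.1 ((x t).1 - e *: w) _ h.
  by apply: filterS h3 => u Cu; apply/translateE; rewrite opprK.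
- exact: F1.
- by rewrite x01.
move=> u v P u0 uv v1 TP; have TP' : T' (P - p.2) by apply/translateE; rewrite opprK subrK.
by have := F2 u v _ u0 uv v1 TP'; rewrite !dot2E; lra.
Qed.

(** The loop is cut at the contact times and one point of [T] is used on each piece; the first and
    last pieces share their point. With three times their cyclic order is unknown, so the triangle
    [m1], [m2], [m3] is required in both orders: the unprimed points serve the order s, t, u and the
    primed points the reverse. *)
Lemma action_ge_chord K T (a : R) : convex_body K -> convex_body T -> is_action (K `*` T) a ->
  exists q : R -> R2,
  [/\ forall t, K (q t),
      forall w, exists2 t, 0 <= t <= 1 & forall e : R, 0 < e -> ~ (K°) (q t - e *: w),
      forall s t P P', 0 <= s <= 1 -> 0 <= t <= 1 -> T P -> T P' ->
        dot2 (P - P') (q s) + dot2 (P' - P) (q t) <= a &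
      forall s t u (l : R) (m1 m2 m3 P1 P2 P3 P1' P2' P3' : R2),
        0 <= s <= 1 -> 0 <= t <= 1 -> 0 <= u <= 1 ->
        T P1 -> T P2 -> T P3 -> T P1' -> T P2' -> T P3' ->
        P1 - P2 = l *: m1 -> P2 - P3 = l *: m2 -> P3 - P1 = l *: m3 ->
        P1' - P3' = l *: m1 -> P2' - P1' = l *: m2 -> P3' - P2' = l *: m3 ->
        l * (dot2 m1 (q s) + dot2 m2 (q t) + dot2 m3 (q u)) <= a].
Proof.
move=> bK bT ia; have [q [F [B [Kq touch Fa [B01 q01] H]]]] := action_witness bK bT ia.
have two s t P P' : 0 <= s -> s <= t -> t <= 1 -> T P -> T P' ->
    dot2 (P - P') (q s) + dot2 (P' - P) (q t) <= a.
  move=> s0 st t1 TP TP'.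
  have h1 := H 0 s P (lexx 0) s0 (le_trans st t1) TP.
  have h2 := H s t P' s0 st t1 TP'.
  have h3 := H t 1 P (le_trans s0 st) t1 (lexx 1) TP.
  move: h1 h3; rewrite q01 B01 !dot2E; lra.
have three s t u P1 P2 P3 : 0 <= s -> s <= t -> t <= u -> u <= 1 -> T P1 -> T P2 -> T P3 ->
    dot2 (P1 - P2) (q s) + dot2 (P2 - P3) (q t) + dot2 (P3 - P1) (q u) <= a.
  move=> s0 st tu u1 T1 T2 T3.
  have h1 := H 0 s P1 (lexx 0) s0 (le_trans st (le_trans tu u1)) T1.
  have h2 := H s t P2 s0 st (le_trans tu u1) T2.
  have h3 := H t u P3 (le_trans s0 st) tu u1 T3.
  have h4 := H u 1 P1 (le_trans s0 (le_trans st tu)) u1 (lexx 1) T1.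
  move: h1 h4; rewrite q01 B01 !dot2E; lra.
exists q; split=> //.
  move=> s t P P' /andP[s0 s1] /andP[t0 t1] TP TP'.
  have [st|/ltW ts] := leP s t; first exact: two.
  by rewrite addrC; exact: two.
move=> s t u l m1 m2 m3 P1 P2 P3 P1' P2' P3' /andP[s0 s1] /andP[t0 t1] /andP[u0 u1].
move=> T1 T2 T3 T1' T2' T3' e1 e2 e3 e1' e2' e3'.
have fin X : X <= a -> X = l * (dot2 m1 (q s) + dot2 m2 (q t) + dot2 m3 (q u)) ->
  l * (dot2 m1 (q s) + dot2 m2 (q t) + dot2 m3 (q u)) <= a by move=> h <-.
have [st|/ltW ts] := leP s t; have [tu|/ltW ut] := leP t u; have [su|/ltW us] := leP s u.
- by apply: (fin _ (three s t u P1 P2 P3 _ _ _ _ _ _ _)) => //; rewrite e1 e2 e3 !dot2E; ring.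
- by apply: (fin _ (three s t u P1 P2 P3 _ _ _ _ _ _ _)) => //; rewrite e1 e2 e3 !dot2E; ring.
- by apply: (fin _ (three s u t P1' P3' P2' _ _ _ _ _ _ _)) => //; rewrite e1' e2' e3' !dot2E; ring.
- by apply: (fin _ (three u s t P3 P1 P2 _ _ _ _ _ _ _)) => //; rewrite e1 e2 e3 !dot2E; ring.
- by apply: (fin _ (three t s u P2' P1' P3' _ _ _ _ _ _ _)) => //; rewrite e1' e2' e3' !dot2E; ring.
- by apply: (fin _ (three t u s P2 P3 P1 _ _ _ _ _ _ _)) => //; rewrite e1 e2 e3 !dot2E; ring.
- by apply: (fin _ (three u t s P3' P2' P1' _ _ _ _ _ _ _)) => //; rewrite e1' e2' e3' !dot2E; ring.
- by apply: (fin _ (three u t s P3' P2' P1' _ _ _ _ _ _ _)) => //; rewrite e1' e2' e3' !dot2E; ring.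
Qed.

(** The pairs of a scale and a translation that fit into [T] form a closed set; [A != B] bounds the
    scales and hence the translations, so the nonnegative scales form a compact projection. *)
Lemma max_scale T (A B C : R2) : convex_body T -> A != B ->
  exists l : R, [/\ 0 < l,
    exists s, [/\ T (l *: A + s), T (l *: B + s) & T (l *: C + s)] &
    forall (r : R) s, T (r *: A + s) -> T (r *: B + s) -> T (r *: C + s) -> r <= l].
Proof.
move=> [cT kT [t0 Tt0]] AB.
have [M [Mr HM]] := compact_bounded kT.
pose S := [set r : R | exists s, [/\ T (r *: A + s), T (r *: B + s) & T (r *: C + s)]].
have clT : closed T by apply: compact_closed => //; exact: norm_hausdorff.
pose N := `|A| + `|B| + `|C| + 1.
have N0 : 0 < N by rewrite /N; have := normr_ge0 A; have := normr_ge0 B; have := normr_ge0 C; lra.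
have [r0 r00 Sr0] : exists2 r : R, 0 < r & S r.
  have /nbhs_ballP[e /= e0 eT] := Tt0.
  exists (e / 2 / N); first by rewrite !divr_gt0.
  have r0 : 0 < e / 2 / N by rewrite !divr_gt0.
  exists t0.
  have fit X : `|X| <= N -> T ((e / 2 / N) *: X + t0).
    move=> XN; apply: eT; rewrite -ball_normE /= opprD addrCA subrr addr0 normrN normrZ gtr0_norm //.
    apply: le_lt_trans (_ : e / 2 / N * N < e); first by rewrite ler_pM2l.
    rewrite mulfVK ?gt_eqF //; lra.
  by split; apply: fit; rewrite /N; have := normr_ge0 A; have := normr_ge0 B; have := normr_ge0 C; lra.
have ub r : S r -> r <= 2 * (M + 1) / `|A - B|.
  move=> [s [TA TB _]]; have AB0 : 0 < `|A - B| by rewrite normr_gt0 subr_eq0.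
  rewrite ler_pdivlMr //.
  have h1 : `|r *: A + s| <= M + 1 by apply: HM TA; lra.
  have h2 : `|r *: B + s| <= M + 1 by apply: HM TB; lra.
  have : `|(r *: A + s) - (r *: B + s)| <= 2 * (M + 1).
    by apply: le_trans (ler_normB _ _) _; lra.
  rewrite opprD addrACA subrr addr0 -scalerBr normrZ.
  have := ler_norm r; nra.
pose u := 2 * (M + 1) / `|A - B|; pose v := (M + 1) + u * `|A|.
pose box : set (R * R2) := `[0, u]%classic `*` (`[- v, v]%classic `*` `[- v, v]%classic).
pose fit X : set (R * R2) := [set w | T (w.1 *: X + w.2)].
have clfit X : closed (fit X).
  apply: (closed_comp _ clT) => w _; apply: cvgD; last exact: cvg_snd.
  by apply: cvgZl; exact: cvg_fst.
pose G := box `&` (fit A `&` (fit B `&` fit C)).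
have kG : compact G.
  apply: compact_closedI.
    by apply: compact_setX; [|apply: compact_setX]; exact: segment_compact.
  by do 2?[apply: closedI; first exact: clfit]; exact: clfit.
have kS : compact (fst @` G).
  by apply: continuous_compact kG; apply: continuous_subspaceT => w; exact: cvg_fst.
have SG r : 0 <= r -> S r -> (fst @` G) r.
  move=> r_ge0 Sr; have [s [h1 h2 h3]] := Sr; exists (r, s) => //; split; last by [].
  have ru : r <= u by exact: ub.
  have : `|s| <= v.
    have -> : s = (r *: A + s) - r *: A by rewrite addrC addKr.
    apply: le_trans (ler_normB _ _) _; rewrite normrZ ger0_norm // /v lerD //.
      by apply: HM h1; lra.
    by rewrite ler_wpM2r.
  move=> sv; have := le_trans (norm_coord1 s) sv; have := le_trans (norm_coord2 s) sv.
  by rewrite !ler_norml => a1 a2; split; [|split] => /=; rewrite in_itv /= ?r_ge0.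
have GS r : (fst @` G) r -> S r by move=> [[r' s] [_ [h1 [h2 h3]]] /= <-]; exists s.
have hub : has_ubound (fst @` G) by exists u => r /GS; exact: ub.
have ne : (fst @` G) !=set0 by exists r0; apply: SG => //; exact: ltW.
have supG : (fst @` G) (sup (fst @` G)).
  apply: (compact_closed (@norm_hausdorff _ _) kS); exact: closure_sup.
have r0le : r0 <= sup (fst @` G) by apply: ub_le_sup => //; apply: SG => //; exact: ltW.
exists (sup (fst @` G)); split; [exact: lt_le_trans r0le | exact: GS | move=> r s h1 h2 h3].
have [r_ge0|r_lt0] := leP 0 r; first by apply: ub_le_sup => //; apply: SG => //; exists s.
lra.
Qed.

End ActionBounds.

(** * Areas of convex sets in the plane *)

Section PlaneMeasure.
Context {R : realType}.
Local Notation R2 := (R * R)%type.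
Local Notation mu := (@lebesgue_measure R).
Local Notation mR2 := (measurableTypeR R * measurableTypeR R)%type.

Definition measurable2 (A : set R2) : Prop := measurable (A : set mR2).

(** The product sigma-algebra is generated by rectangles; an open set is the countable union of the
    squares with rational centre and radius that it contains. *)
Lemma open_measurable2 (A : set R2) : open A -> measurable2 A.
Proof.
move=> oA.
pose c (i j k : rat) : set R2 := ball (ratr i : R) (ratr k : R) `*` ball (ratr j : R) (ratr k).
pose F i j k : set mR2 := if `[< c i j k `<=` A >] then c i j k else set0.
have -> : A = \bigcup_i \bigcup_j \bigcup_k F i j k.
  apply/seteqP; split => [[x y] Axy|p [i _ [j _ [k _]]]]; last first.
    by rewrite /F; case: asboolP => // sub cp; exact: sub.
  have /nbhs_ballP[e /= e0 eA] : nbhs (x, y) A by apply: open_nbhs_nbhs.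
  have [k] := @rat_in_itvoo R 0 (e / 2) (ltac:(lra)).
  rewrite in_itv /= => /andP[k0 ke].
  have [i] := @rat_in_itvoo R (x - ratr k) (x + ratr k) (ltac:(lra)).
  rewrite in_itv /= => /andP[i1 i2].
  have [j] := @rat_in_itvoo R (y - ratr k) (y + ratr k) (ltac:(lra)).
  rewrite in_itv /= => /andP[j1 j2].
  exists i => //; exists j => //; exists k => //; rewrite /F asboolT.
    by split; rewrite /ball /= ltr_norml; lra.
  move=> [a b] [/=]; rewrite /ball /= !ltr_norml => h1 h2; apply: eA.
  by split; rewrite /ball /= ltr_norml; lra.
do 3!(apply: bigcupT_measurable_rat => ?); rewrite /F; case: asboolP => // _.
by apply: measurableX; exact: measurable_ball.
Qed.

Lemma closed_measurable2 (A : set R2) : closed A -> measurable2 A.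
Proof.
by move=> cA; rewrite /measurable2 -[A]setCK; apply: measurableC; apply: open_measurable2; exact: closed_openC.
Qed.

Lemma compact_measurable2 (A : set R2) : compact A -> measurable2 A.
Proof. by move=> kA; apply: closed_measurable2; apply: compact_closed kA; exact: norm_hausdorff. Qed.

Lemma vol2X (A B : set R) : measurable (A : set (measurableTypeR R)) ->
  measurable (B : set (measurableTypeR R)) -> vol2 (A `*` B) = (mu A * mu B)%E.
Proof. exact: product_measure1E. Qed.

(* [vol4] integrates [vol2] with respect to the canonical Borel structure of [R], which has
   another display than the structure of [lebesgue_measure]. *)
Definition borel_vol2 : set R2 -> \bar R := @vol2 R.

Let borel_vol20 : borel_vol2 set0 = 0%E. Proof. exact: (measure0 (mu \x mu)%E). Qed.

Let borel_vol2_ge0 A : (0 <= borel_vol2 A)%E. Proof. exact: (measure_ge0 (mu \x mu)%E). Qed.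

Let borel_vol2_additive : semi_sigma_additive borel_vol2.
Proof. exact: (@measure_semi_sigma_additive _ _ _ (mu \x mu)%E). Qed.

HB.instance Definition _ := isMeasure.Build _ _ _ borel_vol2
  borel_vol20 borel_vol2_ge0 borel_vol2_additive.

Let borel_vol2_sigma_finite : sigma_finite [set: R2] borel_vol2.
Proof.
exists (fun n => `[- n%:R, n%:R]%classic `*` `[- n%:R, n%:R]%classic).
  apply/esym/seteqP; split=> // -[x y] _.
  have [n _ h] := nbhs_infty_ger (`|x| + `|y|).
  have := h n (leqnn n) => /= hn; have := normr_ge0 x; have := normr_ge0 y => y0 x0.
  have /andP[x1 x2] : - n%:R <= x <= n%:R by rewrite -ler_norml; lra.
  have /andP[y1 y2] : - n%:R <= y <= n%:R by rewrite -ler_norml; lra.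
  by exists n => //; split; rewrite /= in_itv /= ?x1 ?y1.
move=> n; split; first by apply: measurableX; exact: measurable_itv.
rewrite /borel_vol2 vol2X; [|exact: measurable_itv|exact: measurable_itv].
by rewrite !lebesgue_measure_itv; case: ifP => _; rewrite ?mule0 ?ltry // -!EFinB -EFinM ltry.
Qed.

HB.instance Definition _ := Measure_isSigmaFinite.Build _ _ _ borel_vol2 borel_vol2_sigma_finite.

Lemma vol4X (K T : set R2) : measurable2 K -> measurable2 T ->
  vol4 (K `*` T) = (vol2 K * vol2 T)%E.
Proof. by move=> mK mT; exact: (product_measure1E borel_vol2 borel_vol2 mK mT). Qed.

(** By uniqueness of Lebesgue measure it suffices to test half-open intervals; a negative [k] moves
    the open end to the other side. *)
Lemma lebesgue_affine (k c : R) (A : set (measurableTypeR R)) : k != 0 -> measurable A ->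
  mu A = (`|k|%:E * mu [set y | A (k * y + c)%R])%E.
Proof.
move=> k0 mA.
have k_gt0 : 0 < `|k| by rewrite normr_gt0.
pose f (y : measurableTypeR R) : measurableTypeR R := k * y + c.
have mf : measurable_fun setT f.
  by apply: measurable_funD => //; apply: measurable_funM.
apply: (@lebesgue_measure_unique R (mscale (NngNum (normr_ge0 k)) (pushforward mu f))) => //.
move=> _ [[a b] _ <-]; rewrite -[RHS]/(`|k|%:E * mu (f @^-1` `]a, b]))%E.
have [kp|kn] := ltP 0 k.
  have -> : f @^-1` `]a, b] = `](a - c) / k, (b - c) / k]%classic.
    apply/seteqP; split => y /=; rewrite /f !in_itv /= ltr_pdivrMr // ler_pdivlMr // mulrC; lra.
  rewrite !lebesgue_measure_itv /= !lte_fin ltr_pM2r ?invr_gt0 // ltrD2r gtr0_norm //.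
  case: ifP => _; last by rewrite mule0.
  by rewrite -!EFinB -EFinM; congr EFin; field; rewrite gt_eqF.
have {}kn : k < 0 by rewrite lt_neqAle k0.
have -> : f @^-1` `]a, b] = `[(b - c) / k, (a - c) / k[%classic.
  apply/seteqP; split => y /=; rewrite /f !in_itv /= ltr_ndivlMr // ler_ndivrMr // mulrC; lra.
rewrite !lebesgue_measure_itv /= !lte_fin ltr_nM2r ?invr_lt0 // ltrD2r ltr0_norm //.
case: ifP => _; last by rewrite mule0.
by rewrite -!EFinB -EFinM; congr EFin; field; rewrite lt_eqF.
Qed.

(** Change of variables stated for preimages, so that it composes without inverses. *)
Definition scales2 (f : R2 -> R2) (k : R) : Prop :=
  measurable_fun setT (f : mR2 -> mR2) /\
  forall A, measurable2 A -> vol2 A = (k%:E * vol2 (f @^-1` A))%E.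

Lemma scales2_comp f g k l : scales2 f k -> scales2 g l -> scales2 (f \o g) (k * l).
Proof.
move=> [mf hf] [mg hg]; split; first exact: measurableT_comp.
move=> A mA; have mfA : measurable2 (f @^-1` A) by rewrite /measurable2 -[_ @^-1` _]setTI; exact: mf.
by rewrite hf // hg // muleA EFinM.
Qed.

Lemma scales2_fiber (k c e : R) : k != 0 -> scales2 (fun p => (p.1, k * p.2 + c * p.1 + e)) `|k|.
Proof.
move=> k0; have mf : measurable_fun setT ((fun p => (p.1, k * p.2 + c * p.1 + e)) : mR2 -> mR2).
  apply: measurable_fun_pair; first exact: measurable_fst.
  apply: measurable_funD; last exact: measurable_cst.
  apply: measurable_funD; apply: measurable_funM; try exact: measurable_cst.
    exact: (@measurable_snd _ _ (measurableTypeR R) (measurableTypeR R)).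
  exact: (@measurable_fst _ _ (measurableTypeR R) (measurableTypeR R)).
split=> // A mA.
have mA' : measurable2 ((fun p => (p.1, k * p.2 + c * p.1 + e)) @^-1` A).
  by rewrite /measurable2 -[_ @^-1` _]setTI; exact: mf.
rewrite /vol2 /product_measure1 -ge0_integralZl //; last first.
  exact: (@measurable_fun_xsection _ _ _ _ _ mu _ mA').
apply: eq_integral => x _ /=.
rewrite (lebesgue_affine (c * x + e) k0); last exact: measurable_xsection.
by congr (_ * mu _)%E; rewrite !xsectionE /=; apply/funext => y /=; rewrite addrA.
Qed.

Lemma scales2_swap : scales2 (fun p => (p.2, p.1)) 1.
Proof.
have mf : measurable_fun setT ((fun p => (p.2, p.1)) : mR2 -> mR2).
  by apply: measurable_fun_pair; [exact: measurable_snd | exact: measurable_fst].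
split=> // A mA; rewrite mul1e.
suff H : (mu \x mu)%E A = pushforward (mu \x mu)%E ((fun p => (p.2, p.1)) : mR2 -> mR2) A by exact: H.
apply: product_measure_unique => //.
move=> B C mB mC; transitivity (vol2 (C `*` B)); last by rewrite vol2X // muleC.
rewrite -[LHS]/(vol2 ((fun p => (p.2, p.1)) @^-1` (B `*` C))); congr vol2.
by apply/seteqP; split => [[x y] [? ?]|[x y] [? ?]].
Qed.

(** Gaussian elimination: with a nonzero pivot the map is a composition of maps along vertical
    fibres, conjugated by the swap where they act horizontally; a zero pivot is cured by one more
    swap. *)
Lemma scales2_affine (a b c d e1 e2 : R) : a * d - b * c != 0 ->
  scales2 (fun p => (a * p.1 + b * p.2 + e1, c * p.1 + d * p.2 + e2)) `|a * d - b * c|.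
Proof.
have gen (a' b' c' d' e1' e2' : R) : a' != 0 -> a' * d' - b' * c' != 0 ->
    scales2 (fun p => (a' * p.1 + b' * p.2 + e1', c' * p.1 + d' * p.2 + e2')) `|a' * d' - b' * c'|.
  move=> a0 det0; pose D := (a' * d' - b' * c') / a'.
  have D0 : D != 0 by rewrite mulf_neq0 // invr_eq0.
  have h1 := scales2_fiber 0 0 D0.
  have h2 := scales2_comp scales2_swap (scales2_comp (scales2_fiber (b' / D) e1' a0) scales2_swap).
  have h3 := scales2_fiber (c' / a') (e2' - c' / a' * e1') (oner_neq0 R).
  have := scales2_comp h3 (scales2_comp h2 h1).
  rewrite normr1 !mul1r mulr1 -normrM.
  have -> : a' * D = a' * d' - b' * c' by rewrite /D; field.
  congr (scales2 _ _); apply/funext => p /=; congr (_, _).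
    by field.
  by rewrite /D; field; rewrite a0.
move=> det0; have [a0|a0] := eqVneq a 0; last exact: gen.
have c0 : c != 0 by apply: contra_neq det0 => ->; rewrite a0; ring.
have det' : c * b - d * 0 != 0 by rewrite mulr0 subr0 -normr_eq0 -normrN; move: det0; rewrite a0 mul0r sub0r mulrC -normr_eq0.
have := scales2_comp scales2_swap (gen c d 0 b e2 e1 c0 det').
rewrite mul1r mulr0 subr0; have -> : `|c * b| = `|a * d - b * c| by rewrite a0 mul0r sub0r normrN mulrC.
by congr (scales2 _ _); apply/funext => p /=; rewrite a0.
Qed.

Lemma vol2_pos_ball (p : R2) (e : R) : 0 < e -> (0 < vol2 (ball p e))%E.
Proof.
move=> e0; have -> : ball p e = ball p.1 e `*` ball p.2 e by [].
rewrite vol2X; [|exact: measurable_ball|exact: measurable_ball].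
by rewrite !lebesgue_measure_ball ?(ltW e0) // -EFinM lte_fin mulr_gt0 // mulrn_wgt0.
Qed.

(** The equality principle of all three cases. A point of [T] off [H] would have near it a shrunken
    copy of a ball of [T], contracted towards that point, which is disjoint from [H] and has
    positive area. *)
Lemma convex_body_sub_eq (T H : set R2) (v : R) : convex_body T -> compact H -> H `<=` T ->
  vol2 H = v%:E -> (vol2 T <= v%:E)%E -> T = H.
Proof.
move=> [cT kT [p /nbhs_ballP[r /= r0 rT]]] kH HT vH vT.
apply/seteqP; split=> // t Tt; apply: contrapT => nHt.
have clH : closed H by apply: compact_closed kH; exact: norm_hausdorff.
have /nbhs_ballP[e /= e0 eH] : nbhs t (~` H).
  by apply: open_nbhs_nbhs; split => //; exact: closed_openC.
(* The contracted ball must stay within distance [e] of [t], hence off [H]. *)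
pose s := Num.min 1 (e / 2 / (`|p - t| + r)).
have pt0 := normr_ge0 (p - t).
have s0 : 0 < s by rewrite /s lt_min ltr01 /= !divr_gt0 //; lra.
have s1 : s <= 1 by rewrite /s ge_min lexx.
have se : s * (`|p - t| + r) <= e / 2.
  by rewrite -ler_pdivlMr; [rewrite /s ge_min lexx orbT | lra].
pose c := t + s *: (p - t).
have sub : ball c (s * r) `<=` T `\` H.
  move=> z; rewrite -ball_normE /= => cz; split.
    pose w := p + s^-1 *: (z - c).
    have Tw : T w.
      apply: rT; rewrite -ball_normE /= /w opprD addrA subrr sub0r normrN normrZ.
      rewrite ger0_norm ?invr_ge0 ?(ltW s0) // ltr_pdivrMl // distrC //.
    have -> : z = s *: w + (1 - s) *: t.
      rewrite /w /c scalerDr scalerA divff ?gt_eqF // scale1r scalerBl scale1r scalerBr.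
      rewrite opprD opprB [_ + (z + _)]addrCA -addrA -[LHS]addr0; congr (_ + _).
      rewrite [_ + (- t + _)]addrCA [s *: p + _]addrCA subrr addr0 addrACA addNr subrr addr0 //.
    by apply: cT => //; rewrite s1 (ltW s0).
  apply: eH; rewrite -ball_normE /=.
  have -> : t - z = (c - z) - s *: (p - t) by rewrite /c addrAC addrK.
  apply: le_lt_trans (ler_normB _ _) _; rewrite normrZ gtr0_norm //; nra.
have mT := compact_measurable2 kT; have mH := compact_measurable2 kH.
have mB : measurable2 (ball c (s * r)) by apply: open_measurable2; exact: ball_open.
have : (vol2 H + vol2 (ball c (s * r)) <= vol2 T)%E.
  rewrite -measureU //; last first.
    by apply/seteqP; split=> // z [Hz /sub[]].
  apply: le_measure; rewrite ?inE //; first exact: measurableU.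
  by move=> z [/HT|/sub[]].
rewrite vH => /le_trans/(_ vT); rewrite -[leRHS]adde0 leeD2lE //.
by rewrite leNgt vol2_pos_ball // mulr_gt0.
Qed.

End PlaneMeasure.

(** * Areas between parallel chords *)

Section Strips.
Context {R : realType}.
Local Notation R2 := (R * R)%type.
Local Notation mu := (@lebesgue_measure R).

Lemma integral_affine (x1 x2 l1 l2 : R) : x1 < x2 -> 0 <= l1 -> 0 <= l2 ->
  (\int[mu]_(x in `[x1, x2]) (l1 + (x - x1) / (x2 - x1) * (l2 - l1))%:E)%E =
  ((x2 - x1) * (l1 + l2) / 2)%:E.
Proof.
move=> x12 l10 l20; have d0 : x2 - x1 != 0 by rewrite subr_eq0 gt_eqF.
pose k := (l2 - l1) / (x2 - x1).
pose F (x : R) := l1 * x + k / 2 * ((x - x1) * (x - x1)).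
have dF (x : R) : is_derive x 1 F (l1 + (x - x1) / (x2 - x1) * (l2 - l1)).
  have d1 : is_derive x 1 (fun y : R => y - x1) 1.
    by have := is_deriveB (is_derive_id x (1 : R)) (is_derive_cst x1 x (1 : R)); rewrite subr0.
  have d2 := is_deriveD (is_deriveZ l1 (is_derive_id x (1 : R))) (is_deriveZ (k / 2) (is_deriveM d1 d1)).
  by refine (is_derive_eq d2 _); rewrite /GRing.scale /= /k; field; rewrite subr_eq0 gt_eqF.
have cF (x : R) : {for x, continuous F}.
  by apply: differentiable_continuous; apply/derivable1_diffP; have := dF x; case.
rewrite (@continuous_FTC2 _ _ F) //.
- rewrite -EFinB; congr EFin; rewrite /F /k; field; exact: d0.
- apply: continuous_subspaceT => x; apply: cvgD; first exact: cvg_cst.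
  apply: cvgMl; apply: cvgMl; apply: cvgB; first exact: cvg_id.
  exact: cvg_cst.
- split.
  + by move=> x _; case: (dF x).
  + by apply: cvg_at_right_filter; exact: cF.
  + by apply: cvg_at_left_filter; exact: cF.
- by move=> x _; rewrite derive1E; have d := dF x; rewrite (@derive_val _ _ _ _ _ _ _ d).
Qed.

(* The part, over the interval [i], of the trapezoid with the vertical sides
   [{x1} * [y1, y1 + l1]] and [{x2} * [y2, y2 + l2]]. *)
Definition strip (i : interval R) (x1 y1 l1 x2 y2 l2 : R) : set R2 :=
  [set p | p.1 \in i /\ let t := (p.1 - x1) / (x2 - x1) in
     y1 + t * (y2 - y1) <= p.2 <= y1 + t * (y2 - y1) + (l1 + t * (l2 - l1))].

Lemma strip_measurable (i : interval R) (x1 y1 l1 x2 y2 l2 : R) :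
  measurable2 (strip i x1 y1 l1 x2 y2 l2).
Proof.
pose t (p : R2) := (p.1 - x1) / (x2 - x1).
have ct : continuous t.
  move=> p; apply: cvgMl; apply: cvgB; [exact: cvg_fst | exact: cvg_cst].
pose g1 (p : R2) := p.2 - (y1 + t p * (y2 - y1)).
pose g2 (p : R2) := (y1 + t p * (y2 - y1) + (l1 + t p * (l2 - l1))) - p.2.
have c1 : continuous g1.
  move=> p; apply: cvgB; first exact: cvg_snd.
  by apply: cvgD; [exact: cvg_cst | apply: cvgMl; exact: ct].
have c2 : continuous g2.
  move=> p; apply: cvgB; last exact: cvg_snd.
  by apply: cvgD; apply: cvgD; try exact: cvg_cst; apply: cvgMl; exact: ct.
have -> : strip i x1 y1 l1 x2 y2 l2 =
    ([set` i] `*` setT) `&` (g1 @^-1` [set y | 0 <= y] `&` g2 @^-1` [set y | 0 <= y]).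
  apply/seteqP; split => [p [pi /= /andP[h1 h2]]|p [[pi _] [/= h1 h2]]].
    by split=> //; split; rewrite /= /g1 /g2 /t subr_ge0.
  move: h1 h2; rewrite /g1 /g2 /t !subr_ge0 => h1 h2.
  by split=> //=; rewrite h1 h2.
apply: measurableI; first by apply: measurableX => //; exact: measurable_itv.
apply: measurableI; apply: closed_measurable2; apply: (closed_comp _ (@closed_ge _ _)) => p _.
- exact: c1.
- exact: c2.
Qed.

Lemma vol2_strip (i : interval R) (x1 y1 l1 x2 y2 l2 : R) : x1 < x2 -> 0 <= l1 -> 0 <= l2 ->
  i = `[x1, x2] \/ i = `]x1, x2[ ->
  vol2 (strip i x1 y1 l1 x2 y2 l2) = ((x2 - x1) * (l1 + l2) / 2)%:E.
Proof.
move=> x12 l10 l20 ix.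
pose g x := l1 + (x - x1) / (x2 - x1) * (l2 - l1).
transitivity (\int[mu]_(x in [set` i]) (g x)%:E)%E.
  rewrite /vol2 /product_measure1 [in RHS]integral_mkcond; apply: eq_integral => x _ /=.
  rewrite patchE; case: ifPn => xi.
    rewrite inE /= in xi.
    have -> : xsection (strip i x1 y1 l1 x2 y2 l2) x =
      `[y1 + (x - x1) / (x2 - x1) * (y2 - y1), y1 + (x - x1) / (x2 - x1) * (y2 - y1) + g x]%classic.
      by rewrite xsectionE; apply/seteqP; split => y /=; rewrite in_itv /=; [move=> [_] | split].
    have g0 : 0 <= g x.
      have t0 : 0 <= (x - x1) / (x2 - x1) <= 1.
        rewrite divr_ge0 ?ler_pdivrMr ?mul1r ?subr_gt0 //=; move: xi; case: ix => ->; rewrite in_itv /= => /andP[]; lra.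
      by rewrite /g; move: t0; set t := _ / _; nra.
    rewrite lebesgue_measure_itv /= lte_fin; case: ltP => h; last first.
      by congr EFin; apply: le_anti; rewrite g0 /=; lra.
    by rewrite -EFinB; congr EFin; lra.
  rewrite (_ : xsection _ _ = set0) ?measure0 // xsectionE.
  by apply/seteqP; split => // y [/= xi' _]; move: xi => /negP; apply; rewrite inE.
case: ix => ->; first exact: integral_affine.
have mg (D : set R) : measurable_fun D (EFin \o g).
  apply/measurable_EFinP; apply: (@measurable_funS _ _ _ _ setT) => //.
  apply: continuous_measurable_fun => x; apply: cvgD; first exact: cvg_cst.
  by apply: cvgMl; apply: cvgMl; apply: cvgB; [exact: cvg_id | exact: cvg_cst].
rewrite integral_itv_bndo_bndc; last exact: mg.
rewrite integral_itv_obnd_cbnd; last exact: mg.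
exact: integral_affine.
Qed.

Lemma strip_sub (T : set R2) (x1 y1 l1 x2 y2 l2 : R) : convex_set T -> x1 < x2 ->
  0 <= l1 -> 0 <= l2 ->
  T (x1, y1) -> T (x1, y1 + l1) -> T (x2, y2) -> T (x2, y2 + l2) ->
  strip `]x1, x2[ x1 y1 l1 x2 y2 l2 `<=` T.
Proof.
move=> cT x12 l10 l20 T1 T1' T2 T2' [x y] /= [].
rewrite in_itv /= => /andP[xx1 xx2] /andP[yl yh].
pose t := (x - x1) / (x2 - x1).
have t01 : 0 <= t <= 1.
  rewrite /t divr_ge0 ?ler_pdivrMr ?mul1r ?subr_gt0 //=; lra.
have B : T (t *: (x2, y2) + (1 - t) *: (x1, y1)) by exact: cT.
have U : T (t *: (x2, y2 + l2) + (1 - t) *: (x1, y1 + l1)) by exact: cT.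
move: yl yh; rewrite -/t => yl yh.
have xE : x = t * x2 + (1 - t) * x1 by rewrite /t; field; rewrite subr_eq0 gt_eqF.
pose w := l1 + t * (l2 - l1).
have w0 : 0 <= w by rewrite /w; nra.
have [w00|wn0] := eqVneq w 0.
  have -> : (x, y) = t *: (x2, y2) + (1 - t) *: (x1, y1) => //.
  by congr (_, _); rewrite /= /GRing.scale /=; [exact: xE | move: w00; rewrite /w; lra].
have wp : 0 < w by rewrite lt_neqAle eq_sym wn0.
pose s := (y - (y1 + t * (y2 - y1))) / w.
have sw : s * w = y - (y1 + t * (y2 - y1)) by rewrite /s mulfVK.
have -> : (x, y) = s *: (t *: (x2, y2 + l2) + (1 - t) *: (x1, y1 + l1)) +
                   (1 - s) *: (t *: (x2, y2) + (1 - t) *: (x1, y1)).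
  congr (_, _); rewrite /= /GRing.scale /=; first by rewrite xE; ring.
  by move: sw; rewrite /w; lra.
apply: cT => //; rewrite /s divr_ge0 ?ler_pdivrMr ?mul1r //=; rewrite /w; lra.
Qed.

(** A triple lists the abscissa, the lower end and the length of a vertical chord. The lower ends
    are ignored because shearing preserves area. *)
Fixpoint chord_area (x l : R) (s : seq (R * R * R)) : R :=
  if s is (x', _, l') :: s' then (x' - x) * (l + l') / 2 + chord_area x' l' s' else 0.

Fixpoint chord_chain (T : set R2) (x y l : R) (s : seq (R * R * R)) : Prop :=
  [/\ 0 <= l, T (x, y), T (x, y + l) &
   if s is (x', y', l') :: s' then x <= x' /\ chord_chain T x' y' l' s' else True].

(** Open strips are disjoint. The induction bounds the part of [T] strictly to the right of the
    first chord, which leaves room for the next strip on the left. *)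
Lemma vol2_ge_chords (T : set R2) (x y l : R) (s : seq (R * R * R)) :
  convex_set T -> measurable2 T -> chord_chain T x y l s ->
  ((chord_area x l s)%:E <= vol2 T)%E.
Proof.
move=> cT mT ch.
have mH (a : R) : measurable2 (T `&` [set p | a < p.1]).
  apply: measurableI => //; have -> : [set p | a < p.1] = `]a, +oo[%classic `*` [set: R] :> set R2.
    by apply/seteqP; split => p /=; rewrite in_itv /= andbT; [split | case].
  by apply: measurableX => //; exact: measurable_itv.
suff : ((chord_area x l s)%:E <= vol2 (T `&` [set p | (x < p.1)%R]))%E.
  by move/le_trans; apply; apply: le_measure; rewrite ?inE //; exact: mH.
elim: s x y l ch => [|[[x' y'] l'] s IH] x y l /= [l0 T1 T2 ch].
  exact: (measure_ge0 (mu \x mu)%E).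
have [xx' ch'] := ch; have {}IH := IH _ _ _ ch'.
have [l'0 T1' T2'] : [/\ 0 <= l', T (x', y') & T (x', y' + l')] by case: s ch' {IH ch} => [|? ?] [].
have [->|xn] := eqVneq x x'; first by rewrite subrr !mul0r add0r.
have lt : x < x' by rewrite lt_neqAle xn.
pose S := strip `]x, x'[ x y l x' y' l'.
have ST : S `<=` T by exact: strip_sub.
have mS : measurable2 S by exact: strip_measurable.
have : (vol2 S + vol2 (T `&` [set p | (x' < p.1)%R]) <= vol2 (T `&` [set p | (x < p.1)%R]))%E.
  rewrite -measureU //; last first.
  - apply/seteqP; split=> // p [[]]; rewrite /= in_itv /= => /andP[_ h1] _ [_ h2]; lra.
    exact: mH.
  apply: le_measure; rewrite ?inE //.
  - by apply: measurableU => //; exact: mH.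
  - exact: mH.
  move=> p [Sp|[Tp h]]; last by split=> //=; apply: lt_trans h.
  by split; [exact: ST | case: Sp; rewrite in_itv /= => /andP[]].
apply: le_trans; rewrite EFinD leeD //.
by rewrite /S vol2_strip //; right.
Qed.

Lemma vol2_unit_square : vol2 (@unit_square R) = 1%:E.
Proof.
have -> : @unit_square R = `[0, 1]%classic `*` `[0, 1]%classic.
  by apply/seteqP; split => p /=; rewrite !in_itv /=.
by rewrite vol2X // !lebesgue_measure_itv /= lte_fin ltr01 -EFinB -EFinM subr0 mulr1.
Qed.

End Strips.

(** * Convex hulls and affine charts *)

Section Hulls.
Context {R : realType}.
Local Notation R2 := (R * R)%type.
Implicit Types (A B C : set R2).

Lemma sub_conv_hull A : A `<=` conv_hull A.
Proof. by move=> p Ap C [_]; apply. Qed.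

Lemma conv_hull_convex A : convex_set (conv_hull A).
Proof.
move=> x y Ax Ay t t01 C CA; have [cC _] := CA.
by apply: cC => //; [exact: Ax | exact: Ay].
Qed.

Lemma conv_hull_sub A C : convex_set C -> A `<=` C -> conv_hull A `<=` C.
Proof. by move=> cC AC p; apply. Qed.

(** Presents the hull of two convex sets as a continuous image of a product, which gives compactness
    directly. *)
Definition join A B : set R2 :=
  (fun w : R * (R2 * R2) => w.1 *: w.2.1 + (1 - w.1) *: w.2.2) @` (`[0, 1]%classic `*` (A `*` B)).

Lemma join_compact A B : compact A -> compact B -> compact (join A B).
Proof.
move=> kA kB; apply: continuous_compact.
  apply: continuous_subspaceT => w; apply: cvgD; apply: cvgZ.
  - exact: cvg_fst.
  - by apply: (@cvg_comp _ _ _ (snd : R * (R2 * R2) -> R2 * R2) fst); [exact: cvg_snd | exact: cvg_fst].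
  - by apply: cvgB; [exact: cvg_cst | exact: cvg_fst].
  - by apply: (@cvg_comp _ _ _ (snd : R * (R2 * R2) -> R2 * R2) snd); [exact: cvg_snd | exact: cvg_snd].
by do 2?[apply: compact_setX => //]; exact: segment_compact.
Qed.

Lemma convex_combination A (x y : R2) (s t : R) : convex_set A -> A x -> A y ->
  0 <= s -> 0 <= t -> exists2 z, A z & s *: x + t *: y = (s + t) *: z.
Proof.
move=> cA Ax Ay s0 t0; have [st|st] := eqVneq (s + t) 0.
  have [-> ->] : s = 0 /\ t = 0 by split; lra.
  by exists x => //; rewrite addr0 !scale0r addr0.
have st0 : 0 < s + t by rewrite lt_neqAle eq_sym st addr_ge0.
exists ((s / (s + t)) *: x + (1 - s / (s + t)) *: y).
  by apply: cA => //; rewrite divr_ge0 ?addr_ge0 //= ler_pdivrMr // mul1r; lra.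
rewrite scalerDr !scalerA mulrCA divff // mulr1; congr (_ + _ *: _).
by rewrite mulrBr mulr1 mulrCA divff // mulr1; lra.
Qed.

Lemma join_convex A B : convex_set A -> convex_set B -> convex_set (join A B).
Proof.
move=> cA cB _ _ [[s [a b]] [/= s01 [Aa Bb]] <-] [[t [c d]] [/= t01 [Ac Bd]] <-] u /andP[u0 u1].
move: s01 t01; rewrite !in_itv /= => /andP[s0 s1] /andP[t0 t1].
have u1' : 0 <= 1 - u by lra.
have [z Az zE] := convex_combination cA Aa Ac (mulr_ge0 u0 s0) (mulr_ge0 u1' t0).
have [||w Bw wE] := @convex_combination B b d (u * (1 - s)) ((1 - u) * (1 - t)) cB Bb Bd.
- by rewrite mulr_ge0 //; lra.
- by rewrite mulr_ge0 //; lra.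
exists (u * s + (1 - u) * t, (z, w)); first by split=> //=; rewrite in_itv /=; nra.
rewrite /= -zE.
have -> : 1 - (u * s + (1 - u) * t) = u * (1 - s) + (1 - u) * (1 - t) by ring.
by rewrite -wE !scalerDr !scalerA addrACA.
Qed.

Lemma conv_hull_join A B : convex_set A -> convex_set B -> A !=set0 -> B !=set0 ->
  conv_hull (A `|` B) = join A B.
Proof.
move=> cA cB [a Aa] [b Bb]; apply/seteqP; split.
  apply: conv_hull_sub; first exact: join_convex.
  move=> p [Ap|Bp].
    exists (1, (p, b)); first by split=> //=; rewrite in_itv /= ler01 lexx.
    by rewrite /= scale1r subrr scale0r addr0.
  exists (0, (a, p)); first by split=> //=; rewrite in_itv /= ler01 lexx.
  by rewrite /= scale0r add0r subr0 scale1r.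
move=> _ [[t [c d]] [/= t01 [Ac Bd]] <-]; rewrite in_itv /= in t01.
by apply: conv_hull_convex => //; apply: sub_conv_hull; [left | right].
Qed.

Lemma conv_hull_compact A B : convex_set A -> convex_set B -> A !=set0 -> B !=set0 ->
  compact A -> compact B -> compact (conv_hull (A `|` B)).
Proof. by move=> *; rewrite conv_hull_join //; exact: join_compact. Qed.

Definition frame (o u v : R2) (p : R2) : R2 := o + p.1 *: u + p.2 *: v.

Lemma frame_convex_comb (o u v p q : R2) (t : R) :
  frame o u v (t *: p + (1 - t) *: q) = t *: frame o u v p + (1 - t) *: frame o u v q.
Proof.
rewrite /frame; case: o u v p q => [ o1 o2] [u1 u2] [v1 v2] [p1 p2] [q1 q2].
by congr (_, _); rewrite /= /GRing.scale /=; ring.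
Qed.

Lemma frame_continuous (o u v : R2) : continuous (frame o u v).
Proof.
move=> p; apply: cvgD; last by apply: cvgZl; exact: cvg_snd.
by apply: cvgD; [exact: cvg_cst | apply: cvgZl; exact: cvg_fst].
Qed.

Lemma frame_scales2 (o u v : R2) : det2 u v != 0 -> scales2 (frame o u v) `|det2 u v|.
Proof.
move=> d0; have := @scales2_affine R u.1 v.1 u.2 v.2 o.1 o.2.
have -> : u.1 * v.2 - v.1 * u.2 = det2 u v by rewrite /det2; ring.
move=> /(_ d0); congr (scales2 _ _); apply/funext => p; rewrite /frame.
by case: o u v p {d0} => [ o1 o2] [u1 u2] [v1 v2] [p1 p2]; congr (_, _);
  rewrite /= /GRing.scale /=; ring.
Qed.

Lemma frame_preimage_convex (o u v : R2) A : convex_set A -> convex_set (frame o u v @^-1` A).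
Proof. by move=> cA p q Ap Aq t t01; rewrite /= frame_convex_comb; exact: cA. Qed.

Lemma frame_image_convex (o u v : R2) A : convex_set A -> convex_set (frame o u v @` A).
Proof.
move=> cA _ _ [p Ap <-] [q Aq <-] t t01; exists (t *: p + (1 - t) *: q); first exact: cA.
by rewrite frame_convex_comb.
Qed.

Lemma frame_inj (o u v : R2) : det2 u v != 0 -> injective (frame o u v).
Proof.
move=> d0 p q; rewrite /frame => H.
have : dot2 (J2 u) (o + p.1 *: u + p.2 *: v) = dot2 (J2 u) (o + q.1 *: u + q.2 *: v) by rewrite H.
have : dot2 (J2 v) (o + p.1 *: u + p.2 *: v) = dot2 (J2 v) (o + q.1 *: u + q.2 *: v) by rewrite H.
have uu : dot2 (J2 u) u = 0 by rewrite /dot2 /J2 /=; ring.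
have vv : dot2 (J2 v) v = 0 by rewrite /dot2 /J2 /=; ring.
have uv : dot2 (J2 u) v = - det2 u v by rewrite /dot2 /J2 /det2 /=; ring.
have vu : dot2 (J2 v) u = det2 u v by rewrite /dot2 /J2 /det2 /=; ring.
rewrite !dot2E uu vv uv vu !mulr0 !addr0 => h1 h2.
have e1 : p.1 = q.1 by apply: (mulIf d0); lra.
have e2 : p.2 = q.2 by apply: (mulIf d0); lra.
by case: p q e1 e2 {H h1 h2} => [? ?] [? ?] /= -> ->.
Qed.

Lemma vol2_frame_preimage (o u v : R2) A : det2 u v != 0 -> measurable2 A ->
  vol2 A = (`|det2 u v|%:E * vol2 (frame o u v @^-1` A))%E.
Proof. by move=> d0 mA; have [_] := frame_scales2 o d0; apply. Qed.

Lemma frame_preimage_measurable (o u v : R2) A : det2 u v != 0 -> measurable2 A ->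
  measurable2 (frame o u v @^-1` A).
Proof. by move=> d0 mA; have [m _] := frame_scales2 o d0; rewrite /measurable2 -[_ @^-1` _]setTI; exact: m. Qed.

Lemma vol2_frame_image (o u v : R2) A : det2 u v != 0 -> measurable2 (frame o u v @` A) ->
  vol2 (frame o u v @` A) = (`|det2 u v|%:E * vol2 A)%E.
Proof.
move=> d0 mA; rewrite (vol2_frame_preimage o d0 mA); congr (_ * vol2 _)%E.
apply/seteqP; split=> p; last by exists p.
by move=> [q Aq /(frame_inj d0) <-].
Qed.

End Hulls.

(** * The capacity of the product with a trapezoid *)

Tactic Notation "pring" :=
  congr pair; rewrite /= /GRing.scale /= ?/GRing.scale /=; (ring || field).
Tactic Notation "vring" constr(f) constr(g) constr(s) :=
  generalize f g s; intros [? ?] [? ?] [? ?]; pring.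

Section TrapezoidFrame.
Context {R : realType}.
Local Notation R2 := (R * R)%type.

(* Up to affine maps: the square for [e = 0], the triangle for [e = 1/2], and the other trapezoids
   that are not parallelograms for [e] in between. *)
Definition trap (e : R) : set R2 :=
  [set p | [/\ 0 <= p.1, p.1 <= 1, p.2 <= 1/2 - e * p.1 & - p.2 <= 1/2 - e * p.1]].

(* The basis dual to [(u, v)]. *)
Definition dual1 (u v : R2) : R2 := (v.2 / det2 u v, - v.1 / det2 u v).
Definition dual2 (u v : R2) : R2 := (- u.2 / det2 u v, u.1 / det2 u v).

Section Duality.
Variables (o u v : R2).
Hypothesis d0 : det2 u v != 0.
Local Notation f := (dual1 u v).
Local Notation g := (dual2 u v).

Lemma dual1_frame p : dot2 f (frame o u v p) = dot2 f o + p.1.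
Proof.
move: d0; rewrite /dual1 /frame /dot2 /det2 /= => d1.
by rewrite /GRing.scale /=; field.
Qed.

Lemma dual2_frame p : dot2 g (frame o u v p) = dot2 g o + p.2.
Proof.
move: d0; rewrite /dual2 /frame /dot2 /det2 /= => d1.
by rewrite /GRing.scale /=; field.
Qed.

Lemma frame_dual z : frame o u v (dot2 f (z - o), dot2 g (z - o)) = z.
Proof.
move: d0; case: z o u v => [z1 z2] [ o1 o2] [u1 u2] [v1 v2]; rewrite /dual1 /dual2 /frame /dot2 /det2 /= => d1.
by congr pair; rewrite /GRing.scale /= ?/GRing.scale /=; field.
Qed.

Lemma dot2_dual : [/\ dot2 f u = 1, dot2 f v = 0, dot2 g u = 0 & dot2 g v = 1].
Proof. by split; move: d0; rewrite /dot2 /dual1 /dual2 /det2 /= => ?; field. Qed.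

Lemma det_dual : det2 f g = (det2 u v)^-1.
Proof.
move: d0; rewrite /dual1 /dual2 /det2 /= => d1.
by rewrite /GRing.scale /=; field.
Qed.

End Duality.

Arguments dual1 : simpl never.
Arguments dual2 : simpl never.

Lemma trap_convex (e : R) : convex_set (trap e).
Proof.
move=> [p1 p2] [q1 q2] [/= a1 a2 a3 a4] [/= b1 b2 b3 b4] t /andP[t0 t1].
rewrite /trap /= /GRing.scale /=; split; nra.
Qed.

Lemma continuous_dot2 (w : R2) : continuous (dot2 w).
Proof. by move=> z; apply: cvgD; apply: cvgMr; [exact: cvg_fst | exact: cvg_snd]. Qed.

Lemma closed_halfplane (w : R2) (c : R) : closed [set p | dot2 w p <= c].
Proof. by apply: (closed_comp _ (@closed_le R c)) => p _; exact: continuous_dot2. Qed.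

Lemma open_halfplane (w : R2) (c : R) : open [set p | dot2 w p < c].
Proof. by apply: (open_comp _ (@open_lt R c)) => p _; exact: continuous_dot2. Qed.

Lemma trapE (e : R) : trap e = [set p | dot2 (-1, 0) p <= 0] `&` [set p | dot2 (1, 0) p <= 1] `&`
  ([set p | dot2 (e, 1) p <= 1/2] `&` [set p | dot2 (e, -1) p <= 1/2]).
Proof.
rewrite /dot2; apply/seteqP; split=> -[x y].
  by move=> [/= a1 a2 a3 a4]; split; split=> /=; lra.
by move=> [[/= a1 a2] [/= a3 a4]]; split=> /=; lra.
Qed.

Lemma trap_compact (e : R) : 0 <= e -> compact (trap e).
Proof.
move=> e0; have kB : compact (`[(0:R), 1]%classic `*` `[(-1:R), 1]%classic).
  by apply: compact_setX; exact: segment_compact.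
have -> : trap e = (`[(0:R), 1]%classic `*` `[(-1:R), 1]%classic) `&` trap e.
  apply/seteqP; split=> [p tp|p []//]; split=> //.
  case: p tp => x y [/= h1 h2 h3 h4].
  have : 0 <= e * x by exact: mulr_ge0.
  by split; rewrite /= in_itv /=; lra.
apply: compact_closedI => //; rewrite trapE.
by apply: closedI; apply: closedI; exact: closed_halfplane.
Qed.

Lemma vol2_trap (e : R) : 0 <= e <= 1/2 -> vol2 (trap e) = (1 - e)%:E.
Proof.
move=> e01; have -> : trap e = strip `[(0:R), 1] 0 (-(1/2)) 1 1 (e - 1/2) (1 - 2 * e).
  apply/seteqP; split=> -[x y]; rewrite /trap /strip /= in_itv /= !subr0 divr1.
    by move=> [h1 h2 h3 h4]; split; nra.
  by move=> [/andP[h1 h2] h3]; split; nra.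
rewrite vol2_strip ?ler01 //; [|lra|by left].
by congr EFin; field.
Qed.

Section Body.
Variables (o u v : R2).
Hypothesis d0 : det2 u v != 0.
Local Notation f := (dual1 u v).
Local Notation g := (dual2 u v).
Local Notation X z := (dot2 f (z - o)).
Local Notation Y z := (dot2 g (z - o)).

Lemma frame_trapP (e : R) z : (frame o u v @` trap e) z <-> trap e (X z, Y z).
Proof.
split=> [[p tp <-]|tz]; last by exists (X z, Y z) => //; rewrite frame_dual.
by rewrite !dot2Br dual1_frame // dual2_frame // ![dot2 _ o + _]addrC !addrK; case: p tp.
Qed.

Lemma frame_trap_interior (e : R) z : 0 < X z -> X z < 1 -> Y z < 1/2 - e * X z ->
  - Y z < 1/2 - e * X z -> ((frame o u v @` trap e)°) z.
Proof.
move=> h1 h2 h3 h4.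
pose O := [set p | dot2 (- f) p < - dot2 f o] `&` [set p | dot2 f p < 1 + dot2 f o] `&`
  ([set p | dot2 (g + e *: f) p < 1/2 + dot2 (g + e *: f) o] `&`
   [set p | dot2 (e *: f - g) p < 1/2 + dot2 (e *: f - g) o]).
have oO : open O by apply: openI; apply: openI; exact: open_halfplane.
have Oz : O z.
  move: h1 h2 h3 h4; rewrite /O !dot2Br => h1 h2 h3 h4.
  by split; split; rewrite /= ?dot2E; lra.
have OK : O `<=` frame o u v @` trap e.
  move=> p [[/= a1 a2] [/= a3 a4]]; apply/frame_trapP.
  by move: a1 a2 a3 a4; rewrite !dot2E => *; split=> /=; lra.
by apply: (interiorS OK); move: oO; rewrite openE; apply.
Qed.

Lemma frame_trap_body (e : R) : 0 <= e <= 1/2 -> convex_body (frame o u v @` trap e).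
Proof.
move=> /andP[e0 e1]; split.
- by apply: frame_image_convex; exact: trap_convex.
- by apply: continuous_compact; [apply: continuous_subspaceT; exact: frame_continuous | exact: trap_compact].
- exists (frame o u v (1/2, 0)).
  by apply: frame_trap_interior; rewrite !dot2Br ?dual1_frame ?dual2_frame //=; lra.
Qed.

Lemma vol2_frame_trap (e : R) : 0 <= e <= 1/2 ->
  vol2 (frame o u v @` trap e) = (`|det2 u v| * (1 - e))%:E.
Proof.
move=> e01; rewrite vol2_frame_image ?vol2_trap //.
by apply: compact_measurable2; have [] := frame_trap_body e01.
Qed.

End Body.

End TrapezoidFrame.

(** * Lower bound for the action from contacts with the sides *)

Section TrapezoidLower.
Context {R : realType}.
Local Notation R2 := (R * R)%type.
Implicit Types (T : set R2) (u v : R2).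

Definition fits3 T (A B C : R2) (r : R) : Prop :=
  exists s, [/\ T (r *: A + s), T (r *: B + s) & T (r *: C + s)].

Lemma fits3_le T A B C (r r' : R) : convex_set T -> 0 < r -> 0 <= r' <= r ->
  fits3 T A B C r -> fits3 T A B C r'.
Proof.
move=> cT r0 /andP[r'0 r'r] [s [TA TB TC]].
have t01 : 0 <= r' / r <= 1 by rewrite divr_ge0 ?(ltW r0) //= ler_pdivrMr // mul1r.
exists ((r' / r) *: s + (1 - r' / r) *: (r *: A + s)).
have key Z : r' *: Z + ((r' / r) *: s + (1 - r' / r) *: (r *: A + s)) =
    (r' / r) *: (r *: Z + s) + (1 - r' / r) *: (r *: A + s).
  by rewrite [(r' / r) *: (_ + s)]scalerDr scalerA mulfVK ?gt_eqF // addrA.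
by rewrite !key; split; apply: cT.
Qed.

(* The action of a 2-bounce trajectory between the parallel sides of a trapezoid, and those of
   the 3-bounce trajectories on its other sides, are scales of configurations in [T]. *)
Definition fits T u v (e r : R) : Prop :=
  [/\ fits3 T (dual1 u v) 0 0 r,
      fits3 T (e *: dual1 u v - dual2 u v) 0 ((2 * e) *: dual1 u v) r &
      fits3 T (e *: dual1 u v + dual2 u v) 0 ((2 * e) *: dual1 u v) r].

Lemma small_step (x y : R) : 0 <= x -> 0 < x \/ 0 < y ->
  exists2 r0 : R, 0 < r0 & forall r, 0 < r -> r <= r0 -> 0 < x + r * y.
Proof.
move=> x0 [x1|y1]; last first.
  by exists 1 => // r r0 _; rewrite ltr_wpDl // mulr_gt0.
have y0 := normr_ge0 y; exists (x / (2 * (1 + `|y|))).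
  by rewrite divr_gt0 //; lra.
move=> r r0; rewrite ler_pdivlMr; last by lra.
move=> h; have : - `|y| <= y by rewrite lerNl -normrN ler_norm.
nra.
Qed.

Lemma trap_touch (e : R) (p d : R2) : trap e p ->
  (forall r : R, 0 < r -> 0 < p.1 + r * d.1 -> p.1 + r * d.1 < 1 ->
    p.2 + r * d.2 < 1/2 - e * (p.1 + r * d.1) ->
    - (p.2 + r * d.2) < 1/2 - e * (p.1 + r * d.1) -> False) ->
  [\/ p.1 = 0 /\ d.1 <= 0, p.1 = 1 /\ 0 <= d.1,
      p.2 = 1/2 - e * p.1 /\ 0 <= d.2 + e * d.1 |
      - p.2 = 1/2 - e * p.1 /\ 0 <= e * d.1 - d.2].
Proof.
move=> [p1 p2 p3 p4] H.
have step (x y : R) : 0 <= x -> (x = 0 /\ y <= 0) \/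
    exists2 r0 : R, 0 < r0 & forall r, 0 < r -> r <= r0 -> 0 < x + r * y.
  move=> x0; case: (ltP 0 x) => [x1|x1]; first by right; apply: small_step => //; left.
  case: (ltP 0 y) => y1; first by right; apply: small_step => //; right.
  by left; split=> //; lra.
have [[h1 h2]|[r1 r10 H1]] := step p.1 d.1 p1; first by constructor 1.
have [||[r2 r20 H2]] := step (1 - p.1) (- d.1).
- by lra.
- by move=> [h1 h2]; constructor 2; split; lra.
have [||[r3 r30 H3]] := step (1/2 - e * p.1 - p.2) (- (d.2 + e * d.1)).
- by lra.
- by move=> [h1 h2]; constructor 3; split; lra.
have [||[r4 r40 H4]] := step (1/2 - e * p.1 + p.2) (- (e * d.1 - d.2)).
- by lra.
- by move=> [h1 h2]; constructor 4; split; lra.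
pose r := Num.min (Num.min r1 r2) (Num.min r3 r4).
have r0 : 0 < r by rewrite !lt_min r10 r20 r30 r40.
have : r <= r by [].
rewrite {2}/r !le_min => /andP[/andP[/(H1 _ r0) h1 /(H2 _ r0) h2] /andP[/(H3 _ r0) h3 /(H4 _ r0) h4]].
by exfalso; apply: (H r) => //; lra.
Qed.

(** A direction with horizontal part 1/4 and vertical part 1 up to signs can be stopped by only one
    vertical and one slanted side, as [e / 4 < 1]. The direction (-1, 0) is stopped only by X = 0,
    unless [e = 0], when it is parallel to the other two sides. *)
Lemma facets_of_directions (e X Y : R) : 0 <= e <= 1/2 ->
  let active d1 d2 := [\/ X = 0 /\ d1 <= 0, X = 1 /\ 0 <= d1,
    Y = 1/2 - e * X /\ 0 <= d2 + e * d1 | - Y = 1/2 - e * X /\ 0 <= e * d1 - d2] in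
  [/\ active (1/4) (-1) -> X = 1 \/ - Y = 1/2 - e * X,
      active (1/4) 1 -> X = 1 \/ Y = 1/2 - e * X,
      active (-1/4) (-1) -> X = 0 \/ - Y = 1/2 - e * X,
      active (-1/4) 1 -> X = 0 \/ Y = 1/2 - e * X &
      active (-1) 0 -> e = 0 \/ X = 0].
Proof.
move=> /andP[e0 e1]; split=> -[] [h1 h2]; first [by left | by right | by exfalso; lra | by left; lra].
Qed.

Section Lower.
Variables (o u v : R2).
Hypothesis d0 : det2 u v != 0.
Local Notation f := (dual1 u v).
Local Notation g := (dual2 u v).
Local Notation X z := (dot2 f (z - o)).
Local Notation Y z := (dot2 g (z - o)).
Variables (T : set R2) (e : R).
Hypothesis e01 : 0 <= e <= 1/2.
Hypothesis bT : convex_body T.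
Local Notation K := (frame o u v @` trap e).

Lemma touch_direction (q : R -> R2) (d1 d2 : R) : (forall t, K (q t)) ->
  (forall w, exists2 t, 0 <= t <= 1 & forall r : R, 0 < r -> ~ (K°) (q t - r *: w)) ->
  exists2 t, 0 <= t <= 1 &
  [\/ X (q t) = 0 /\ d1 <= 0, X (q t) = 1 /\ 0 <= d1,
      Y (q t) = 1/2 - e * X (q t) /\ 0 <= d2 + e * d1 |
      - Y (q t) = 1/2 - e * X (q t) /\ 0 <= e * d1 - d2].
Proof.
move=> Kq /(_ (- (d1 *: u + d2 *: v)))[t t01 H]; exists t => //.
have [fu fv gu gv] := dot2_dual d0.
have tq : trap e (X (q t), Y (q t)) by apply/frame_trapP.
apply: (trap_touch (d := (d1, d2)) tq) => r r0 /= h1 h2 h3 h4; apply: (H _ r0).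
have EX : X (q t - r *: - (d1 *: u + d2 *: v)) = X (q t) + r * d1.
  by rewrite !dot2E fu fv; ring.
have EY : Y (q t - r *: - (d1 *: u + d2 *: v)) = Y (q t) + r * d2.
  by rewrite !dot2E gu gv; ring.
by apply: frame_trap_interior; rewrite ?EX ?EY.
Qed.

(** The five contacts contain either both parallel sides, or both slanted sides together with X = 0;
    for [e = 0] the latter side has coefficient [2 * e = 0] and any time serves. The first case is
    charged to the chord in [T], the second to the two triangles, one for each cyclic order of the
    contact times. *)
Lemma trap_action_ge (a c : R) : is_action (K `*` T) a -> 0 < c -> fits T u v e c -> c <= a.
Proof.
move=> aa c0 [[s0 [A1 A2 _]] [s1 [B1 B2 B3]] [s2 [C1 C2 C3]]].
have bK := frame_trap_body o d0 e01.
have [q [Kq Tq chord tri]] := action_ge_chord bK bT aa.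
have touch d1 d2 := @touch_direction q d1 d2 Kq Tq.
have e0 : 0 <= e by case/andP: e01.
have e1 : e <= 1/2 by case/andP: e01.
have [tdr tdr01 Hdr] := touch (1/4) (-1).
have [tur tur01 Hur] := touch (1/4) 1.
have [tdl tdl01 Hdl] := touch (-1/4) (-1).
have [tul tul01 Hul] := touch (-1/4) 1.
have [tl tl01 Hl] := touch (-1) 0.
have LR s t : 0 <= s <= 1 -> 0 <= t <= 1 -> X (q s) = 1 -> X (q t) = 0 -> c <= a.
  move=> s01 t01 Xs Xt; have := chord s t _ _ s01 t01 A1 A2.
  have h : c * (X (q s) - X (q t)) = c by rewrite Xs Xt subr0 mulr1.
  by move: h; rewrite !dot2E => h1 h2; lra.
have UDL s t w : 0 <= s <= 1 -> 0 <= t <= 1 -> 0 <= w <= 1 -> Y (q s) = 1/2 - e * X (q s) ->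
    - Y (q t) = 1/2 - e * X (q t) -> e = 0 \/ X (q w) = 0 -> c <= a.
  move=> s01 t01 w01 Ys Yt Xw.
  have := tri s t w c (e *: f + g) (e *: f - g) (- ((2 * e) *: f)) _ _ _ _ _ _
    s01 t01 w01 B3 B1 B2 C1 C3 C2.
  have -> : c *: ((2 * e) *: f) + s1 - (c *: (e *: f - g) + s1) = c *: (e *: f + g).
    by vring f g s1.
  have -> : c *: (e *: f - g) + s1 - (c *: 0 + s1) = c *: (e *: f - g) by vring f g s1.
  have -> : c *: 0 + s1 - (c *: ((2 * e) *: f) + s1) = c *: (- ((2 * e) *: f)) by vring f g s1.
  have -> : c *: (e *: f + g) + s2 - (c *: 0 + s2) = c *: (e *: f + g) by vring f g s2.
  have -> : c *: ((2 * e) *: f) + s2 - (c *: (e *: f + g) + s2) = c *: (e *: f - g).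
    by vring f g s2.
  have -> : c *: 0 + s2 - (c *: ((2 * e) *: f) + s2) = c *: (- ((2 * e) *: f)) by vring f g s2.
  move=> /(_ erefl erefl erefl erefl erefl erefl).
  move: Ys Yt; rewrite !dot2E => Ys Yt.
  (* At the contacts eX + Y and eX - Y equal 1/2 while eX vanishes at the third; the conormals sum
     to zero, so the origin [o] drops out. *)
  have -> : e * dot2 f (q s) + dot2 g (q s) + (e * dot2 f (q t) - dot2 g (q t)) - 2 * e * dot2 f (q w) = 1.
    have : e * (dot2 f (q w) - dot2 f o) = 0 by case: Xw => [->|]; [rewrite mul0r | rewrite dot2Br => ->; rewrite mulr0].
    move=> h; lra.
  by rewrite mulr1.
have [/(_ Hdr) {}Hdr _ _ _ _] := facets_of_directions (X (q tdr)) (Y (q tdr)) e01.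
have [_ /(_ Hur) {}Hur _ _ _] := facets_of_directions (X (q tur)) (Y (q tur)) e01.
have [_ _ /(_ Hdl) {}Hdl _ _] := facets_of_directions (X (q tdl)) (Y (q tdl)) e01.
have [_ _ _ /(_ Hul) {}Hul _] := facets_of_directions (X (q tul)) (Y (q tul)) e01.
have [_ _ _ _ /(_ Hl) {}Hl] := facets_of_directions (X (q tl)) (Y (q tl)) e01.
have right_hit t : 0 <= t <= 1 -> X (q t) = 1 -> c <= a.
  move=> t01 Xt; case: Hdl => [h|hd]; first exact: (LR t tdl).
  by case: Hul => [h|hu]; [exact: (LR t tul) | exact: (UDL tul tdl tl)].
case: Hdr => [|hd]; first exact: right_hit.
by case: Hur => [|hu]; [exact: right_hit | exact: (UDL tur tdr tl)].
Qed.

End Lower.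
End TrapezoidLower.

(** * Upper bound for the capacity from normals of maximal configurations *)

Section TrapezoidUpper.
Context {R : realType}.
Local Notation R2 := (R * R)%type.
Implicit Types (T : set R2).

Lemma normal_cone_scale T (z n : R2) (c : R) : 0 < c -> normal_cone T z n ->
  normal_cone T z (c *: n).
Proof. by move=> c0 H w Tw; rewrite !dot2Zl ler_pM2l //; exact: H. Qed.

Lemma normal_cone_add T (z n m : R2) : normal_cone T z n -> normal_cone T z m ->
  normal_cone T z (n + m).
Proof. by move=> H H' w Tw; rewrite !dot2Dl lerD //; [exact: H | exact: H']. Qed.

(** The last clause is how the other configurations enter: any triple that fits into [T] at the same
    scale bounds the normals, and this confines the trajectory to [K]. *)
Lemma fits3_normals T (A B C : R2) (c : R) : convex_body T -> 0 < c -> fits3 T A B C c ->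
  (forall r, fits3 T A B C r -> r <= c) ->
  exists s n1 n2 n3, [/\
    [/\ T (c *: A + s), T (c *: B + s) & T (c *: C + s)],
    [/\ normal_cone T (c *: A + s) n1, normal_cone T (c *: B + s) n2 &
        normal_cone T (c *: C + s) n3],
    n1 + n2 + n3 = 0,
    c * (dot2 n1 A + dot2 n2 B + dot2 n3 C) = 1 &
    forall Z1 Z2 Z3 t, T (c *: Z1 + t) -> T (c *: Z2 + t) -> T (c *: Z3 + t) ->
      c * (dot2 n1 Z1 + dot2 n2 Z2 + dot2 n3 Z3) <= 1].
Proof.
move=> [cT kT [t0 Tt0]] c0 [s [TA TB TC]] cmax.
have clT : closed T by apply: compact_closed => //; exact: norm_hausdorff.
have [l t l1|n1 [n2 [n3 [N1 N2 N3 n0 n1E]]]] :=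
    @normals_of_maximal _ T t0 (c *: A + s) (c *: B + s) (c *: C + s) cT clT Tt0 TA TB TC.
  rewrite !scalerDr !scalerA -!addrA => h1 h2 h3.
  have : l * c <= c by apply: cmax; exists (l *: s + t).
  by rewrite ger_pMl // leNgt l1.
exists s, n1, n2, n3.
have s0 t : dot2 n1 t + dot2 n2 t + dot2 n3 t = 0 by rewrite -!dot2Dl n0 dot20l.
split=> //.
  by move: n1E (s0 s); rewrite !dot2Dr !dot2Zr; lra.
move=> Z1 Z2 Z3 t T1 T2 T3; have := N1 _ T1; have := N2 _ T2; have := N3 _ T3.
by move: n1E (s0 s) (s0 t); rewrite !dot2Dr !dot2Zr; lra.
Qed.

Section Upper.
Variables (o u v : R2).
Hypothesis d0 : det2 u v != 0.
Local Notation f := (dual1 u v).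
Local Notation g := (dual2 u v).
Variables (T : set R2) (e c : R).
Hypothesis e01 : 0 <= e <= 1/2.
Hypothesis bT : convex_body T.
Hypothesis c0 : 0 < c.
Hypothesis fT : fits T u v e c.
Local Notation K := (frame o u v @` trap e).

Lemma dual_expand z : z = dot2 f z *: u + dot2 g z *: v.
Proof.
have := frame_dual o d0 (o + z); have -> : o + z - o = z by rewrite addrC addKr.
by rewrite /frame /= -addrA => /addrI.
Qed.

(* Maximality of the chord yields parallel supporting lines of [T] at its ends; their slope is
   bounded because [T] also contains the two triangles. *)
Lemma chord_action : (forall r, fits3 T f 0 0 r -> r <= c) -> is_action (K `*` T) c.
Proof.
have [ch [s1 [T1 T2 T3]] _] := fT.
move=> /(fits3_normals bT c0 ch)[s [n1 [n2 [n3 [[A1 A2 _] [N1 N2 N3] n0 n1E Hn]]]]].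
have e0 : 0 <= e by case/andP: e01.
have e1 : e <= 1/2 by case/andP: e01.
have [cK kK [k0 Kk0]] := frame_trap_body o d0 e01.
have [cT kT [t0 Tt0]] := bT.
have n23 : n2 + n3 = - n1 by apply/eqP; rewrite -addr_eq0 addrC addrA n0.
have nE Z : dot2 n2 Z + dot2 n3 Z = - dot2 n1 Z by rewrite -dot2Dl n23 dot2Nl.
pose y := c * dot2 g n1.
have xE : c * dot2 f n1 = 1 by move: n1E; rewrite !dot20r !addr0 dot2C.
have y1 : e + y <= 1.
  have := Hn _ _ _ _ T3 T1 T1; rewrite -addrA nE -dot2Br dot2C !dot2Bl !dot2Zl.
  by rewrite /y; move: xE; nra.
have y2 : e - y <= 1.
  have := Hn _ _ _ _ T1 T2 T2; rewrite !dot20r !addr0 dot2C !dot2Bl !dot2Zl.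
  by rewrite /y; move: xE; nra.
pose t := y / (1 - e).
have yE : y = t * (1 - e) by rewrite /t divfK // gt_eqF //; lra.
have t1 : -1 <= t <= 1 by apply/andP; split; [rewrite /t ler_pdivlMr | rewrite /t ler_pdivrMr]; lra.
have q1K : K (frame o u v (1, t * (1/2 - e))) by exists (1, t * (1/2 - e)) => //; split => /=; nra.
have q2K : K (frame o u v (0, - t / 2)) by exists (0, - t / 2) => //; split => /=; nra.
have cn : c *: n1 = frame o u v (1, t * (1/2 - e)) - frame o u v (0, - t / 2).
  rewrite [n1 in LHS]dual_expand scalerDr !scalerA xE -/y yE /frame /=.
  by vring o u v.
have Kf w : K w -> dot2 f o <= dot2 f w /\ dot2 f w <= dot2 f o + 1.
  by move=> [p [h1 h2 _ _] <-]; rewrite dual1_frame //; lra.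
have Pd : c *: f + s - (c *: 0 + s) = c *: f by rewrite scaler0 add0r addrK.
(* A trajectory with two bounces is a triangle whose last two vertices coincide. *)
have := @triangle_loop _ K T k0 t0 (frame o u v (1, t * (1/2 - e))) (frame o u v (0, - t / 2))
  (frame o u v (0, - t / 2)) (c *: f + s) (c *: 0 + s) (c *: 0 + s).
rewrite -cn -(opprB (frame o u v (1, _))) -cn !subrr dot20l addr0.
move=> H; have <- : dot2 (c *: n1) (c *: f + s) + dot2 (- (c *: n1)) (c *: 0 + s) = c.
  rewrite dot2Nl -dot2Br Pd dot2Zl dot2Zr [dot2 n1 _]dot2C.
  by rewrite xE mulr1.
apply: H => //.
- exact: normal_cone_scale.
- by rewrite -scalerN -n23; apply: normal_cone_scale => //; exact: normal_cone_add.
- by move=> w _; rewrite !dot20l.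
- by rewrite Pd; apply: normal_cone_scale => // w /Kf[_ h]; rewrite dual1_frame.
- by move=> w _; rewrite !dot20l.
- rewrite -opprB Pd -(scalerN c f); apply: normal_cone_scale => // w /Kf[h _].
  by rewrite !dot2Nl dual1_frame // addr0 lerN2.
- rewrite dot2Nl -dot2Br Pd dot2Zl dot2Zr [dot2 n1 _]dot2C xE mulr1.
  by [].
Qed.

(** The scaled normals are the edges of a triangle with one vertex on X = 0 and one on the line of
    each slanted side, which determines its position. The normal inequalities at the vertices of the
    configuration put the abscissas in X >= 0 and the first vertex on its side; the chord with ends
    [D1] and [D2] keeps the other two within X <= 1. *)
Lemma triangle_action : 0 < e ->
  (forall r, fits3 T (e *: f - g) 0 ((2 * e) *: f) r -> r <= c) -> is_action (K `*` T) c.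
Proof.
move=> e0; have [[s1 [D1 D2 _]] tr _] := fT.
move=> /(fits3_normals bT c0 tr)[s [n2 [n3 [n1 [[T2 T3 T1] [N2 N3 N1] n0 nE Hn]]]]].
have e1 : e <= 1/2 by case/andP: e01.
have [cK kK [k0 Kk0]] := frame_trap_body o d0 e01.
have [cT kT [t0 Tt0]] := bT.
have n2E : n2 = - n1 - n3.
  by apply/eqP; rewrite -subr_eq0 opprD !opprK addrA addrAC; apply/eqP.
pose a1 := c * dot2 f n1; pose b1 := c * dot2 g n1.
pose a3 := c * dot2 f n3; pose b3 := c * dot2 g n3.
have F1 : e * a1 - e * a3 + b1 + b3 = 1.
  by move: nE; rewrite n2E /a1 /a3 /b1 /b3 !dot2E -![dot2 _ f]dot2C -![dot2 _ g]dot2C; nra.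
have cea1 : 0 <= 2 * e * a1.
  have := N1 _ T3; rewrite !dot2E -![dot2 _ f]dot2C /a1; nra.
have cea3 : 2 * e * a3 <= 0.
  have := N3 _ T1; rewrite !dot2E -![dot2 _ f]dot2C /a3; nra.
have h1 : 0 <= e * a1 + b1.
  have := N1 _ T2; rewrite !dot2E -![dot2 _ f]dot2C -![dot2 _ g]dot2C /a1 /b1; nra.
have h3 : e * a3 - b3 <= 0.
  have := N3 _ T2; rewrite !dot2E -![dot2 _ f]dot2C -![dot2 _ g]dot2C /a3 /b3; nra.
have a1_ge0 : 0 <= a1 by move: cea1; rewrite pmulr_rge0 //; lra.
have a3_le0 : a3 <= 0 by move: cea3; rewrite pmulr_rle0 //; lra.
have a1_le1 : a1 <= 1.
  by have := Hn _ _ _ _ D2 D2 D1; rewrite !dot20r !add0r dot2C.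
have a3_ge : - a3 <= 1.
  have := Hn _ _ _ _ D1 D2 D1; rewrite n2E !dot2E -![dot2 _ f]dot2C /a3; nra.
have K1 : K (frame o u v (a1, 1/2 - e * a1)).
  by exists (a1, 1/2 - e * a1) => //; split=> /=; nra.
have K2 : K (frame o u v (- a3, - (1/2) - e * a3)).
  by exists (- a3, - (1/2) - e * a3) => //; split=> /=; nra.
have K3 : K (frame o u v (0, 1/2 - e * a1 - b1)).
  by exists (0, 1/2 - e * a1 - b1) => //; split=> /=; nra.
have v1 : frame o u v (a1, 1/2 - e * a1) - frame o u v (0, 1/2 - e * a1 - b1) = c *: n1.
  rewrite [n1 in RHS]dual_expand scalerDr !scalerA -/a1 -/b1 /frame /=.
  by vring o u v.
have v3 : frame o u v (0, 1/2 - e * a1 - b1) - frame o u v (- a3, - (1/2) - e * a3) = c *: n3.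
  rewrite [n3 in RHS]dual_expand scalerDr !scalerA -/a3 -/b3 /frame /=.
  have -> : b3 = 1 - e * a1 + e * a3 - b1 by lra.
  by vring o u v.
have v2 : frame o u v (- a3, - (1/2) - e * a3) - frame o u v (a1, 1/2 - e * a1) = c *: n2.
  by rewrite n2E scalerBr scalerN -v1 -v3; vring (frame o u v (- a3, - (1/2) - e * a3))
    (frame o u v (a1, 1/2 - e * a1)) (frame o u v (0, 1/2 - e * a1 - b1)).
have K_le w : K w -> [/\ dot2 f o <= dot2 f w, e * dot2 f w + dot2 g w <= 1/2 + (e * dot2 f o + dot2 g o) &
    e * dot2 f w - dot2 g w <= 1/2 + (e * dot2 f o - dot2 g o)].
  by move=> [p [p1 p2 p3 p4] <-]; rewrite dual1_frame // dual2_frame //; split; lra.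
have := @triangle_loop _ K T k0 t0 _ _ _ (c *: ((2 * e) *: f) + s) (c *: (e *: f - g) + s)
  (c *: 0 + s) cK cT Kk0 Tt0 K1 K2 K3 T1 T2 T3.
rewrite v1 v2 v3.
have -> : c *: ((2 * e) *: f) + s - (c *: (e *: f - g) + s) = c *: (e *: f + g) by vring f g s.
have -> : c *: (e *: f - g) + s - (c *: 0 + s) = c *: (e *: f - g) by vring f g s.
have -> : c *: 0 + s - (c *: ((2 * e) *: f) + s) = c *: ((2 * e) *: (- f)) by vring f g s.
have -> : dot2 (c *: n1) (c *: ((2 * e) *: f) + s) + dot2 (c *: n2) (c *: (e *: f - g) + s) +
    dot2 (c *: n3) (c *: 0 + s) = c.
  have n0s : dot2 n1 s + dot2 n2 s + dot2 n3 s = 0 by rewrite -!dot2Dl [n1 + _]addrC addrAC n0 dot20l.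
  rewrite !dot2E; move: nE; rewrite !dot2E => nE.
  transitivity (c * (c * (e * dot2 n2 f - dot2 n2 g + 0 + 2 * e * dot2 n1 f)) +
    c * (dot2 n1 s + dot2 n2 s + dot2 n3 s)); first ring.
  by rewrite nE n0s mulr1 mulr0 addr0.
apply=> //; try by apply: normal_cone_scale.
- apply: normal_cone_scale => // w /K_le[_ h _].
  by rewrite !dot2Dl !dot2Zl dual1_frame // dual2_frame //=; lra.
- apply: normal_cone_scale => // w /K_le[_ _ h].
  by rewrite !dot2Bl !dot2Zl dual1_frame // dual2_frame //=; lra.
- apply: normal_cone_scale => //; apply: normal_cone_scale; first lra.
  by move=> w /K_le[h _ _]; rewrite !dot2Nl dual1_frame //=; lra.
Qed.

End Upper.
End TrapezoidUpper.

(** * The capacity formula *)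

Section TrapezoidCapacity.
Context {R : realType}.
Local Notation R2 := (R * R)%type.
Implicit Types (T : set R2) (o u v : R2).

Lemma dual1_swap u v : dual1 v u = dual2 u v.
Proof.
rewrite /dual1 /dual2; have -> : det2 v u = - det2 u v by rewrite /det2; ring.
by rewrite invrN !mulrN !mulNr opprK.
Qed.

Lemma dual2_swap u v : dual2 v u = dual1 u v.
Proof.
rewrite /dual1 /dual2; have -> : det2 v u = - det2 u v by rewrite /det2; ring.
by rewrite invrN !mulrN !mulNr opprK.
Qed.

Lemma det2Nr u v : det2 u (- v) = - det2 u v. Proof. by rewrite /det2 /=; ring. Qed.

Lemma dual1_flip u v : dual1 u (- v) = dual1 u v.
Proof. by rewrite /dual1 det2Nr /= invrN !mulrN !mulNr !opprK. Qed.

Lemma dual2_flip u v : dual2 u (- v) = - dual2 u v.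
Proof.
by rewrite /dual2 det2Nr /= invrN !mulrN; congr pair; rewrite /= mulNr.
Qed.

Lemma frame_trap_flip o u v (e : R) : frame o u (- v) @` trap e = frame o u v @` trap e.
Proof.
apply/seteqP; split=> _ [[x y] [/= h1 h2 h3 h4] <-]; exists (x, - y);
  rewrite ?/frame /= ?scalerN ?scaleNr ?opprK //; split=> //=; lra.
Qed.

Lemma frame_trap0_swap o u v :
  frame (o + (1/2) *: u - (1/2) *: v) v u @` trap 0 = frame o u v @` trap (0 : R).
Proof.
apply/seteqP; split=> _ [[x y] [/= h1 h2 h3 h4] <-].
  exists (y + 1/2, x - 1/2); first by split=> /=; lra.
  by rewrite /frame /=; vring o u v.
exists (y + 1/2, x - 1/2); first by split=> /=; lra.
by rewrite /frame /=; vring o u v.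
Qed.

Lemma fits3_opp T (A : R2) (r : R) : fits3 T A 0 0 r -> fits3 T (- A) 0 0 r.
Proof.
move=> [s]; rewrite scaler0 add0r => -[h1 h2 h3].
exists (r *: A + s); rewrite scaler0 add0r scalerN addKr.
by split.
Qed.

Lemma fits_flip T u v (e c : R) : fits T u v e c -> fits T u (- v) e c.
Proof. by rewrite /fits dual1_flip dual2_flip opprK => -[]. Qed.

Lemma fits0_swap T u v (c : R) : fits T u v 0 c -> fits T v u 0 c.
Proof.
rewrite /fits (dual1_swap u v) (dual2_swap u v) !mulr0 !scale0r !add0r => -[h1 h2 h3].
by split=> //; exact: (fits3_opp h1).
Qed.

(** [c] is the least of the three maximal scales, and a loop is built from a configuration that
    attains it. Reflecting Y exchanges the two triangles. For [e = 0] the triangles are segments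
    along [g], and exchanging the axes of the square makes them chords. *)
Lemma trap_capacity o u v T (e : R) : det2 u v != 0 -> 0 <= e <= 1/2 -> convex_body T ->
  exists c : R, [/\ 0 < c, cEHZ ((frame o u v @` trap e) `*` T) = c, fits T u v e c &
    forall r, fits T u v e r -> r <= c].
Proof.
move=> d0 e01 bT; set f := dual1 u v; set g := dual2 u v.
have cT : convex_set T by case: bT.
have d0' : det2 v u != 0.
  by have -> : det2 v u = - det2 u v; [rewrite /det2; ring | rewrite oppr_eq0].
have [fu fv _ gv] := dot2_dual d0; rewrite -/f -/g in fu fv gv.
have f0 : f != 0 by apply/eqP => h; move: fu; rewrite h dot20l; lra.
have m0 : e *: f - g != 0.
  apply/eqP => h; have : dot2 (e *: f - g) v = 0 by rewrite h dot20l.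
  by rewrite dot2Bl dot2Zl fv gv; lra.
have p0 : e *: f + g != 0.
  apply/eqP => h; have : dot2 (e *: f + g) v = 0 by rewrite h dot20l.
  by rewrite dot2Dl dot2Zl fv gv; lra.
have [l0 [l00 F0 M0]] := max_scale 0 bT f0.
have [l1 [l10 F1 M1]] := max_scale ((2 * e) *: f) bT m0.
have [l2 [l20 F2 M2]] := max_scale ((2 * e) *: f) bT p0.
have {}M0 r : fits3 T f 0 0 r -> r <= l0 by move=> [s [h1 h2 h3]]; exact: M0 h1 h2 h3.
have {}M1 r : fits3 T (e *: f - g) 0 ((2 * e) *: f) r -> r <= l1.
  by move=> [s [h1 h2 h3]]; exact: M1 h1 h2 h3.
have {}M2 r : fits3 T (e *: f + g) 0 ((2 * e) *: f) r -> r <= l2.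
  by move=> [s [h1 h2 h3]]; exact: M2 h1 h2 h3.
pose c := Num.min l0 (Num.min l1 l2).
have c0 : 0 < c by rewrite !lt_min l00 l10 l20.
have fT : fits T u v e c.
  split; [apply: fits3_le cT l00 _ F0 | apply: fits3_le cT l10 _ F1 | apply: fits3_le cT l20 _ F2];
    by rewrite (ltW c0) !ge_min lexx ?orbT.
exists c; split=> //; last first.
  by move=> r [/M0 h0 /M1 h1 /M2 h2]; rewrite !le_min h0 h1 h2.
apply: cEHZ_eq; last by move=> a aa; exact: (trap_action_ge d0 e01 bT aa c0 fT).
have e0 : 0 <= e by case/andP: e01.
have [[cl|cl]|cl] : (c = l0 \/ c = l1) \/ c = l2.
- by rewrite /c; do 2?[case: (ltP _ _) => _]; [left; left|left;right|right].
- by apply: chord_action => // r; rewrite cl; exact: M0.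
- move: e0; rewrite le_eqVlt => /predU1P[e0|e0]; last first.
    by apply: triangle_action => // r; rewrite cl; exact: M1.
  move: fT M1 e01; rewrite -e0 => fT M1 e01.
  rewrite -frame_trap0_swap; apply: chord_action => //; first exact: fits0_swap.
  move=> r; rewrite dual1_swap cl -/g => h; apply: M1.
  by rewrite mulr0 !scale0r add0r; exact: fits3_opp.
- move: e0; rewrite le_eqVlt => /predU1P[e0|e0]; last first.
    rewrite -frame_trap_flip; apply: triangle_action => //; first by rewrite det2Nr oppr_eq0.
      exact: fits_flip.
    by move=> r; rewrite dual1_flip dual2_flip opprK cl; exact: M2.
  move: fT M2 e01; rewrite -e0 => fT M2 e01.
  rewrite -frame_trap0_swap; apply: chord_action => //; first exact: fits0_swap.
  move=> r; rewrite dual1_swap cl -/g => h; apply: M2.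
  by rewrite mulr0 !scale0r add0r.
Qed.

End TrapezoidCapacity.

(** * The area inequality *)

Section ChordArea.
Context {R : realType}.
Local Notation R2 := (R * R)%type.
Implicit Types (W : set R2).

Definition right_area W (y A : R) : Prop :=
  exists2 s, chord_chain W 0 y 1 s & A <= chord_area 0 1 s.

(** Chains are read from left to right, so the left part is described by how it prolongs an
    arbitrary chain starting at the unit chord; this makes the two sides independent. *)
Definition left_area W (y A : R) : Prop :=
  forall s, chord_chain W 0 y 1 s -> exists x z l s',
    chord_chain W x z l s' /\ A + chord_area 0 1 s <= chord_area x l s'.

Lemma vol2_ge_halves W (y A B : R) : convex_set W -> measurable2 W ->
  left_area W y A -> right_area W y B -> ((A + B)%:E <= vol2 W)%E.
Proof.
move=> cW mW lA [s ch hB]; have [x [z [l [s' [ch' hA]]]]] := lA s ch.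
apply: le_trans (vol2_ge_chords cW mW ch'); rewrite lee_fin.
by apply: le_trans hA; rewrite lerD2l.
Qed.

Section Sides.
Variables (W : set R2) (y : R).
Hypotheses (W0 : W (0, y)) (W1 : W (0, y + 1)).

Lemma right_area_apex (x z : R) : W (x, z) -> right_area W y (x / 2).
Proof.
move=> Wx; have [x0|x0] := leP 0 x; last first.
  by exists [::] => /=; [split | lra].
exists [:: (x, z, 0)] => /=; last by lra.
by split=> //; split=> //; split=> //; rewrite addr0.
Qed.

(** An apex beyond the chord adds a triangle. For an apex before it the chord alone gives enough, as
    [l * x] is then at most [l * v]. *)
Lemma right_area_trapezoid (x z v zv l : R) : 0 <= v -> 0 <= l -> W (x, z) -> W (v, zv) ->
  W (v, zv + l) -> right_area W y ((v + l * x) / 2).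
Proof.
move=> v0 l0 Wx Wv Wvl; have [xv|xv] := leP v x.
  exists [:: (v, zv, l); (x, z, 0)] => /=; last by lra.
  by do 3?split=> //; rewrite addr0.
exists [:: (v, zv, l)] => /=; last by nra.
by do 3?split=> //.
Qed.

Lemma left_area_apex (x z : R) : W (x, z) -> left_area W y (- x / 2).
Proof.
move=> Wx s ch; have [x0|x0] := leP x 0; last first.
  by exists 0, y, 1, s; split=> //; lra.
exists x, z, 0, ((0, y, 1) :: s); split; last by rewrite /=; lra.
by split=> //; rewrite addr0.
Qed.

Lemma left_area_trapezoid (x z u zu l : R) : u <= 0 -> 0 <= l -> W (x, z) -> W (u, zu) ->
  W (u, zu + l) -> left_area W y ((- u - l * x) / 2).
Proof.
move=> u0 l0 Wx Wu Wul s ch; have [xu|xu] := leP x u.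
  exists x, z, 0, [:: (u, zu, l), (0, y, 1) & s]; split; last by rewrite /=; lra.
  by do 2?[split=> //; rewrite ?addr0 //].
exists u, zu, l, ((0, y, 1) :: s); split; last by rewrite /=; nra.
by split.
Qed.

End Sides.

(* The three configurations of [fits], at unit scale and in the basis [(dual2, dual1)]. *)
Definition unit_config W (e y u z v t : R) : Prop :=
  [/\ W (0, y) /\ W (0, y + 1),
      [/\ W (u, z), W (u, z + 2 * e) & W (u + 1, z + e)] &
      [/\ W (v, t), W (v, t + 2 * e) & W (v - 1, t + e)]].

(* Here [x = (1 - e) u], [y = (1 - e) v] and [z = 2 (1 - e) w] in the notation of
   [unit_config_area]; the hypotheses are its four lower bounds on the area. *)
Lemma unit_config_arith (e x y z : R) : 0 <= e <= 1/2 ->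
  2 * (1 - e) - (y - x) <= z ->
  (0 <= y -> 1 + e * (1 - 2 * e) + 2 * (e * x) <= z) ->
  (x <= 0 -> 1 + e * (1 - 2 * e) - 2 * (e * y) <= z) ->
  (x <= 0 -> 0 <= y -> 1 + (1 - 2 * e) * (y - x - (1 - 2 * e)) <= z) ->
  1 <= z /\ (0 < e < 1/2 -> z = 1 -> x = - y /\ 2 * y = 1 - 2 * e).
Proof.
move=> /andP[e0 e1] h1 h2 h3 h4.
have q0 : 0 <= e * (1 - 2 * e) by apply: mulr_ge0; lra.
have q1 : 0 < e < 1/2 -> 0 < e * (1 - 2 * e) by move=> /andP[? ?]; apply: mulr_gt0; lra.
(* The first bound suffices up to y - x = 1 - 2e. Beyond, the signs of [x] and [y] select one of the
   other three, which is strict for 0 < e < 1/2; equality thus forces y - x = 1 - 2e. *)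
have far : 1 - 2 * e < y - x -> 1 <= z /\ (0 < e < 1/2 -> 1 < z).
  move=> m1; have [x0|x0] := leP x 0; have [y0|y0] := leP 0 y.
  - have {}h4 := h4 x0 y0; split.
      by apply: le_trans h4; rewrite lerDl mulr_ge0 //; lra.
    move=> /andP[e0' e1']; apply: lt_le_trans h4.
    by rewrite ltrDl mulr_gt0 //; lra.
  - have {}h3 := h3 x0; have ey : 0 <= e * - y by rewrite mulr_ge0 //; lra.
    by split=> [|/q1 ?]; lra.
  - have {}h2 := h2 y0; have ex : 0 <= e * x by rewrite mulr_ge0 // ltW.
    by split=> [|/q1 ?]; lra.
  - by lra.
have [m1|/far[f1 f2]] := leP (y - x) (1 - 2 * e); last first.
  by split=> // /f2 + zE; rewrite zE ltxx.
split; first by lra.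
move=> e01 z1; have {}q1 := q1 e01; case/andP: e01 => e0' e1'.
have m2 : y - x = 1 - 2 * e by lra.
have x0 : x <= 0.
  rewrite leNgt; apply/negP => x0; have y0 : 0 <= y by lra.
  by have := h2 y0; have : 0 <= e * x by [rewrite mulr_ge0 // ltW]; lra.
have y0 : 0 <= y.
  rewrite leNgt; apply/negP => y0.
  by have := h3 x0; have : 0 <= e * - y by [rewrite mulr_ge0 //; lra]; lra.
have k2 : 2 * x <= - (1 - 2 * e) by rewrite -(ler_pM2l e0'); have := h2 y0; lra.
have k3 : - (2 * y) <= - (1 - 2 * e) by rewrite -(ler_pM2l e0'); have := h3 x0; lra.
by split; lra.
Qed.

(** On each side of the unit chord one may use the apex of one triangle alone, or also the base of
    the other triangle if it lies on that side. The four combinations give the four bounds of the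
    arithmetic lemma. *)
Lemma unit_config_area W (e y u z v t w : R) : 0 <= e <= 1/2 -> convex_set W -> measurable2 W ->
  unit_config W e y u z v t -> (vol2 W <= w%:E)%E ->
  1 <= 2 * (1 - e) * w /\
  (0 < e < 1/2 -> 2 * (1 - e) * w = 1 -> u = - v /\ 2 * (1 - e) * v = 1 - 2 * e).
Proof.
move=> /andP[e0 e1] cW mW [[W0 W1] [A1 A2 A3] [B1 B2 B3]] wW.
have key A B : left_area W y A -> right_area W y B -> A + B <= w.
  by move=> lA rB; rewrite -lee_fin; apply: le_trans wW; exact: vol2_ge_halves lA rB.
have e20 : 0 <= 2 * e by lra.
have R1 := right_area_apex W0 W1 A3.
have L1 := @left_area_apex W y _ _ B3.
have R2' : 0 <= v -> right_area W y ((v + 2 * e * (u + 1)) / 2).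
  by move=> v0; exact: right_area_trapezoid A3 B1 B2.
have L2 : u <= 0 -> left_area W y ((- u - 2 * e * (v - 1)) / 2).
  by move=> u0; exact: (@left_area_trapezoid W y _ _ _ _ _ u0 e20 B3 A1 A2).
have h1 := key _ _ L1 R1.
have h2 v0 := key _ _ L1 (R2' v0).
have h3 u0 := key _ _ (L2 u0) R1.
have h4 u0 v0 := key _ _ (L2 u0) (R2' v0).
have c0 : 0 < 1 - e by lra.
have c2 : 2 * (1 - e) * w = (1 - e) * (2 * w) by ring.
have sx : ((1 - e) * u <= 0) = (u <= 0) by rewrite pmulr_rle0.
have sy : (0 <= (1 - e) * v) = (0 <= v) by rewrite pmulr_rge0.
have [||||| r1 r2] := @unit_config_arith e ((1 - e) * u) ((1 - e) * v) (2 * (1 - e) * w).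
- by rewrite e0.
- have -> : 2 * (1 - e) - ((1 - e) * v - (1 - e) * u) = (1 - e) * (2 - (v - u)) by ring.
  by rewrite c2 ler_pM2l //; lra.
- rewrite sy => /h2 {}h2.
  have -> : 1 + e * (1 - 2 * e) + 2 * (e * ((1 - e) * u)) = (1 - e) * (1 + 2 * e + 2 * e * u) by ring.
  by rewrite c2 ler_pM2l //; lra.
- rewrite sx => /h3 {}h3.
  have -> : 1 + e * (1 - 2 * e) - 2 * (e * ((1 - e) * v)) = (1 - e) * (1 + 2 * e - 2 * e * v) by ring.
  by rewrite c2 ler_pM2l //; lra.
- rewrite sx sy => u0 v0; have {}h4 := h4 u0 v0.
  have -> : 1 + (1 - 2 * e) * ((1 - e) * v - (1 - e) * u - (1 - 2 * e)) =
    (1 - e) * (4 * e + (v - u) * (1 - 2 * e)) by ring.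
  by rewrite c2 ler_pM2l //; lra.
split=> // e01 we; have [xy vE] := r2 e01 we.
have c1 : 1 - e != 0 by rewrite gt_eqF.
by split; [apply: (mulfI c1); rewrite mulrN | rewrite -mulrA].
Qed.

End ChordArea.

(** * From planar areas to the volume of the product *)

Section TrapezoidVolume.
Context {R : realType}.
Local Notation R2 := (R * R)%type.
Implicit Types (T : set R2) (o u v : R2).

Lemma frame_surj o u v (z : R2) : det2 u v != 0 -> exists p, frame o u v p = z.
Proof. by move=> d0; eexists; exact: frame_dual. Qed.

Lemma det_dual_scaled u v (c : R) : det2 u v != 0 ->
  det2 (c *: dual2 u v) (c *: dual1 u v) = - (c ^+ 2 / det2 u v).
Proof.
move=> d0; move: d0; rewrite /det2 /dual1 /dual2 /det2 /= /GRing.scale /= => d0.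
by field.
Qed.

Lemma det_dual_scaled_neq0 u v (c : R) : det2 u v != 0 -> 0 < c ->
  det2 (c *: dual2 u v) (c *: dual1 u v) != 0.
Proof.
by move=> d0 c0; rewrite det_dual_scaled // oppr_eq0 mulf_neq0 ?invr_eq0 // expf_neq0 // gt_eqF.
Qed.

(** The dual vectors are exchanged so that the chord along [dual1] becomes vertical, as the chord
    areas require; the factor [c] gives it unit length. *)
Local Notation momenta u v c s := (frame s (c *: dual2 u v) (c *: dual1 u v)).

(** The chart of [K] and the dual chart of [T] have inverse determinants up to sign and [c ^+ 2], so
    only the planar preimage of [T] matters. *)
Lemma trap_vol4 o u v T s (e c : R) : det2 u v != 0 -> 0 <= e <= 1/2 -> 0 < c -> convex_body T ->
  vol4 ((frame o u v @` trap e) `*` T) =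
  (((1 - e) * c ^+ 2)%:E * vol2 (momenta u v c s @^-1` T))%E.
Proof.
move=> d0 e01 c0 [cT kT _].
have mT := compact_measurable2 kT.
have [_ /compact_measurable2 mK _] := frame_trap_body o d0 e01.
rewrite (vol4X mK mT) (vol2_frame_trap o d0 e01) (vol2_frame_preimage s (det_dual_scaled_neq0 d0 c0) mT).
rewrite muleA -EFinM det_dual_scaled // normrN normrM normfV normrX (gtr0_norm c0).
congr (_%:E * _)%E; have : `|det2 u v| != 0 by rewrite normr_eq0.
by move=> ?; field.
Qed.

Lemma fits_unit_config T u v (e c : R) : det2 u v != 0 -> 0 < c -> fits T u v e c ->
  exists s (u' z v' t : R), unit_config (momenta u v c s @^-1` T) e 0 u' z v' t.
Proof.
move=> d0 c0 [[s [h1 h2 _]] [s1 [A1 A2 A3]] [s2 [B1 B2 B3]]].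
have [[v' t] E1] := frame_surj s s1 (det_dual_scaled_neq0 d0 c0).
have [[u' z] E2] := frame_surj s s2 (det_dual_scaled_neq0 d0 c0).
exists s, u', z, v', t; move: h1 h2 A1 A2 A3 B1 B2 B3; rewrite -E1 -E2 /frame /=.
move: (dual1 u v) (dual2 u v) s {E1 E2} => f g s.
move=> h1 h2 A1 A2 A3 B1 B2 B3; split; split; rewrite /frame /=.
- by move: h2; congr T; vring f g s.
- by move: h1; congr T; vring f g s.
- by move: B2; congr T; vring f g s.
- by move: B3; congr T; vring f g s.
- by move: B1; congr T; vring f g s.
- by move: A2; congr T; vring f g s.
- by move: A3; congr T; vring f g s.
- by move: A1; congr T; vring f g s.
Qed.

Lemma momenta_convex T u v (c : R) s : convex_set T -> convex_set (momenta u v c s @^-1` T).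
Proof. exact: frame_preimage_convex. Qed.

Lemma fits_vol4 o u v T (e c : R) : det2 u v != 0 -> 0 <= e <= 1/2 -> 0 < c -> convex_body T ->
  fits T u v e c -> ((c ^+ 2 / 2)%:E <= vol4 ((frame o u v @` trap e) `*` T))%E.
Proof.
move=> d0 e01 c0 bT fT; have [s [u' [z [v' [t cfg]]]]] := fits_unit_config d0 c0 fT.
rewrite (trap_vol4 o s d0 e01 c0 bT).
have mW : measurable2 (momenta u v c s @^-1` T).
  by apply: frame_preimage_measurable; [exact: det_dual_scaled_neq0 | case: bT => _ /compact_measurable2].
have cW : convex_set (momenta u v c s @^-1` T) by apply: momenta_convex; case: bT.
have k0 : 0 < (1 - e) * c ^+ 2 by rewrite mulr_gt0 ?exprn_gt0 //; case/andP: e01 => *; lra.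
have := @unit_config_area _ _ _ _ _ _ _ _ _ e01 cW mW cfg.
have V0 : (0 <= vol2 (momenta u v c s @^-1` T))%E by exact: (measure_ge0 borel_vol2).
case: (vol2 _) V0 => [w||] // _ H; last first.
  by rewrite gt0_muley ?leey ?lte_fin.
have [h _] := H w (lexx _).
by rewrite -EFinM lee_fin; have := ler_wpM2r (sqr_ge0 c) h; lra.
Qed.

(* A configuration of scale [r] in [T] bounds the capacity below by [r], and the capacity bounds
   the volume below. *)
Lemma trap_equality_intro o u v T (e r : R) : det2 u v != 0 -> 0 <= e <= 1/2 -> 0 < r ->
  convex_body T -> fits T u v e r ->
  (vol4 ((frame o u v @` trap e) `*` T) <= (r ^+ 2 / 2)%:E)%E ->
  vol4 ((frame o u v @` trap e) `*` T) = (cEHZ ((frame o u v @` trap e) `*` T) ^+ 2 / 2)%:E.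
Proof.
move=> d0 e01 r0 bT fT; have [c [c0 -> fc cmax]] := trap_capacity o d0 e01 bT.
have cle := cmax _ fT.
have := fits_vol4 o d0 e01 c0 bT fc => h h'.
apply/eqP; rewrite eq_le h andbT; apply: le_trans h' _; rewrite lee_fin.
by rewrite ler_pM2r ?invr_gt0 ?ltr0n // ler_sqr ?nnegrE //; lra.
Qed.

Lemma trap_equality_elim o u v T (e : R) : det2 u v != 0 -> 0 <= e <= 1/2 -> convex_body T ->
  vol4 ((frame o u v @` trap e) `*` T) = (cEHZ ((frame o u v @` trap e) `*` T) ^+ 2 / 2)%:E ->
  exists c s (u' z v' t : R), let W := momenta u v c s @^-1` T in
    [/\ 0 < c, fits T u v e c, unit_config W e 0 u' z v' t & vol2 W = (1 / (2 * (1 - e)))%:E].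
Proof.
move=> d0 e01 bT; have [c [c0 -> fc _]] := trap_capacity o d0 e01 bT.
have [s [u' [z [v' [t cfg]]]]] := fits_unit_config d0 c0 fc.
rewrite (trap_vol4 o s d0 e01 c0 bT) => H.
exists c, s, u', z, v', t; split=> //.
have e0 : 1 - e != 0 by rewrite gt_eqF //; case/andP: e01 => *; lra.
have k0 : 0 < (1 - e) * c ^+ 2 by rewrite mulr_gt0 ?exprn_gt0 //; case/andP: e01 => *; lra.
move: H; case: (vol2 _) => [w|/=|/=].
- rewrite -EFinM => -[H]; congr EFin; apply: (mulfI (_ : (1 - e) * c ^+ 2 != 0)); first by rewrite gt_eqF.
  rewrite H; field; exact: e0.
- by rewrite gt0_muley ?lte_fin.
- by rewrite gt0_muleNy ?lte_fin.
Qed.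

End TrapezoidVolume.

(** * Triangles *)

Section Homothety.
Context {R : realType}.
Local Notation R2 := (R * R)%type.
Implicit Types (T W : set R2).

Lemma homothetE T (lam : R) (s : R2) :
  translate (scale_set lam T) s = frame s (lam, 0) (0, lam) @` T.
Proof.
have E p : lam *: p + s = frame s (lam, 0) (0, lam) p by rewrite /frame; vring p s s.
apply/seteqP; split.
  by move=> _ [_ [p Tp <-] <-]; exists p => //; rewrite E.
by move=> _ [p Tp <-]; exists (lam *: p); [exists p | rewrite E].
Qed.

Lemma homothet_fits3 T (lam r : R) (s A B C : R2) : fits3 T A B C r ->
  fits3 (translate (scale_set lam T) s) A B C (lam * r).
Proof.
move=> [p [h1 h2 h3]]; exists (lam *: p + s).
have key X : T (r *: X + p) -> translate (scale_set lam T) s (lam * r *: X + (lam *: p + s)).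
  move=> TX; exists (lam *: (r *: X + p)); first by exists (r *: X + p).
  by rewrite scalerDr scalerA addrA.
by split; apply: key.
Qed.

Lemma vol2_homothet T (lam : R) (s : R2) : 0 < lam -> compact T ->
  vol2 (translate (scale_set lam T) s) = ((lam ^+ 2)%:E * vol2 T)%E.
Proof.
move=> lam0 kT; have dE : det2 (lam, 0) (0, lam) = lam ^+ 2 :> R by rewrite /det2 /=; ring.
rewrite homothetE vol2_frame_image ?dE ?gt_eqF ?exprn_gt0 //.
  by rewrite ger0_norm // sqr_ge0.
apply: compact_measurable2; apply: continuous_compact kT.
by apply: continuous_subspaceT; exact: frame_continuous.
Qed.

Lemma homothet_compact T (lam : R) (s : R2) : compact T -> compact (translate (scale_set lam T) s).
Proof.
move=> kT; rewrite homothetE; apply: continuous_compact kT.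
by apply: continuous_subspaceT; exact: frame_continuous.
Qed.

Lemma J2_frame (o u v p : R2) : J2 (frame o u v p) = frame (J2 o) (J2 u) (J2 v) p.
Proof. by case: p => p1 p2; rewrite /frame /J2 /=; vring o u v. Qed.

Lemma frame_square_vol2 (o u v : R2) : det2 u v != 0 ->
  compact (frame o u v @` unit_square) /\
  vol2 (frame o u v @` unit_square) = `|det2 u v|%:E.
Proof.
move=> d0; have k : compact (frame o u v @` unit_square).
  apply: continuous_compact.
    by apply: continuous_subspaceT; exact: frame_continuous.
  have -> : unit_square = `[(0:R), 1]%classic `*` `[(0:R), 1]%classic.
    by apply/seteqP; split=> p [/= h1 h2]; split; move: h1 h2; rewrite /= !in_itv.
  by apply: compact_setX; exact: segment_compact.
by split=> //; rewrite vol2_frame_image ?vol2_unit_square ?mule1 //; exact: compact_measurable2.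
Qed.

End Homothety.

Section Triangles.
Context {R : realType}.
Local Notation R2 := (R * R)%type.
Implicit Types (T W : set R2).

Lemma triangle_frame (a b c : R2) :
  conv_hull [set p | p = a \/ p = b \/ p = c] =
  frame ((1/2) *: (a + b)) (c - (1/2) *: (a + b)) (b - a) @` trap (1/2).
Proof.
set S := [set p | _].
apply/seteqP; split.
  apply: conv_hull_sub; first by apply: frame_image_convex; exact: trap_convex.
  move=> p [->|[->|->]].
  - by exists (0, -(1/2)); [split=> /=; lra | rewrite /frame /=; vring a b c].
  - by exists (0, 1/2); [split=> /=; lra | rewrite /frame /=; vring a b c].
  - by exists (1, 0); [split=> /=; lra | rewrite /frame /=; vring a b c].
move=> _ [[x y] [/= x0 x1 y1 y2] <-].
have Sa : conv_hull S a by apply: sub_conv_hull; left.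
have Sb : conv_hull S b by apply: sub_conv_hull; right; left.
have Sc : conv_hull S c by apply: sub_conv_hull; right; right.
have cS := @conv_hull_convex _ S.
have [x1'|x1'] := ltP x 1; last first.
  have -> : y = 0 by lra.
  have -> : x = 1 by lra.
  by move: Sc; congr (conv_hull S); rewrite /frame /=; vring a b c.
have ne : 1 - x != 0 by rewrite gt_eqF //; lra.
pose t := ((1 - x) / 2 + y) / (1 - x).
have t01 : 0 <= t <= 1.
  by rewrite /t divr_ge0 /=; [rewrite ler_pdivrMr; lra | lra | lra].
have x01 : 0 <= x <= 1 by rewrite x0.
have := cS _ _ Sc (cS _ _ Sb Sa t t01) x x01.
congr (conv_hull S); have yE : y = t * (1 - x) - (1 - x) / 2 by rewrite /t divfK //; lra.
rewrite yE /frame /=; clear; move: t => t.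
by vring a b c.
Qed.

Lemma half_range : 0 <= (1/2 : R) <= 1/2. Proof. by apply/andP; split; lra. Qed.

Lemma convex_interior_triangle W (a b c : R2) : convex_set W -> W a -> W b -> W c ->
  det2 (b - a) (c - a) != 0 -> (W°) !=set0.
Proof.
move=> cW Wa Wb Wc d0.
have d1 : det2 (c - (1/2) *: (a + b)) (b - a) != 0.
  have -> : det2 (c - (1/2) *: (a + b)) (b - a) = - det2 (b - a) (c - a).
    by rewrite /det2 /= /GRing.scale /=; field.
  by rewrite oppr_eq0.
have [_ _ [i hi]] := frame_trap_body ((1/2) *: (a + b)) d1 half_range.
exists i; apply: interiorS hi; rewrite -triangle_frame.
by apply: conv_hull_sub => // p [->|[->|->]].
Qed.

Section Family.
Variables (a b c : R2).
Let o := (1/2) *: (a + b).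
Let u := c - o.
Let v := b - a.
Let d := det2 u v.
Hypothesis d0 : 0 < d.
Let D := conv_hull [set p | p = a \/ p = b \/ p = c].

Lemma conv_JD_E t : conv_JD D t = conv_hull ((frame (J2 o) (J2 u) (J2 v) @` trap (1/2)) `|`
  (frame (- J2 o + t) (- J2 u) (- J2 v) @` trap (1/2))).
Proof.
rewrite /conv_JD /D triangle_frame -/o -/u -/v; congr (conv_hull (_ `|` _)).
  apply/seteqP; split; first by move=> _ [_ [p tp <-] <-]; exists p; rewrite ?J2_frame.
  by move=> _ [p tp <-]; exists (frame o u v p); [exists p | rewrite J2_frame].
have E p : - J2 (frame o u v p) + t = frame (- J2 o + t) (- J2 u) (- J2 v) p.
  rewrite J2_frame; move: (J2 u) (J2 v) (J2 o) p => u' v' o' [p1 p2]; rewrite /frame /=.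
  by move: t => [t1 t2]; vring u' v' o'.
apply/seteqP; split; first by move=> _ [_ [p tp <-] <-]; exists p; rewrite ?E.
by move=> _ [p tp <-]; exists (frame o u v p); [exists p | rewrite E].
Qed.

Lemma conv_JD_body t : convex_body (conv_JD D t).
Proof.
have dJ : det2 (J2 u) (J2 v) != 0.
  have -> : det2 (J2 u) (J2 v) = d by rewrite /d /det2 /=; ring.
  by rewrite gt_eqF.
have dJ' : det2 (- J2 u) (- J2 v) != 0.
  by have -> : det2 (- J2 u) (- J2 v) = det2 (J2 u) (J2 v) by rewrite /det2 /=; ring.
have [c1 k1 [i1 h1]] := frame_trap_body (J2 o) dJ half_range.
have [c2 k2 [i2 h2]] := frame_trap_body (- J2 o + t) dJ' half_range.
rewrite conv_JD_E; split; first exact: conv_hull_convex.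
  by apply: conv_hull_compact => //; [exists i1; exact: interior_subset h1 | exists i2; exact: interior_subset h2].
exists i1; apply: interiorS h1; apply: subset_trans (@sub_conv_hull _ _).
exact: subsetUl.
Qed.

Lemma J2D_mem t p : D p -> conv_JD D t (J2 p).
Proof. by move=> Dp; apply: sub_conv_hull; left; exists p. Qed.

Lemma NJ2D_mem t p : D p -> conv_JD D t (- J2 p + t).
Proof. by move=> Dp; apply: sub_conv_hull; right; exists p. Qed.

(** Scaled by [d], the dual vectors are the rotated edge from [a] to [b] and a rotated median of
    [D]. So the chord is an edge of J D, and the two triangles are J D and its reflected
    translate. *)
Lemma conv_JD_fits t : fits (conv_JD D t) u v (1/2) d.
Proof.
have Da : D a by apply: sub_conv_hull; left.
have Db : D b by apply: sub_conv_hull; right; left.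
have Dc : D c by apply: sub_conv_hull; right; right.
have fE : d *: dual1 u v = J2 b - J2 a.
  have : d != 0 by rewrite gt_eqF.
  by rewrite /d /dual1 /J2 /v /= => ?; congr pair; rewrite /= /GRing.scale /=; field.
have gE : d *: dual2 u v = J2 o - J2 c.
  have : d != 0 by rewrite gt_eqF.
  by rewrite /d /dual2 /J2 /u /= => ?; congr pair; rewrite /= /GRing.scale /=; field.
have oE : J2 o = (1/2) *: J2 a + (1/2) *: J2 b.
  by rewrite /o /J2; vring a b c.
have l1 : 2 * (1/2) = 1 :> R by field.
split.
- exists (J2 a); rewrite scaler0 add0r fE subrK.
  by split; exact: J2D_mem.
- exists (J2 a); rewrite l1 scale1r scaler0 add0r fE subrK scalerBr scalerA mulrC -scalerA fE gE.
  split; try exact: J2D_mem.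
  have -> : (1/2) *: (J2 b - J2 a) - (J2 o - J2 c) + J2 a = J2 c.
    by rewrite oE; vring (J2 a) (J2 b) (J2 c).
  exact: J2D_mem.
- exists (- J2 b + t); rewrite l1 scale1r scaler0 add0r fE scalerDr scalerA mulrC -scalerA fE gE.
  split; last 2 first.
  + exact: NJ2D_mem.
  + have -> : J2 b - J2 a + (- J2 b + t) = - J2 a + t by vring (J2 a) (J2 b) t.
    exact: NJ2D_mem.
  have -> : (1/2) *: (J2 b - J2 a) + (J2 o - J2 c) + (- J2 b + t) = - J2 c + t.
    by rewrite oE; move: t => [t1 t2]; vring (J2 a) (J2 b) (J2 c).
  exact: NJ2D_mem.
Qed.

Lemma vol4_D T : convex_body T -> vol4 (D `*` T) = ((d / 2)%:E * vol2 T)%E.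
Proof.
move=> [_ kT _]; rewrite /D triangle_frame -/o -/u -/v.
have dn : d != 0 by rewrite gt_eqF.
have [_ kK _] := frame_trap_body o dn half_range.
rewrite vol4X; [|exact: compact_measurable2|exact: compact_measurable2].
by rewrite vol2_frame_trap ?half_range // -/d gtr0_norm //; congr (_%:E * _)%E; field.
Qed.

(** The hull contains the configurations at scale [d], so the volume inequality bounds its area. *)
Lemma conv_JD_vol_ge t : (d%:E <= vol2 (conv_JD D t))%E.
Proof.
have dn : d != 0 by rewrite gt_eqF.
have := fits_vol4 o dn half_range d0 (conv_JD_body t) (conv_JD_fits t).
rewrite -triangle_frame -/D vol4_D; last exact: conv_JD_body.
have V0 : (0 <= vol2 (conv_JD D t))%E by exact: (measure_ge0 borel_vol2).
case: (vol2 _) V0 => [w||] // _; last by rewrite leey.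
by rewrite -EFinM !lee_fin expr2 mulrAC ler_pM2l //; move: d0 => *; lra.
Qed.

(** This translation reflects J D in the midpoint of one of its edges, and a triangle together with
    such a reflection is a parallelogram of twice its area. *)
Lemma conv_JD_vol_min : vol2 (conv_JD D (2 *: J2 o)) = d%:E.
Proof.
apply/eqP; rewrite eq_le conv_JD_vol_ge andbT.
have dE : det2 ((1/2) *: J2 v + J2 u) ((1/2) *: J2 v - J2 u) = d.
  by rewrite /d /det2 /= /GRing.scale /=; field.
have dn : d != 0 by rewrite gt_eqF.
have [/compact_measurable2 mS vS] := @frame_square_vol2 _ (J2 o - (1/2) *: J2 v) ((1/2) *: J2 v + J2 u)
  ((1/2) *: J2 v - J2 u) ltac:(by rewrite dE).
rewrite -[d in leRHS]gtr0_norm // -dE -vS.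
apply: (le_measure borel_vol2); rewrite ?inE //.
  by apply: compact_measurable2; have [] := conv_JD_body (2 *: J2 o).
rewrite conv_JD_E; apply: conv_hull_sub.
  apply: frame_image_convex => -[p1 p2] [q1 q2] [/= /andP[? ?] /andP[? ?]] [/= /andP[? ?] /andP[? ?]] t /andP[? ?].
  by split; rewrite /= /GRing.scale /=; nra.
move=> _ [[[x y] [/= x0 x1 y1 y2] <-]|[[x y] [/= x0 x1 y1 y2] <-]].
  exists (y + 1/2 + x / 2, y + 1/2 - x / 2); first by split=> /=; lra.
  by rewrite /frame /=; vring (J2 o) (J2 u) (J2 v).
exists (- y + 1/2 - x / 2, - y + 1/2 + x / 2); first by split=> /=; lra.
by rewrite /frame /=; vring (J2 o) (J2 u) (J2 v).
Qed.

Lemma T_family_vol2 T : T_family D T <-> exists t, T = conv_JD D t /\ vol2 T = d%:E.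
Proof.
split=> -[t [-> h]]; exists t; (split; first by []).
  by apply/eqP; rewrite eq_le conv_JD_vol_ge andbT -conv_JD_vol_min.
by move=> t'; rewrite h; exact: conv_JD_vol_ge.
Qed.

Lemma triangle_equality_intro T (lam : R) (s : R2) Ts : convex_body T -> 0 < lam ->
  T_family D Ts -> T = translate (scale_set lam Ts) s ->
  vol4 (D `*` T) = (cEHZ (D `*` T) ^+ 2 / 2)%:E.
Proof.
move=> bT lam0 /T_family_vol2[t [-> vt]] TE.
have dn : d != 0 by rewrite gt_eqF.
have fT : fits T u v (1/2) (lam * d).
  by rewrite TE; have [h1 h2 h3] := conv_JD_fits t; split; apply: homothet_fits3.
have := @trap_equality_intro _ o u v T (1/2) (lam * d) dn half_range (mulr_gt0 lam0 d0) bT fT.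
rewrite -triangle_frame -/D; apply.
rewrite vol4_D // TE vol2_homothet //; last by have [] := conv_JD_body t.
by rewrite vt -!EFinM lee_fin le_eqVlt; apply/orP; left; apply/eqP; field.
Qed.

(** For [e = 1/2] the two triangles that fit into [T] are translates of J D and - J D, scaled alike.
    Their hull is homothetic to some [conv_JD D t]; equality leaves [T] no more area than the least
    possible for such a hull. *)
Lemma triangle_equality_elim T : convex_body T ->
  vol4 (D `*` T) = (cEHZ (D `*` T) ^+ 2 / 2)%:E ->
  exists (lam : R) (s : R2) (Ts : set R2),
    [/\ 0 < lam, T_family D Ts & T = translate (scale_set lam Ts) s].
Proof.
move=> bT; have dn : d != 0 by rewrite gt_eqF.
have [c' [c0 + fT _]] := trap_capacity o dn half_range bT.
rewrite -triangle_frame -/D => -> H.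
have [[_ [_ _ _]] [s1 [A1 A2 A3]] [s2 [B1 B2 B3]]] := fT.
have cT : convex_set T by case: bT.
pose lam := c' / d; have lam0 : 0 < lam by rewrite divr_gt0.
have lamE w : lam *: (d *: w) = c' *: w by rewrite scalerA /lam divfK.
(* Matches the vertex [s1] of the first triangle with J a and the vertex [s2] of the second with - J
   b + t. *)
pose s := s1 - lam *: J2 a; pose t := lam^-1 *: (s2 - s) + J2 b.
have fE : d *: dual1 u v = J2 b - J2 a.
  by rewrite /d /dual1 /J2 /v /=; congr pair; rewrite /= /GRing.scale /=; field.
have gE : d *: dual2 u v = J2 o - J2 c.
  by rewrite /d /dual2 /J2 /u /=; congr pair; rewrite /= /GRing.scale /=; field.
have oE : J2 o = (1/2) *: J2 a + (1/2) *: J2 b by rewrite /o /J2; vring a b c.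
have l1 : 2 * (1/2) = 1 :> R by field.
have mE : d *: ((1/2) *: dual1 u v - dual2 u v) = J2 c - J2 a.
  by rewrite scalerBr scalerA mulrC -scalerA fE gE oE; vring (J2 a) (J2 b) (J2 c).
have pE : d *: ((1/2) *: dual1 u v + dual2 u v) = J2 b - J2 c.
  by rewrite scalerDr scalerA mulrC -scalerA fE gE oE; vring (J2 a) (J2 b) (J2 c).
move: A1 A2 A3 B1 B2 B3; rewrite l1 scale1r scaler0 !add0r -!lamE fE mE pE !scalerBr.
move=> A1 A2 A3 B1 B2 B3.
have sE p : lam *: p + s = lam *: p - lam *: J2 a + s1 by rewrite /s [s1 - _]addrC addrA.
have tE p : lam *: (- p + t) + s = lam *: J2 b - lam *: p + s2.
  rewrite /t 2!scalerDr scalerN scalerA divff ?gt_eqF // scale1r.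
  have ab (x y z w : R2) : - y + (z - w + x) + w = x - y + z by move: w => [w1 w2]; vring x y z.
  exact: ab.
have HT : translate (scale_set lam (conv_JD D t)) s `<=` T.
  move=> _ [_ [p Hp <-] <-].
  pose C : set R2 := [set p | T (lam *: p + s)].
  have cC : convex_set C.
    move=> x y Cx Cy r r01; rewrite /C /=.
    have -> : lam *: (r *: x + (1 - r) *: y) + s = r *: (lam *: x + s) + (1 - r) *: (lam *: y + s).
      by generalize lam; intro k; vring s x y.
    exact: cT.
  have CJ : (J2 @` D) `|` [set - J2 e + t | e in D] `<=` C.
    move=> _ [[e De <-]|[e De <-]].
      have cJ : convex_set [set e | C (J2 e)].
        move=> x y Cx Cy r r01.
        have /= -> : J2 (r *: x + (1 - r) *: y) = r *: J2 x + (1 - r) *: J2 y by rewrite /J2; vring x y x.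
        exact: cC.
      apply: (conv_hull_sub cJ _ De) => _ [->|[->|->]]; rewrite /C /= sE //.
      by rewrite subrr add0r.
    have cJ : convex_set [set e | C (- J2 e + t)].
      move=> x y Cx Cy r r01.
      have /= -> : - J2 (r *: x + (1 - r) *: y) + t = r *: (- J2 x + t) + (1 - r) *: (- J2 y + t).
        by rewrite /J2; vring x y t.
      exact: cC.
    apply: (conv_hull_sub cJ _ De) => _ [->|[->|->]]; rewrite /C /= tE //.
    by rewrite subrr add0r.
  exact: (conv_hull_sub cC CJ Hp).
have [_ kH _] := conv_JD_body t.
have vT : vol2 T = (lam ^+ 2 * d)%:E.
  move: H; rewrite vol4_D //.
  have V0 : (0 <= vol2 T)%E by exact: (measure_ge0 borel_vol2).
  case: (vol2 T) V0 => [w||] // _; last by rewrite gt0_muley // lte_fin divr_gt0.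
  rewrite -EFinM => -[H]; congr EFin; apply: (mulfI dn); rewrite /lam.
  have -> : d * w = 2 * (d / 2 * w) by field.
  by rewrite H; field.
have vH := vol2_homothet s lam0 kH.
have vHT : (vol2 (translate (scale_set lam (conv_JD D t)) s) <= vol2 T)%E.
  apply: (le_measure borel_vol2); rewrite ?inE //.
    by apply: compact_measurable2; exact: homothet_compact.
  by apply: compact_measurable2; case: bT.
have vJ : vol2 (conv_JD D t) = d%:E.
  apply/eqP; rewrite eq_le conv_JD_vol_ge andbT.
  move: vHT; rewrite vH vT (EFinM (lam ^+ 2)) lee_pmul2l //.
  by rewrite lte_fin exprn_gt0.
exists lam, s, (conv_JD D t); split=> //; first by apply/T_family_vol2; exists t.
apply: (@convex_body_sub_eq _ _ _ (lam ^+ 2 * d)) => //.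
- exact: homothet_compact.
- by rewrite vH vJ -EFinM.
- by rewrite vT.
Qed.

End Family.
End Triangles.

Section TriangleCase.
Context {R : realType}.
Local Notation R2 := (R * R)%type.

Lemma homothet_id (T : set R2) : T = translate (scale_set 1 T) 0.
Proof.
rewrite homothetE; apply/seteqP; split=> [p Tp|_ [[x y] Tp <-]].
  by exists p => //; case: p {Tp} => x y; rewrite /frame /=; pring.
by move: Tp; congr T; rewrite /frame /=; pring.
Qed.

Lemma triangle_case (D : set R2) : is_triangle D ->
  (forall T, T_family D T -> vol4 (D `*` T) = ((cEHZ (D `*` T)) ^+ 2 / 2)%:E) /\
  (forall T : set R2, convex_body T ->
    (vol4 (D `*` T) = ((cEHZ (D `*` T)) ^+ 2 / 2)%:E <->
     exists (lam : R) (s : R2) (Ts : set R2),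
       [/\ 0 < lam, T_family D Ts & T = translate (scale_set lam Ts) s])).
Proof.
move=> [a [b [c [d0 ->]]]].
(* Exchanging [a] and [b] reverses the orientation without changing the triangle. *)
wlog d1 : a b c d0 / 0 < det2 (c - (1/2) *: (a + b)) (b - a).
  have dE (x y z : R2) : det2 (z - (1/2) *: (x + y)) (y - x) = - det2 (y - x) (z - x).
    by rewrite /det2 /= /GRing.scale /=; field.
  have [d1|d1] := ltP 0 (det2 (c - (1/2) *: (a + b)) (b - a)) => H; first exact: H.
  have -> : [set p | p = a \/ p = b \/ p = c] = [set p | p = b \/ p = a \/ p = c].
    by apply/seteqP; split=> p /=; tauto.
  have dE' : det2 (a - b) (c - b) = - det2 (b - a) (c - a) by rewrite /det2 /=; ring.
  move: d1; rewrite dE oppr_le0 le_eqVlt eq_sym (negPf d0) /= => d1.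
  apply: H; first by rewrite dE' oppr_eq0.
  by rewrite dE dE' opprK.
split=> [T fT|T bT].
  apply: (triangle_equality_intro d1 _ ltr01 fT (homothet_id T)).
  by have [t [-> _]] := fT; exact: conv_JD_body.
split; first exact: triangle_equality_elim.
by move=> [lam [s [Ts [lam0 fTs TE]]]]; exact: (triangle_equality_intro d1 bT lam0 fTs TE).
Qed.

End TriangleCase.

(** * Squares *)

Section SquareCase.
Context {R : realType}.
Local Notation R2 := (R * R)%type.

Lemma segment_convex_compact (p q : R2) (A : set R2) :
  A = (fun t : R => p + t *: (q - p)) @` `[0, 1]%classic -> [/\ convex_set A, compact A & A !=set0].
Proof.
move=> ->; split.
- move=> _ _ [x /= + <-] [y /= + <-] t /andP[t0 t1]; rewrite !in_itv /= => /andP[x0 x1] /andP[y0 y1].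
  exists (t * x + (1 - t) * y); first by rewrite /= in_itv /=; nra.
  by vring p q p.
- apply: continuous_compact; last exact: segment_compact.
  apply: continuous_subspaceT => x; apply: cvgD; first exact: cvg_cst.
  by apply: cvgZr_tmp; exact: cvg_id.
- by exists p, 0; rewrite /= ?in_itv /= ?lexx ?ler01 // scale0r addr0.
Qed.

Section Diamond.
Variables (a1 a2 : R).
Hypotheses (a1_01 : 0 <= a1 <= 1) (a2_01 : 0 <= a2 <= 1).

Lemma diamond_mem : [/\ diamond a1 a2 (0, a2), diamond a1 a2 (1, a2),
  diamond a1 a2 (a1, 0) & diamond a1 a2 (a1, 1)].
Proof.
by split; apply: sub_conv_hull; [left|left|right|right]; split; rewrite //= ?lexx ?ler01.
Qed.

Lemma diamond_sub (W : set R2) : convex_set W -> W (0, a2) -> W (1, a2) -> W (a1, 0) -> W (a1, 1) ->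
  diamond a1 a2 `<=` W.
Proof.
move=> cW h1 h2 h3 h4; apply: conv_hull_sub => // -[x y] [/= [x01 ->]|/= [-> y01]].
  by have := cW _ _ h2 h1 x x01; congr W; pring.
by have := cW _ _ h4 h3 y y01; congr W; pring.
Qed.

Lemma diamond_body : convex_body (diamond a1 a2).
Proof.
have [h1 h2 h3 h4] := diamond_mem.
split; first exact: conv_hull_convex.
  have [|c1 k1 n1] := @segment_convex_compact (0, a2) (1, a2) [set p | 0 <= p.1 <= 1 /\ p.2 = a2].
    apply/seteqP; split.
      move=> [x y] [/= x01 ->]; exists x; first by rewrite /= in_itv.
      by pring.
    move=> _ [x /= x01 <-]; rewrite in_itv /= in x01; rewrite /= /GRing.scale /=.
    by split; [rewrite subr0 mulr1 add0r | ring].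
  have [|c2 k2 n2] := @segment_convex_compact (a1, 0) (a1, 1) [set p | p.1 = a1 /\ 0 <= p.2 <= 1].
    apply/seteqP; split.
      move=> [x y] [/= -> y01]; exists y; first by rewrite /= in_itv.
      by pring.
    move=> _ [x /= x01 <-]; rewrite in_itv /= in x01; rewrite /= /GRing.scale /=.
    by split; [ring | rewrite subr0 mulr1 add0r].
  exact: conv_hull_compact.
have tri x : diamond a1 a2 (x, a2) -> x != a1 -> ((diamond a1 a2)°) !=set0.
  move=> hx xa.
  apply: (@convex_interior_triangle _ _ (a1, 0) (a1, 1) (x, a2)) => //; first exact: conv_hull_convex.
  rewrite /det2 /=; have -> : (a1 - a1) * (a2 - 0) - (1 - 0) * (x - a1) = a1 - x by ring.
  by rewrite subr_eq0 eq_sym.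
have [a10|a10] := eqVneq a1 0; last by apply: (tri 0) => //; rewrite eq_sym.
by apply: (tri 1) => //; rewrite a10 oner_neq0.
Qed.

(** The vertical diagonal cuts the diamond into two triangles with that unit diagonal as base and
    heights [a1] and [1 - a1]. *)
Lemma diamond_vol_le : (vol2 (diamond a1 a2) <= (1/2)%:E)%E.
Proof.
case/andP: a1_01 => a10 a11; case/andP: a2_01 => a20 a21.
(* The formula of a strip divides by its width, so a triangle of width zero is replaced by the empty
   set. *)
pose L := if 0 < a1 then strip `[0, a1] 0 a2 0 a1 0 1 else set0.
pose U := if a1 < 1 then strip `[a1, 1] a1 0 1 1 a2 0 else set0.
have mL : measurable2 L by rewrite /L; case: ifP => _; [exact: strip_measurable | exact: measurable0].
have mU : measurable2 U by rewrite /U; case: ifP => _; [exact: strip_measurable | exact: measurable0].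
have vL : vol2 L = (a1 / 2)%:E.
  rewrite /L; case: ltP => h; first by rewrite vol2_strip ?ler01 //; [congr EFin; field | left].
  have -> : a1 = 0 by lra.
  by rewrite mul0r; exact: (measure0 borel_vol2).
have vU : vol2 U = ((1 - a1) / 2)%:E.
  rewrite /U; case: ltP => h; first by rewrite vol2_strip ?ler01 //; [congr EFin; field | left].
  have -> : a1 = 1 by lra.
  by rewrite subrr mul0r; exact: (measure0 borel_vol2).
have sub : diamond a1 a2 `<=` L `|` U.
  pose H : set R2 := [set p | [/\ 0 <= p.1 <= 1, a1 * (p.2 - a2) <= (1 - a2) * p.1, a1 * (a2 - p.2) <= a2 * p.1,
    (1 - a1) * (p.2 - a2) <= (1 - a2) * (1 - p.1) & (1 - a1) * (a2 - p.2) <= a2 * (1 - p.1)]].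
  have dH : diamond a1 a2 `<=` H.
    apply: diamond_sub; try by split=> /=; try (apply/andP; split); nra.
    move=> [x1 y1] [x2 y2] [/= /andP[? ?] ? ? ? ?] [/= /andP[? ?] ? ? ? ?] t /andP[? ?].
    by split; rewrite /= /GRing.scale /=; try (apply/andP; split); nra.
  move=> p /dH; case: p => x y [/= /andP[x0 x1] h1 h2 h3 h4].
  have [xa|xa] := leP x a1.
    have [a1p|a1n] := ltP 0 a1; last first.
      right; have a1E : a1 = 0 by lra.
      rewrite /U; case: ltP => [_|]; last lra.
      have xE : x = 0 by lra.
      move: h3 h4; rewrite /strip /= in_itv /= a1E xE => h3 h4; split; first by rewrite lexx ler01.
      by rewrite subrr mul0r; lra.
    left; rewrite /L a1p /strip /= in_itv /= x0 xa !subr0; split=> //.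
    have xE : x = x / a1 * a1 by rewrite divfK ?gt_eqF.
    move: (x / a1) xE h1 h2 => t -> h1 h2.
    have {}h1 : a1 * (y - a2) <= a1 * ((1 - a2) * t) by lra.
    have {}h2 : a1 * (a2 - y) <= a1 * (a2 * t) by lra.
    by move: h1 h2; rewrite !ler_pM2l // => h1 h2; lra.
  right; have a1n : a1 < 1 by lra.
  have a1m : 0 < 1 - a1 by lra.
  rewrite /U a1n /strip /= in_itv /= x1 (ltW xa); split=> //.
  have xE : 1 - x = (1 - (x - a1) / (1 - a1)) * (1 - a1).
    by rewrite mulrBl divfK ?gt_eqF //; ring.
  move: ((x - a1) / (1 - a1)) xE h3 h4 => t -> h3 h4.
  have {}h3 : (1 - a1) * (y - a2) <= (1 - a1) * ((1 - a2) * (1 - t)) by lra.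
  have {}h4 : (1 - a1) * (a2 - y) <= (1 - a1) * (a2 * (1 - t)) by lra.
  by move: h3 h4; rewrite !ler_pM2l // => h3 h4; lra.
apply: le_trans (_ : vol2 (L `|` U) <= _)%E.
  apply: (le_measure borel_vol2); rewrite ?inE //.
    by apply: compact_measurable2; have [] := diamond_body.
  exact: measurableU.
have H : (vol2 (L `|` U) <= vol2 L + vol2 U)%E by exact: (measureU2 borel_vol2 mL mU).
apply: le_trans H _; rewrite vL vU -EFinD lee_fin; lra.
Qed.

Lemma diamond_fits (s : R) : 0 < s -> fits (diamond a1 a2) (s, 0) (0, s) 0 s.
Proof.
move=> s0; have sn : s != 0 by rewrite gt_eqF.
have [h1 h2 h3 h4] := diamond_mem.
have d1E : s *: dual1 (s, 0) (0, s) = (1, 0) :> R2 by rewrite /dual1 /det2; pring.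
have d2E : s *: dual2 (s, 0) (0, s) = (0, 1) :> R2 by rewrite /dual2 /det2; pring.
rewrite /fits !mulr0 !scale0r !add0r; split.
- exists (0, a2); rewrite d1E scaler0 add0r; split=> //.
  by move: h2; congr diamond; pring.
- exists (a1, 1); rewrite scalerN d2E scaler0 add0r; split=> //.
  by move: h3; congr diamond; pring.
- exists (a1, 0); rewrite d2E scaler0 add0r; split=> //.
  by move: h4; congr diamond; pring.
Qed.

End Diamond.

Lemma zero_range : 0 <= (0 : R) <= 1/2. Proof. by rewrite lexx /= divr_ge0. Qed.

End SquareCase.

Section SquareEquality.
Context {R : realType}.
Local Notation R2 := (R * R)%type.
Implicit Types T : set R2.

Section Square.
Variables (a b s : R).
Hypothesis s0 : 0 < s.
Let u : R2 := (s, 0).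
Let v : R2 := (0, s).
Let o : R2 := (a, b + s / 2).
Local Notation S := [set p : R2 | (a <= p.1 <= a + s) /\ (b <= p.2 <= b + s)].

Let duv : det2 u v = s ^+ 2. Proof. by rewrite /det2 /=; ring. Qed.
Let d0 : det2 u v != 0. Proof. by rewrite duv gt_eqF // exprn_gt0. Qed.

Lemma square_frame : S = frame o u v @` trap 0.
Proof.
have sn : s != 0 by rewrite gt_eqF.
apply/seteqP; split=> [[x y] [/= /andP[h1 h2] /andP[h3 h4]]|_ [[x y] [/= h1 h2 h3 h4] <-]].
  exists ((x - a) / s, (y - b) / s - 1/2); last by rewrite /frame /u /v /o; pring.
  have k1 : 0 <= (x - a) / s by rewrite divr_ge0; lra.
  have k2 : (x - a) / s <= 1 by rewrite ler_pdivrMr; lra.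
  have k3 : 0 <= (y - b) / s by rewrite divr_ge0; lra.
  have k4 : (y - b) / s <= 1 by rewrite ler_pdivrMr; lra.
  by split=> /=; lra.
rewrite /frame /= /GRing.scale /=.
have k1 : 0 <= x * s by rewrite mulr_ge0 // ltW.
have k2 : x * s <= s by rewrite ger_pMl.
have k3 : y * s <= s / 2 by rewrite [s / 2]mulrC ler_pM2r //; lra.
have k4 : - y * s <= s / 2 by rewrite [s / 2]mulrC ler_pM2r //; lra.
by split; apply/andP; split; lra.
Qed.

Lemma vol4_square T : convex_body T -> vol4 (S `*` T) = ((s ^+ 2)%:E * vol2 T)%E.
Proof.
move=> [_ kT _]; rewrite square_frame.
have [_ kK _] := frame_trap_body o d0 zero_range.
rewrite vol4X; [|exact: compact_measurable2|exact: compact_measurable2].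
by rewrite vol2_frame_trap ?zero_range // duv subr0 mulr1 gtr0_norm // exprn_gt0.
Qed.

(** The lower bound is the volume inequality, with the square as a test factor. *)
Lemma diamond_vol a1 a2 : 0 <= a1 <= 1 -> 0 <= a2 <= 1 -> vol2 (diamond a1 a2) = (1/2 : R)%:E.
Proof.
move=> h1 h2; apply/eqP; rewrite eq_le diamond_vol_le //=.
have := fits_vol4 o d0 zero_range s0 (diamond_body a1 a2) (diamond_fits a1 a2 s0).
rewrite -square_frame vol4_square; last exact: diamond_body.
have V0 : (0 <= vol2 (diamond a1 a2))%E by exact: (measure_ge0 borel_vol2).
case: (vol2 _) V0 => [w||] // _; last by rewrite leey.
have s2 : 0 < s ^+ 2 by rewrite exprn_gt0.
by rewrite -EFinM !lee_fin ler_pM2l // mul1r.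
Qed.

Lemma square_equality_intro T (lam : R) (s' : R2) a1 a2 : convex_body T -> 0 < lam ->
  0 <= a1 <= 1 -> 0 <= a2 <= 1 -> T = translate (scale_set lam (diamond a1 a2)) s' ->
  vol4 (S `*` T) = (cEHZ (S `*` T) ^+ 2 / 2)%:E.
Proof.
move=> bT lam0 h1 h2 TE.
have fT : fits T u v 0 (lam * s).
  by rewrite TE; have [k1 k2 k3] := diamond_fits a1 a2 s0; split; apply: homothet_fits3.
have := @trap_equality_intro _ o u v T 0 (lam * s) d0 zero_range (mulr_gt0 lam0 s0) bT fT.
rewrite -square_frame; apply.
rewrite vol4_square // TE vol2_homothet //; last by have [] := diamond_body a1 a2.
by rewrite diamond_vol // -!EFinM lee_fin le_eqVlt; apply/orP; left; apply/eqP; field.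
Qed.

(** For [e = 0] the configurations are unit chords in the two axis directions. If they did not
    cross, the hull of one chord and an end of the other would already have area above 1/2; crossing
    chords span a diamond of area 1/2, which then exhausts [T]. *)
Lemma square_equality_elim T : convex_body T ->
  vol4 (S `*` T) = (cEHZ (S `*` T) ^+ 2 / 2)%:E ->
  exists (lam : R) (s' : R2) (a1 a2 : R),
    [/\ 0 < lam, 0 <= a1 <= 1, 0 <= a2 <= 1 & T = translate (scale_set lam (diamond a1 a2)) s'].
Proof.
move=> bT; rewrite square_frame => /(trap_equality_elim d0 zero_range bT).
move=> [c [p [u' [z [x [y [c0 _ [[W0 W1] _ [W2 _ W3]] vW]]]]]]].
set W := (X in vol2 X = _) in vW W0 W1 W2 W3.
have [cT kT _] := bT.
have cW : convex_set W by exact: frame_preimage_convex.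
have mW : measurable2 W.
  by apply: frame_preimage_measurable; [exact: det_dual_scaled_neq0 | exact: compact_measurable2].
rewrite add0r in W1; rewrite addr0 in W3; rewrite subr0 mulr1 in vW.
move: W0 W1 W2 W3; rewrite -!/(W _) => W0 W1 W2 W3.
have y01 : 0 <= x <= 1.
  have W1' : W (0, 0 + 1) by rewrite add0r.
  have r0 := right_area_apex W0 W1' W0; have l0 := @left_area_apex _ W 0 _ _ W0.
  have rx := right_area_apex W0 W1' W2; have lx := @left_area_apex _ W 0 _ _ W3.
  have := vol2_ge_halves cW mW l0 rx; have := vol2_ge_halves cW mW lx r0.
  by rewrite vW !lee_fin => k1 k2; apply/andP; split; lra.
have x01 : 0 <= y <= 1.
  clearbody W.
  (* Exchanges the axes and moves the origin to the left end of the horizontal chord, so that the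
     area bounds for vertical chords apply to it. *)
  pose V := frame (x - 1, y) (0, 1) (1, 0) @^-1` W.
  have dE : det2 (0, 1) (1, 0) = -1 :> R by rewrite /det2 /=; ring.
  have dE0 : det2 (0, 1) (1, 0) != 0 :> R by rewrite dE oppr_eq0 oner_neq0.
  have cV : convex_set V by exact: frame_preimage_convex.
  have mV : measurable2 V by exact: frame_preimage_measurable.
  have vV : vol2 V = (1/2)%:E by rewrite -vW (vol2_frame_preimage (x - 1, y) dE0 mW) dE normrN1 mul1e.
  have VE q1 q2 : W (x - 1 + q2, y + q1) -> V (q1, q2).
    have E : frame (x - 1, y) (0, 1) (1, 0) (q1, q2) = (x - 1 + q2, y + q1) by rewrite /frame; pring.
    by rewrite /V /= E.
  have x0 : x - 1 + (1 - x) = 0 by ring.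
  have V0 : V (0, 0) by apply: VE; rewrite !addr0.
  have V1 : V (0, 0 + 1) by apply: VE; rewrite add0r subrK addr0.
  have V2 : V (- y, 1 - x) by apply: VE; rewrite x0 subrr.
  have V3 : V (1 - y, 1 - x) by apply: VE; rewrite x0 addrC subrK.
  have r0 := right_area_apex V0 V1 V0; have l0 := @left_area_apex _ V 0 _ _ V0.
  have rx := right_area_apex V0 V1 V3; have lx := @left_area_apex _ V 0 _ _ V2.
  have := vol2_ge_halves cV mV l0 rx; have := vol2_ge_halves cV mV lx r0.
  by rewrite vV !lee_fin => k1 k2; apply/andP; split; lra.
have sn : s != 0 by rewrite gt_eqF.
pose lam := c / s; have lam0 : 0 < lam by rewrite divr_gt0.
have x01' : 0 <= 1 - x <= 1 by lra.
have WE x1 x2 : W (x1, x2) -> T (lam *: (x2, x1 + (1 - x)) + (p - lam *: (0, 1 - x))).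
  rewrite /W /=; congr T; rewrite /frame /dual1 /dual2 /det2 /lam /u /v.
  by generalize p; intros [p1 p2]; pring.
pose s' := p - lam *: (0, 1 - x).
have HT : translate (scale_set lam (diamond y (1 - x))) s' `<=` T.
  have cP : convex_set [set q | T (lam *: q + s')].
    move=> q r Tq Tr t t01; rewrite /=.
    have -> : lam *: (t *: q + (1 - t) *: r) + s' = t *: (lam *: q + s') + (1 - t) *: (lam *: r + s').
      by generalize lam; intro k; vring s' q r.
    exact: cT.
  have dP : diamond y (1 - x) `<=` [set q | T (lam *: q + s')].
    apply: diamond_sub => //=.
    - by have := WE _ _ W0; rewrite add0r.
    - by have := WE _ _ W1; rewrite add0r.
    - by have := WE _ _ W3; have -> : x - 1 + (1 - x) = 0 by ring.
    - by have := WE _ _ W2; have -> : x + (1 - x) = 1 by ring.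
  by move=> _ [_ [q /dP Tq <-] <-].
have [_ kD _] := diamond_body y (1 - x).
exists lam, s', y, (1 - x); split=> //.
apply: (@convex_body_sub_eq _ _ _ (lam ^+ 2 / 2)) => //.
- exact: homothet_compact.
- by rewrite vol2_homothet // diamond_vol // -EFinM mul1r.
- rewrite (vol2_frame_preimage p (det_dual_scaled_neq0 d0 c0) (compact_measurable2 kT)) -/W vW.
  rewrite det_dual_scaled // duv normrN ger0_norm ?divr_ge0 ?sqr_ge0 //.
  rewrite -EFinM lee_fin le_eqVlt; apply/orP; left; apply/eqP.
  by rewrite /lam; field.
Qed.

End Square.
End SquareEquality.

(** * Trapezoids *)

Section TrapezoidEquality.
Context {R : realType}.
Local Notation R2 := (R * R)%type.
Implicit Types (T W : set R2).

Lemma frame_square_convex (o p q : R2) : convex_set (frame o p q @` unit_square).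
Proof.
apply: frame_image_convex => -[p1 p2] [q1 q2] [/= /andP[? ?] /andP[? ?]] [/= /andP[? ?] /andP[? ?]] t /andP[? ?].
by split; rewrite /= /GRing.scale /=; nra.
Qed.

Lemma frame_square_sub W (o p q : R2) : convex_set W -> W o -> W (o + p) -> W (o + q) ->
  W (o + p + q) -> frame o p q @` unit_square `<=` W.
Proof.
move=> cW W0 Wp Wq Wpq _ [[x y] [/= x01 y01] <-].
have := cW _ _ (cW _ _ Wpq Wq x x01) (cW _ _ Wp W0 x x01) y y01.
by congr W; rewrite /frame /=; vring o p q.
Qed.

Lemma frame_square_body (o p q : R2) : det2 p q != 0 -> convex_body (frame o p q @` unit_square).
Proof.
move=> d0; split; [exact: frame_square_convex | by have [] := frame_square_vol2 o d0 |].
have m x y : 0 <= x <= 1 -> 0 <= y <= 1 -> (frame o p q @` unit_square) (frame o p q (x, y)).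
  by move=> *; exists (x, y).
have h0 : 0 <= (0 : R) <= 1 by rewrite lexx ler01.
have h1 : 0 <= (1 : R) <= 1 by rewrite lexx ler01.
apply: (@convex_interior_triangle _ _ (frame o p q (0, 0)) (frame o p q (1, 0)) (frame o p q (0, 1)));
  [exact: frame_square_convex | exact: m | exact: m | exact: m |].
have -> : frame o p q (1, 0) - frame o p q (0, 0) = p by rewrite /frame /=; vring o p q.
by have -> : frame o p q (0, 1) - frame o p q (0, 0) = q by rewrite /frame /=; vring o p q.
Qed.

(* Both triangles have their base on the same line as a chord of the hull of the long chord and
   the opposite apex; since no area is left, these chords coincide, which fixes the apexes. *)
Lemma unit_config_apex W (e y z v t w : R) : 0 < e < 1/2 -> convex_set W -> measurable2 W ->
  unit_config W e y (- v) z v t -> 2 * (1 - e) * v = 1 - 2 * e ->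
  2 * (1 - e) * w = 1 -> (vol2 W <= w%:E)%E -> z + e = y + 1/2 /\ t + e = y + 1/2.
Proof.
move=> /andP[e0 e1] cW mW [[W0 W1] [A1 A2 A3] [B1 B2 B3]] vE wE wW.
have c0 : 0 < 1 - e by lra.
have c2 : 2 * (1 - e) != 0 by rewrite gt_eqF //; lra.
have e2 : 2 * e != 0 by rewrite gt_eqF //; lra.
have w0 : 0 < w by rewrite -(pmulr_rgt0 _ (_ : 0 < 2 * (1 - e))) ?wE //; lra.
have wv : 1 - v = w by apply: (mulfI c2); lra.
have vw : v = (1 - 2 * e) * w by apply: (mulfI c2); rewrite vE mulrCA wE mulr1.
have v0 : 0 < v by rewrite vw mulr_gt0 //; lra.
have r01 : 0 <= 1 - 2 * e <= 1 by lra.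
have key A B : left_area W y A -> right_area W y B -> A + B <= w.
  by move=> lA rB; rewrite -lee_fin; apply: le_trans wW; exact: vol2_ge_halves lA rB.
have R1 := right_area_apex W0 W1 A3.
have L1 := @left_area_apex _ W y _ _ B3.
have secR : W (v, (1 - 2 * e) * (z + e) + 2 * e * y) /\
    W (v, (1 - 2 * e) * (z + e) + 2 * e * y + 2 * e).
  have xE : - v + 1 = w by lra.
  split; [have := cW _ _ A3 W0 _ r01 | have := cW _ _ A3 W1 _ r01];
    by congr W; congr pair; rewrite /= /GRing.scale /= ?xE ?vw; ring.
have secL : W (- v, (1 - 2 * e) * (t + e) + 2 * e * y) /\
    W (- v, (1 - 2 * e) * (t + e) + 2 * e * y + 2 * e).
  have xE : v - 1 = - w by lra.
  split; [have := cW _ _ B3 W0 _ r01 | have := cW _ _ B3 W1 _ r01];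
    by congr W; congr pair; rewrite /= /GRing.scale /= ?xE ?vw; ring.
(* A chord at abscissa [v] longer than [2 * e] would push the area above [w]. *)
have long x1 x2 : W (v, x1) -> W (v, x2 + 2 * e) -> x2 <= x1.
  move=> h1 h2; rewrite leNgt; apply/negP => x12.
  have h2' : W (v, x1 + (x2 + 2 * e - x1)) by rewrite addrC subrK.
  have := key _ _ L1 (@right_area_trapezoid _ W y W0 W1 _ _ _ _ _ (ltW v0) _ A3 h1 h2').
  move=> /(_ ltac:(lra)); have : 0 < (x2 - x1) * w by rewrite mulr_gt0 ?subr_gt0.
  have -> : - v + 1 = w by lra.
  have -> : v - 1 = - w by lra.
  by rewrite vw; lra.
have long' x1 x2 : W (- v, x1) -> W (- v, x2 + 2 * e) -> x2 <= x1.
  move=> h1 h2; rewrite leNgt; apply/negP => x12.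
  have h2' : W (- v, x1 + (x2 + 2 * e - x1)) by rewrite addrC subrK.
  have v0' : - v <= 0 by lra.
  have := key _ _ (@left_area_trapezoid _ W y _ _ _ _ _ v0' _ B3 h1 h2') R1.
  move=> /(_ ltac:(lra)); have : 0 < (x2 - x1) * w by rewrite mulr_gt0 ?subr_gt0.
  have -> : - v + 1 = w by lra.
  have -> : v - 1 = - w by lra.
  by rewrite vw; lra.
have [sR1 sR2] := secR; have [sL1 sL2] := secL.
have t1 := long _ _ B1 sR2; have t2 := long _ _ sR1 B2.
have z1 := long' _ _ A1 sL2; have z2 := long' _ _ sL1 A2.
have tE : t = (1 - 2 * e) * (z + e) + 2 * e * y by lra.
have zE : z = (1 - 2 * e) * (t + e) + 2 * e * y by lra.
have tz : t = z by apply: (mulfI c2); lra.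
suff : t + e = y + 1/2 by lra.
by apply: (mulfI e2); move: tE; rewrite -tz; lra.
Qed.

End TrapezoidEquality.

Section TrapezoidFrameEquality.
Context {R : realType}.
Local Notation R2 := (R * R)%type.
Implicit Types (T W : set R2).

Variables (o u v : R2) (e b : R).
Hypothesis d0 : det2 u v != 0.
Hypothesis e01 : 0 < e < 1/2.
Hypothesis bE : 2 * (1 - e) * b = 1.
Local Notation f := (dual1 u v).
Local Notation g := (dual2 u v).
Local Notation K := (frame o u v @` trap e).
(** In the chart of momenta at scale [c], this is the hull of the unit chord and of the two apexes
    at half its height and distance [b]; its area there is the extremal value [b]. *)
Local Notation rhombus c s :=
  (frame s (c *: ((1/2) *: f + b *: g)) (c *: ((1/2) *: f - b *: g)) @` unit_square).

Let e01' : 0 <= e <= 1/2. Proof. by move: e01 => /andP[? ?]; apply/andP; split; lra. Qed.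

Let b0 : 0 < b.
Proof. by rewrite -(pmulr_rgt0 _ (_ : 0 < 2 * (1 - e))) ?bE //; case/andP: e01 => *; lra. Qed.

Let det_rhombus c : det2 (c *: ((1/2) *: f + b *: g)) (c *: ((1/2) *: f - b *: g)) =
  - (c ^+ 2 * b / det2 u v).
Proof.
transitivity (- (c ^+ 2 * b * det2 f g)); last by rewrite det_dual // mulrA.
by rewrite /det2 /= /GRing.scale /=; field.
Qed.

Let det_rhombus_neq0 (c : R) : 0 < c ->
  det2 (c *: ((1/2) *: f + b *: g)) (c *: ((1/2) *: f - b *: g)) != 0.
Proof.
by move=> c0; rewrite det_rhombus oppr_eq0 mulf_neq0 ?invr_eq0 // gt_eqF // mulr_gt0 // exprn_gt0.
Qed.

Let vol2_rhombus (c : R) s : 0 < c ->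
  compact (rhombus c s) /\ vol2 (rhombus c s) = (c ^+ 2 * b / `|det2 u v|)%:E.
Proof.
move=> c0; have [k ->] := frame_square_vol2 s (det_rhombus_neq0 c0); split=> //.
by rewrite det_rhombus normrN normrM normfV gtr0_norm // mulr_gt0 // exprn_gt0.
Qed.

Lemma rhombus_fits (c : R) s : fits (rhombus c s) u v e c.
Proof.
have m x y : 0 <= x <= 1 -> 0 <= y <= 1 -> (rhombus c s)
    (s + x *: (c *: ((1/2) *: f + b *: g)) + y *: (c *: ((1/2) *: f - b *: g))).
  by move=> *; exists (x, y).
have h0 : 0 <= (0 : R) <= 1 by rewrite lexx ler01.
have h1 : 0 <= (1 : R) <= 1 by rewrite lexx ler01.
have h2 : 0 <= 2 * e <= 1 by case/andP: e01 => *; lra.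
have h3 : 0 <= 1 - 2 * e <= 1 by case/andP: e01 => *; lra.
(* Inserting the factor [2 * (1 - e) * b = 1] makes the memberships below polynomial identities. *)
have gm : e *: f - g = e *: f - (2 * (1 - e) * b) *: g by rewrite bE scale1r.
have gp : e *: f + g = e *: f + (2 * (1 - e) * b) *: g by rewrite bE scale1r.
split.
- exists s; split.
  + by have := m _ _ h1 h1; congr (rhombus c s); vring f g s.
  + by have := m _ _ h0 h0; congr (rhombus c s); vring f g s.
  + by have := m _ _ h0 h0; congr (rhombus c s); vring f g s.
- exists (s + (1 - 2 * e) *: (c *: ((1/2) *: f + b *: g))); split.
  + by have := m _ _ h0 h1; congr (rhombus c s); rewrite gm; vring f g s.
  + by have := m _ _ h3 h0; congr (rhombus c s); vring f g s.
  + by have := m _ _ h1 h2; congr (rhombus c s); vring f g s.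
- exists (s + (1 - 2 * e) *: (c *: ((1/2) *: f - b *: g))); split.
  + by have := m _ _ h1 h0; congr (rhombus c s); rewrite gp; vring f g s.
  + by have := m _ _ h0 h3; congr (rhombus c s); vring f g s.
  + by have := m _ _ h2 h1; congr (rhombus c s); vring f g s.
Qed.

Lemma rhombus_equality T : convex_body T ->
  (vol4 (K `*` T) = (cEHZ (K `*` T) ^+ 2 / 2)%:E <-> exists c s, 0 < c /\ T = rhombus c s).
Proof.
move=> bT; have [cT kT _] := bT; split; last first.
  move=> [c [s [c0 TE]]].
  have fT : fits T u v e c by rewrite TE; exact: rhombus_fits.
  apply: (trap_equality_intro d0 e01' c0 bT fT).
  rewrite vol4X; [|apply: compact_measurable2; by have [] := frame_trap_body o d0 e01'|exact: compact_measurable2].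
  rewrite vol2_frame_trap // TE; have [_ ->] := vol2_rhombus s c0.
  rewrite -EFinM lee_fin le_eqVlt; apply/orP; left; apply/eqP.
  have dn : `|det2 u v| != 0 by rewrite normr_eq0.
  transitivity (c ^+ 2 * (2 * (1 - e) * b) / 2); last by rewrite bE mulr1.
  by field.
move=> /(trap_equality_elim d0 e01' bT)[c [s [u' [z [v' [t [c0 _ cfg vW]]]]]]].
set W := (X in vol2 X = _) in vW; rewrite -/W in cfg.
have bE' : b = 1 / (2 * (1 - e)).
  have c2 : 2 * (1 - e) != 0 by rewrite gt_eqF //; case/andP: e01 => *; lra.
  by apply: (mulfI c2); rewrite bE mul1r divff.
rewrite -bE' in vW.
have cW : convex_set W by exact: frame_preimage_convex.
have mW : measurable2 W.
  by apply: frame_preimage_measurable; [exact: det_dual_scaled_neq0 | exact: compact_measurable2].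
have vW' : (vol2 W <= b%:E)%E by rewrite vW.
have [_ /(_ e01 bE)[uv vE]] := unit_config_area e01' cW mW cfg vW'.
move: cfg; rewrite uv => cfg.
have [zE tE] := unit_config_apex e01 cW mW cfg vE bE vW'.
have [[W0 W1] [_ _ A3] [_ _ B3]] := cfg.
have vb : 1 - v' = b.
  have c2 : 2 * (1 - e) != 0 by rewrite gt_eqF //; case/andP: e01 => *; lra.
  by apply: (mulfI c2); rewrite mulrBr mulr1 vE bE; ring.
have E1 : - v' + 1 = b by lra.
have E2 : v' - 1 = - b by lra.
move: W0 W1 A3 B3; rewrite zE tE E1 E2 !add0r => W0 W1 A3 B3.
have WT p : W p -> T (frame s (c *: g) (c *: f) p) by [].
have sub : rhombus c s `<=` T.
  apply: frame_square_sub => //.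
  - by have := WT _ W0; congr T; rewrite /frame; vring f g s.
  - by have := WT _ A3; congr T; rewrite /frame; vring f g s.
  - by have := WT _ B3; congr T; rewrite /frame; vring f g s.
  - by have := WT _ W1; congr T; rewrite /frame; vring f g s.
exists c, s; split=> //; have [kH vH] := vol2_rhombus s c0.
apply: (convex_body_sub_eq bT kH sub vH).
rewrite (vol2_frame_preimage s (det_dual_scaled_neq0 d0 c0) (compact_measurable2 kT)) -/W vW.
rewrite det_dual_scaled // normrN normrM normfV ger0_norm ?sqr_ge0 //.
by rewrite -EFinM lee_fin mulrAC.
Qed.

End TrapezoidFrameEquality.

(** * Trapezoids as affine images of diamonds *)

Section DiamondQuadrilaterals.
Context {R : realType}.
Local Notation R2 := (R * R)%type.
Implicit Types (T W : set R2).

Lemma det2_frame (o u v p q p' q' : R2) :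
  det2 (frame o u v p - frame o u v q) (frame o u v p' - frame o u v q') =
  det2 u v * det2 (p - q) (p' - q').
Proof.
case: p q p' q' => [? ?] [? ?] [? ?] [? ?]; rewrite /det2 /frame /= /GRing.scale /=; ring.
Qed.

Lemma orient_frame (o u v p q r : R2) :
  orient (frame o u v p) (frame o u v q) (frame o u v r) = det2 u v * orient p q r.
Proof. exact: det2_frame. Qed.

Lemma frame_diamond_sub W (c m1 m2 : R2) (a1 a2 : R) : convex_set W ->
  W (frame c m1 m2 (0, a2)) -> W (frame c m1 m2 (1, a2)) ->
  W (frame c m1 m2 (a1, 0)) -> W (frame c m1 m2 (a1, 1)) ->
  frame c m1 m2 @` diamond a1 a2 `<=` W.
Proof.
move=> cW h1 h2 h3 h4 _ [p dp <-].
have H := (@diamond_sub _ a1 a2 (frame c m1 m2 @^-1` W) (frame_preimage_convex cW) h1 h2 h3 h4 p dp).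
exact: H.
Qed.

Lemma frame_diamond_convex (c m1 m2 : R2) (a1 a2 : R) :
  convex_set (frame c m1 m2 @` diamond a1 a2).
Proof. by apply: frame_image_convex; exact: conv_hull_convex. Qed.

Lemma frame_diamond_flip1 (c m1 m2 : R2) (a1 a2 : R) :
  frame c m1 m2 @` diamond a1 a2 = frame (c + m1) (- m1) m2 @` diamond (1 - a1) a2.
Proof.
have key c' n1 n2 b1 : frame c' n1 n2 @` diamond b1 a2 `<=`
    frame (c' + n1) (- n1) n2 @` diamond (1 - b1) a2.
  have [d1 d2 d3 d4] := diamond_mem (1 - b1) a2.
  apply: frame_diamond_sub; first exact: frame_diamond_convex.
  - by exists (1, a2) => //; rewrite /frame; vring c' n1 n2.
  - by exists (0, a2) => //; rewrite /frame; vring c' n1 n2.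
  - by exists (1 - b1, 0) => //; rewrite /frame; vring c' n1 n2.
  - by exists (1 - b1, 1) => //; rewrite /frame; vring c' n1 n2.
apply/seteqP; split; first exact: key.
have := key (c + m1) (- m1) m2 (1 - a1).
by rewrite addrK opprK; have -> : 1 - (1 - a1) = a1 by ring.
Qed.

Lemma frame_diamond_flip2 (c m1 m2 : R2) (a1 a2 : R) :
  frame c m1 m2 @` diamond a1 a2 = frame (c + m2) m1 (- m2) @` diamond a1 (1 - a2).
Proof.
have key c' n1 n2 b2 : frame c' n1 n2 @` diamond a1 b2 `<=`
    frame (c' + n2) n1 (- n2) @` diamond a1 (1 - b2).
  have [d1 d2 d3 d4] := diamond_mem a1 (1 - b2).
  apply: frame_diamond_sub; first exact: frame_diamond_convex.
  - by exists (0, 1 - b2) => //; rewrite /frame; vring c' n1 n2.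
  - by exists (1, 1 - b2) => //; rewrite /frame; vring c' n1 n2.
  - by exists (a1, 1) => //; rewrite /frame; vring c' n1 n2.
  - by exists (a1, 0) => //; rewrite /frame; vring c' n1 n2.
apply/seteqP; split; first exact: key.
have := key (c + m2) m1 (- m2) (1 - a2).
by rewrite addrK opprK; have -> : 1 - (1 - a2) = a2 by ring.
Qed.

Lemma trap_sub W (e : R) : convex_set W -> 0 <= e < 1/2 -> W (0, 1/2) -> W (0, -(1/2)) ->
  W (1, 1/2 - e) -> W (1, e - 1/2) -> trap e `<=` W.
Proof.
move=> cW /andP[e0 e1] h1 h2 h3 h4 [x y] [/= x0 x1 y1 y2].
have ex : e * x <= e by rewrite ler_piMr.
have den : 0 < 1 - 2 * e * x by lra.
pose t := ((1/2 - e * x) + y) / (1 - 2 * e * x).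
have t01 : 0 <= t <= 1.
  by rewrite /t divr_ge0 /=; [rewrite ler_pdivrMr; lra | lra | lra].
have x01 : 0 <= x <= 1 by rewrite x0.
have := cW _ _ (cW _ _ h3 h4 t t01) (cW _ _ h1 h2 t t01) x x01.
have yE : y = t * (1 - 2 * e * x) - (1/2 - e * x) by rewrite /t divfK ?gt_eqF //; ring.
by congr W; rewrite yE; generalize t; intro k; pring.
Qed.

(** The sides from (b, 0) to (0, b) and from (1, b) to (b, 1) are parallel with lengths in the ratio
    b : 1 - b. Matching this with 1 : 1 - 2e gives the relation between [b] and [e]. *)
Lemma frame_diamond_trap (c m1 m2 : R2) (b e : R) : 1/2 < b < 1 -> 2 * (1 - e) * b = 1 ->
  frame c m1 m2 @` diamond b b =
  frame (c + (b / 2) *: (m1 + m2)) ((1/2) *: (m1 + m2)) (b *: (m2 - m1)) @` trap e.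
Proof.
move=> /andP[b1 b2] bE.
have be : b * e = b - 1/2 by lra.
have e0 : 0 <= e by rewrite -(pmulr_rge0 _ (_ : 0 < b)); lra.
have e1 : e < 1/2 by rewrite -(ltr_pM2l (_ : 0 < b)); lra.
have eE : e = (b - 1/2) / b by rewrite -be mulrC mulKf // gt_eqF //; lra.
have bn : b != 0 by rewrite gt_eqF //; lra.
apply/seteqP; split.
  apply: frame_diamond_sub; first by apply: frame_image_convex; exact: trap_convex.
  - by exists (0, 1/2); [split=> /=; lra | rewrite /frame; vring c m1 m2].
  - by exists (1, e - 1/2); [split=> /=; lra | rewrite eE /frame; vring c m1 m2].
  - by exists (0, - (1/2)); [split=> /=; lra | rewrite /frame; vring c m1 m2].
  - by exists (1, 1/2 - e); [split=> /=; lra | rewrite eE /frame; vring c m1 m2].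
have [d1 d2 d3 d4] := diamond_mem b b.
move=> _ [p tp <-]; move: p tp.
apply: (@trap_sub (frame _ _ _ @^-1` (frame c m1 m2 @` diamond b b))).
- by apply: frame_preimage_convex; exact: frame_diamond_convex.
- by rewrite e0.
- by exists (0, b) => //; rewrite /frame; vring c m1 m2.
- by exists (b, 0) => //; rewrite /frame; vring c m1 m2.
- by exists (b, 1) => //; rewrite eE /frame; vring c m1 m2.
- by exists (1, b) => //; rewrite eE /frame; vring c m1 m2.
Qed.

Lemma frame_square_swap (s p q : R2) :
  frame s p q @` unit_square = frame s q p @` unit_square.
Proof.
by apply/seteqP; split=> _ [[x y] [/= h1 h2] <-]; exists (y, x) => //; rewrite /frame addrAC.
Qed.

Lemma frame_square_flip (s p q : R2) :
  frame s (- p) q @` unit_square = frame (s - p) p q @` unit_square.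
Proof.
apply/seteqP; split=> _ [[x y] [/= /andP[? ?] h2] <-]; exists (1 - x, y).
- by split=> //=; apply/andP; split; lra.
- by rewrite /frame; vring s p q.
- by split=> //=; apply/andP; split; lra.
- by rewrite /frame; vring s p q.
Qed.

Definition homothetic_square (n1 n2 : R2) T : Prop :=
  exists (r : R) s, 0 < r /\ T = frame s (r *: n1) (r *: n2) @` unit_square.

Lemma homothetic_square_flip1 (n1 n2 : R2) T :
  homothetic_square (- n1) n2 T <-> homothetic_square n1 n2 T.
Proof.
split=> -[r [s [r0 ->]]]; exists r.
  by exists (s - r *: n1); split=> //; rewrite scalerN frame_square_flip.
by exists (s + r *: n1); split=> //; rewrite scalerN frame_square_flip addrK.
Qed.

Lemma homothetic_square_swap (n1 n2 : R2) T :
  homothetic_square n1 n2 T <-> homothetic_square n2 n1 T.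
Proof. by split=> -[r [s [r0 ->]]]; exists r, s; split=> //; exact: frame_square_swap. Qed.

Lemma dual1_flip1 (u v : R2) : dual1 (- u) v = - dual1 u v.
Proof.
have dE : det2 (- u) v = - det2 u v by rewrite /det2 /=; ring.
by rewrite /dual1 dE invrN !mulrN.
Qed.

Lemma dual2_flip1 (u v : R2) : dual2 (- u) v = dual2 u v.
Proof.
have dE : det2 (- u) v = - det2 u v by rewrite /det2 /=; ring.
by rewrite /dual2 dE /= invrN !mulrN !mulNr !opprK.
Qed.

Definition viterbo_equality (K T : set R2) : Prop :=
  vol4 (K `*` T) = (cEHZ (K `*` T) ^+ 2 / 2)%:E.

(** The edges of the rhombus, expressed through [m1] and [m2], are multiples of their dual basis; so
    the extremal bodies do not depend on [b]. *)
Lemma viterbo_diamond_diag (c m1 m2 : R2) (b : R) T : det2 m1 m2 != 0 -> 1/2 < b < 1 ->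
  convex_body T -> viterbo_equality (frame c m1 m2 @` diamond b b) T <->
    homothetic_square (dual1 m1 m2) (dual2 m1 m2) T.
Proof.
move=> d0 b01 bT; pose e := 1 - (2 * b)^-1.
have bn : b != 0 by rewrite gt_eqF //; case/andP: b01; lra.
have bE : 2 * (1 - e) * b = 1 by rewrite /e; field.
have be : b * e = b - 1/2 by lra.
have e01 : 0 < e < 1/2.
  case/andP: b01 => b1 b2; apply/andP; split.
    by rewrite -(pmulr_rgt0 _ (_ : 0 < b)); lra.
  by rewrite -(ltr_pM2l (_ : 0 < b)); lra.
rewrite /viterbo_equality (frame_diamond_trap c m1 m2 b01 bE).
have dE : det2 ((1/2) *: (m1 + m2)) (b *: (m2 - m1)) = b * det2 m1 m2.
  by rewrite /det2 /= /GRing.scale /=; field.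
have d1 : det2 ((1/2) *: (m1 + m2)) (b *: (m2 - m1)) != 0 by rewrite dE mulf_neq0.
have E1 : (1/2) *: dual1 ((1/2) *: (m1 + m2)) (b *: (m2 - m1)) +
    b *: dual2 ((1/2) *: (m1 + m2)) (b *: (m2 - m1)) = dual2 m1 m2.
  by rewrite /dual1 /dual2 dE; pring; rewrite ?d0.
have E2 : (1/2) *: dual1 ((1/2) *: (m1 + m2)) (b *: (m2 - m1)) -
    b *: dual2 ((1/2) *: (m1 + m2)) (b *: (m2 - m1)) = dual1 m1 m2.
  by rewrite /dual1 /dual2 dE; pring; rewrite ?d0.
rewrite (rhombus_equality _ d1 e01 bE bT) E1 E2 homothetic_square_swap.
by [].
Qed.

End DiamondQuadrilaterals.

Section DiamondShape.
Context {R : realType}.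
Local Notation R2 := (R * R)%type.
Implicit Types (T W : set R2).

Definition affine_on_segments (f : R2 -> R) : Prop :=
  forall p q (t : R), f (t *: p + (1 - t) *: q) = t * f p + (1 - t) * f q.

Lemma halfplane_convex (f : R2 -> R) (r : R) : affine_on_segments f -> convex_set [set p | r <= f p].
Proof. by move=> af p q /= h1 h2 t /andP[? ?]; rewrite /= af; nra. Qed.

(* A functional that is positive at three vertices and nonnegative at the fourth vanishes at
   most at this vertex, because [f > 0] together with the vertex is a convex set. *)
Lemma unique_zero (f : R2 -> R) (a1 a2 : R) (v : R2) : affine_on_segments f -> 0 <= f v ->
  (forall w, w = (0, a2) \/ w = (1, a2) \/ w = (a1, 0) \/ w = (a1, 1) -> w = v \/ 0 < f w) ->
  forall p, diamond a1 a2 p -> f p = 0 -> p = v.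
Proof.
move=> af fv H p dp fp.
pose C : set R2 := [set p | p = v \/ 0 < f p].
have cC : convex_set C.
  move=> x y Cx Cy t /andP[t0 t1].
  have [tE|tn0] := eqVneq t 0; first by rewrite tE scale0r add0r subr0 scale1r.
  have [tE|tn1] := eqVneq t 1; first by rewrite tE subrr scale0r addr0 scale1r.
  have t0' : 0 < t by rewrite lt_neqAle eq_sym tn0.
  have t1' : 0 < 1 - t by rewrite subr_gt0 lt_neqAle tn1.
  case: Cx Cy => [->|fx] [->|fy].
  - by left; rewrite -scalerDl addrC subrK scale1r.
  - by right; rewrite af; apply: ltr_wpDl; [rewrite mulr_ge0 | rewrite mulr_gt0].
  - by right; rewrite af; apply: ltr_wpDr; [rewrite mulr_ge0 // ltW | rewrite mulr_gt0].
  - by right; rewrite af; apply: addr_gt0; rewrite mulr_gt0.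
have : C p by apply: (@diamond_sub _ a1 a2 C) dp => //; apply: H; tauto.
by case=> //; rewrite fp ltxx.
Qed.

(* If an affine functional has its minimum and its maximum at two points each, it is extremal on
   two opposite sides, which are therefore parallel. *)
Lemma parallel_sides (f : R2 -> R) (a1 a2 h : R) (p p' q q' : R2) : 0 < a1 < 1 -> 0 < a2 < 1 ->
  affine_on_segments f -> 0 < h -> (forall x, diamond a1 a2 x -> 0 <= f x <= h) ->
  diamond a1 a2 p -> diamond a1 a2 p' -> p <> p' -> f p = 0 -> f p' = 0 ->
  diamond a1 a2 q -> diamond a1 a2 q' -> q <> q' -> f q = h -> f q' = h ->
  a1 = a2 \/ a1 + a2 = 1.
Proof.
move=> /andP[a10 a11] /andP[a20 a21] af h0 fh dp dp' pp' fp fp' dq dq' qq' fq fq'.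
have [d1 d2 d3 d4] := diamond_mem a1 a2.
pose A := f (0, a2); pose B := f (1, a2); pose C := f (a1, 0); pose D := f (a1, 1).
have /andP[A0 Ah] := fh _ d1; have /andP[B0 Bh] := fh _ d2.
have /andP[C0 Ch] := fh _ d3; have /andP[D0 Dh] := fh _ d4.
(* The diagonals meet at (a1, a2), where [f] is computed along each of them. *)
have cross : a1 * B + (1 - a1) * A = a2 * D + (1 - a2) * C.
  by rewrite /A /B /C /D -!af; congr f; pring.
have zero v : 0 <= f v ->
    (forall w, w = (0, a2) \/ w = (1, a2) \/ w = (a1, 0) \/ w = (a1, 1) -> w = v \/ 0 < f w) -> False.
  move=> fv H; apply: pp'; have z := unique_zero af fv H.
  by rewrite (z _ dp fp) (z _ dp' fp').
have af' : affine_on_segments (fun x => h - f x) by move=> x y t; rewrite af; ring.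
have top v : f v <= h ->
    (forall w, w = (0, a2) \/ w = (1, a2) \/ w = (a1, 0) \/ w = (a1, 1) -> w = v \/ f w < h) -> False.
  move=> fv H; apply: qq'.
  have fv' : 0 <= h - f v by rewrite subr_ge0.
  have z : forall x, diamond a1 a2 x -> h - f x = 0 -> x = v.
    by apply: (unique_zero af') => // w /H[->|k]; [left | right; rewrite subr_gt0].
  have -> : q = v by apply: z => //; rewrite fq subrr.
  by have -> : q' = v by apply: z => //; rewrite fq' subrr.
have zA : 0 < B -> 0 < C -> 0 < D -> False.
  by move=> *; apply: (zero (0, a2)) => // w [|[|[|]]] ->; [left|right|right|right].
have zB : 0 < A -> 0 < C -> 0 < D -> False.
  by move=> *; apply: (zero (1, a2)) => // w [|[|[|]]] ->; [right|left|right|right].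
have zC : 0 < A -> 0 < B -> 0 < D -> False.
  by move=> *; apply: (zero (a1, 0)) => // w [|[|[|]]] ->; [right|right|left|right].
have zD : 0 < A -> 0 < B -> 0 < C -> False.
  by move=> *; apply: (zero (a1, 1)) => // w [|[|[|]]] ->; [right|right|right|left].
have tA : B < h -> C < h -> D < h -> False.
  by move=> *; apply: (top (0, a2)) => // w [|[|[|]]] ->; [left|right|right|right].
have tB : A < h -> C < h -> D < h -> False.
  by move=> *; apply: (top (1, a2)) => // w [|[|[|]]] ->; [right|left|right|right].
have tC : A < h -> B < h -> D < h -> False.
  by move=> *; apply: (top (a1, 0)) => // w [|[|[|]]] ->; [right|right|left|right].
have tD : A < h -> B < h -> C < h -> False.
  by move=> *; apply: (top (a1, 1)) => // w [|[|[|]]] ->; [right|right|right|left].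
move: A0 Ah B0 Bh C0 Ch D0 Dh cross zA zB zC zD tA tB tC tD; rewrite -/A -/B -/C -/D.
move: A B C D => A B C D.
move=> A0 Ah B0 Bh C0 Ch D0 Dh cross zA zB zC zD tA tB tC tD.
have split0 (x : R) : 0 <= x -> x = 0 \/ 0 < x.
  by rewrite le_eqVlt => /predU1P[->|]; [left | right].
have hn : h != 0 by rewrite gt_eqF.
have AB : A = 0 -> B = 0 -> False.
  move=> AE BE; move: cross; rewrite AE BE !mulr0 addr0 => /esym/eqP.
  rewrite paddr_eq0 ?mulr_ge0 ?subr_ge0 ?(ltW a20) ?(ltW a21) // !mulf_eq0 subr_eq0.
  rewrite (gt_eqF a20) (gt_eqF a21) /= => /andP[/eqP DE /eqP CE].
  by apply: tD; rewrite ?AE ?BE ?CE.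
have CD : C = 0 -> D = 0 -> False.
  move=> CE DE; move: cross; rewrite CE DE !mulr0 addr0 => /eqP.
  rewrite paddr_eq0 ?mulr_ge0 ?subr_ge0 ?(ltW a10) ?(ltW a11) // !mulf_eq0 subr_eq0.
  rewrite (gt_eqF a10) (gt_eqF a11) /= => /andP[/eqP BE /eqP AE].
  by apply: AB.
have full (x : R) : x <= h -> (x < h -> False) -> x = h.
  by move=> xh H; apply/eqP; rewrite eq_le xh leNgt; apply/negP.
have [AE|Ap] := split0 A A0.
  have Bp : 0 < B by case: (split0 B B0) => // /(AB AE).
  have [CE|Cp] := split0 C C0.
    have DE : D = h by apply: full => // ?; apply: tB; rewrite ?AE ?CE.
    have BE : B = h by apply: full => // ?; apply: tD; rewrite ?AE ?CE.
    by left; apply: (mulIf hn); move: cross; rewrite AE CE DE BE !mulr0 !addr0.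
  have [DE|Dp] := split0 D D0; last by case: (zA Bp Cp Dp).
  have CE : C = h by apply: full => // ?; apply: tB; rewrite ?AE ?DE.
  have BE : B = h by apply: full => // ?; apply: tC; rewrite ?AE ?DE.
  right; apply: (mulIf hn); move: cross; rewrite AE CE DE BE !mulr0 addr0 add0r mulrBl mul1r => E.
  by rewrite mulrDl E subrK.
have [BE|Bp] := split0 B B0.
  have [CE|Cp] := split0 C C0.
    have DE : D = h by apply: full => // ?; apply: tA; rewrite ?BE ?CE.
    have AE : A = h by apply: full => // ?; apply: tD; rewrite ?BE ?CE.
    right; apply: (mulIf hn); move: cross; rewrite AE CE DE BE !mulr0 addr0 add0r mulrBl mul1r => E.
    by rewrite mulrDl -E addrC subrK.
  have [DE|Dp] := split0 D D0; last by case: (zB Ap Cp Dp).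
  have CE : C = h by apply: full => // ?; apply: tA; rewrite ?BE ?DE.
  have AE : A = h by apply: full => // ?; apply: tC; rewrite ?BE ?DE.
  by left; apply/oppr_inj/(addrI 1)/(mulIf hn); move: cross; rewrite AE CE DE BE !mulr0 !add0r.
have [CE|Cp] := split0 C C0; last by case: (zD Ap Bp Cp).
have [DE|Dp] := split0 D D0; first by case: (CD CE DE).
by case: (zC Ap Bp Dp).
Qed.

Lemma frame_affine (o u v w z : R2) (k : R) :
  affine_on_segments (fun p => k * det2 w (frame o u v p - z)).
Proof.
move=> [? ?] [? ?] t; rewrite /det2 /frame /= /GRing.scale /=; ring.
Qed.

Lemma convex_quad_rotate (v0 v1 v2 v3 : R2) : convex_quad v0 v1 v2 v3 -> convex_quad v1 v2 v3 v0.
Proof. by move=> [[? [? [? ?]]]|[? [? [? ?]]]]; [left|right]. Qed.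

Lemma quad_rotate (v0 v1 v2 v3 : R2) : quad v0 v1 v2 v3 = quad v1 v2 v3 v0.
Proof. by congr conv_hull; apply/seteqP; split=> p /=; tauto. Qed.

(** The vertices of the two presentations of the quadrilateral are not matched. The signed distance
    to one of the parallel sides is minimal at two points and maximal at two others, and this is
    read off on the diamond. *)
Lemma trapezoid_diamond (c m1 m2 : R2) (a1 a2 : R) : 0 < a1 < 1 -> 0 < a2 < 1 ->
  (exists v0 v1 v2 v3, [/\ convex_quad v0 v1 v2 v3,
     frame c m1 m2 @` diamond a1 a2 = quad v0 v1 v2 v3 &
     det2 (v1 - v0) (v3 - v2) = 0 \/ det2 (v2 - v1) (v0 - v3) = 0]) ->
  a1 = a2 \/ a1 + a2 = 1.
Proof.
move=> a1_01 a2_01 [v0 [v1 [v2 [v3 [cq QE par]]]]].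
wlog par0 : v0 v1 v2 v3 cq QE par / det2 (v1 - v0) (v3 - v2) = 0.
  move=> H; case: par => par; first by apply: (H v0 v1 v2 v3) => //; left.
  apply: (H v1 v2 v3 v0) => //; [exact: convex_quad_rotate | by rewrite -quad_rotate | by left].
pose k : R := if 0 < orient v0 v1 v2 then 1 else -1.
have [pos1 pos2] : 0 < k * orient v0 v1 v2 /\ 0 < k * orient v2 v3 v0.
  rewrite /k; case: cq => [[h1 [h2 [h3 h4]]]|[h1 [h2 [h3 h4]]]]; first by rewrite h1 !mul1r.
  by rewrite (lt_gtF h1) !mulN1r !oppr_gt0.
pose f p := k * det2 (v1 - v0) (p - v0).
have f0 : f v0 = 0 by rewrite /f subrr /det2 /= !mulr0 subrr mulr0.
have f1 : f v1 = 0 by rewrite /f /det2; ring.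
have f2 : f v2 = k * orient v0 v1 v2 by rewrite /f /orient /det2 /=; ring.
have f3 : f v3 = k * orient v0 v1 v2.
  rewrite -f2 /f; congr (k * _); move: par0; rewrite /det2 /=; lra.
have af : affine_on_segments f by move=> p q t; rewrite /f /det2 /= /GRing.scale /=; ring.
have af' : affine_on_segments (fun p => k * orient v0 v1 v2 - f p) by move=> p q t; rewrite af; ring.
have lo : quad v0 v1 v2 v3 `<=` [set p | 0 <= f p].
  apply: conv_hull_sub; first exact: halfplane_convex.
  by move=> x /= [->|[->|[->|->]]]; rewrite ?f0 ?f1 ?f2 ?f3 // ltW.
have hi : quad v0 v1 v2 v3 `<=` [set p | 0 <= k * orient v0 v1 v2 - f p].
  apply: conv_hull_sub; first exact: (halfplane_convex af').
  by move=> x /= [->|[->|[->|->]]]; rewrite ?f0 ?f1 ?f2 ?f3 ?subr0 ?subrr // ltW.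
have fQ p : quad v0 v1 v2 v3 p -> 0 <= f p <= k * orient v0 v1 v2.
  by move=> Qp; apply/andP; split; [exact: lo | rewrite -subr_ge0; exact: hi].
have mem i : i = v0 \/ i = v1 \/ i = v2 \/ i = v3 -> exists2 p, diamond a1 a2 p & frame c m1 m2 p = i.
  move=> vi; have : quad v0 v1 v2 v3 i by apply: sub_conv_hull.
  by rewrite -QE => -[p dp pE]; exists p.
have [p0 d0 E0] := mem v0 ltac:(tauto); have [p1 d1 E1] := mem v1 ltac:(tauto).
have [p2 d2 E2] := mem v2 ltac:(tauto); have [p3 d3 E3] := mem v3 ltac:(tauto).
apply: (@parallel_sides (f \o frame c m1 m2) a1 a2 (k * orient v0 v1 v2) p0 p1 p2 p3) => //=.
- exact: frame_affine.
- by move=> x dx; apply: fQ; rewrite -QE; exists x.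
- by move=> pE; move: pos1; rewrite -E0 -E1 pE /orient subrr /det2 /= !mul0r subrr mulr0 ltxx.
- by rewrite E0.
- by rewrite E1.
- by move=> pE; move: pos2; rewrite -E2 -E3 pE /orient subrr /det2 /= !mul0r subrr mulr0 ltxx.
- by rewrite E2.
- by rewrite E3.
Qed.

End DiamondShape.

Section TrapezoidCase.
Context {R : realType}.
Local Notation R2 := (R * R)%type.
Implicit Types (T W : set R2).

Lemma homothetic_square_flip2 (n1 n2 : R2) T :
  homothetic_square n1 (- n2) T <-> homothetic_square n1 n2 T.
Proof. by rewrite homothetic_square_swap homothetic_square_flip1 homothetic_square_swap. Qed.

Lemma det2Nl (u v : R2) : det2 (- u) v = - det2 u v.
Proof. by rewrite /det2 /=; ring. Qed.

(** Reflecting the diamond in one or both directions leads to equal parameters above 1/2. The dual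
    basis changes only by signs, which a translation of the square absorbs. *)
Lemma viterbo_diamond (c m1 m2 : R2) (a1 a2 : R) T : det2 m1 m2 != 0 -> 0 < a1 < 1 ->
  a1 = a2 \/ a1 + a2 = 1 -> a1 != 1/2 -> convex_body T ->
  viterbo_equality (frame c m1 m2 @` diamond a1 a2) T <->
    homothetic_square (dual1 m1 m2) (dual2 m1 m2) T.
Proof.
move=> d0 a01 aE a_half bT.
have diag c' n1 n2 b : det2 n1 n2 != 0 -> 0 < b < 1 -> b != 1/2 ->
    viterbo_equality (frame c' n1 n2 @` diamond b b) T <->
    homothetic_square (dual1 n1 n2) (dual2 n1 n2) T.
  move=> dn /andP[b0 b1] bh; have [b2|b2|bE] := ltgtP b (1/2); last by rewrite bE eqxx in bh.
    rewrite frame_diamond_flip1 frame_diamond_flip2 viterbo_diamond_diag //.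
    - rewrite dual1_flip dual2_flip dual1_flip1 dual2_flip1.
      by rewrite homothetic_square_flip2 homothetic_square_flip1.
    - by rewrite det2Nl det2Nr opprK.
    - by apply/andP; split; lra.
  by apply: viterbo_diamond_diag => //; rewrite b2.
case: aE => [<-|aE]; first exact: diag.
have aE' : a2 = 1 - a1 by lra.
rewrite frame_diamond_flip1 aE' diag.
- by rewrite dual1_flip1 dual2_flip1 homothetic_square_flip1.
- by rewrite det2Nl oppr_eq0.
- by case/andP: a01 => ? ?; apply/andP; split; lra.
- by apply: contra a_half => /eqP h; apply/eqP; lra.
Qed.

Lemma frame_diamond_triangle (c m1 m2 p q r : R2) (a1 a2 : R) : det2 m1 m2 != 0 ->
  det2 (q - p) (r - p) != 0 -> diamond a1 a2 p -> diamond a1 a2 q -> diamond a1 a2 r ->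
  let H := conv_hull [set x | x = p \/ x = q \/ x = r] in
  H (0, a2) -> H (1, a2) -> H (a1, 0) -> H (a1, 1) ->
  is_triangle (frame c m1 m2 @` diamond a1 a2).
Proof.
move=> d0 d1 dp dq dr H h1 h2 h3 h4.
exists (frame c m1 m2 p), (frame c m1 m2 q), (frame c m1 m2 r).
split; first by rewrite det2_frame mulf_neq0.
have HF x : H x -> conv_hull [set y | y = frame c m1 m2 p \/ y = frame c m1 m2 q \/
    y = frame c m1 m2 r] (frame c m1 m2 x).
  move: x; apply: (@conv_hull_sub _ _ (frame c m1 m2 @^-1` conv_hull [set y |
    y = frame c m1 m2 p \/ y = frame c m1 m2 q \/ y = frame c m1 m2 r])).
    by apply: frame_preimage_convex; exact: conv_hull_convex.
  by move=> x [->|[->|->]]; apply: sub_conv_hull; [left|right; left|right; right].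
apply/seteqP; split.
  by apply: frame_diamond_sub; [exact: conv_hull_convex | exact: HF | exact: HF | exact: HF | exact: HF].
apply: conv_hull_sub; first exact: frame_diamond_convex.
by move=> x [->|[->|->]]; [exists p | exists q | exists r].
Qed.

Lemma conv_hull3_segment (p q r : R2) (t : R) : 0 <= t <= 1 ->
  conv_hull [set x | x = p \/ x = q \/ x = r] (t *: q + (1 - t) *: p).
Proof.
by move=> t01; apply: conv_hull_convex => //; apply: sub_conv_hull; [right; left | left].
Qed.

(** With a parameter equal to 0 or 1, an end of one diagonal lies on the other diagonal, and the
    remaining three ends span a triangle. *)
Lemma degenerate_diamond (c m1 m2 : R2) (a1 a2 : R) : det2 m1 m2 != 0 -> 0 <= a1 <= 1 ->
  0 <= a2 <= 1 -> ~ is_triangle (frame c m1 m2 @` diamond a1 a2) -> 0 < a1 < 1 /\ 0 < a2 < 1.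
Proof.
move=> d0 a1_01 a2_01 ntri; have [d1 d2 d3 d4] := diamond_mem a1 a2.
have vert (p q r x : R2) : x = p \/ x = q \/ x = r -> conv_hull [set x | x = p \/ x = q \/ x = r] x.
  by move=> h; apply: sub_conv_hull.
have n0 : (0 : R) != 1 by rewrite eq_sym oner_neq0.
have a10 : a1 != 0.
  apply/eqP => aE; apply: ntri; rewrite aE in d1 d2 d3 d4 *.
  apply: (@frame_diamond_triangle _ _ _ (0, 0) (0, 1) (1, a2)) => //; try by apply: vert; tauto.
    by rewrite /det2 /= !subr0 mul0r mul1r sub0r oppr_eq0 oner_neq0.
  have -> : (0, a2) = a2 *: (0, 1) + (1 - a2) *: (0, 0) :> R2 by pring.
  exact: conv_hull3_segment.
have a11 : a1 != 1.
  apply/eqP => aE; apply: ntri; rewrite aE in d1 d2 d3 d4 *.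
  apply: (@frame_diamond_triangle _ _ _ (1, 0) (1, 1) (0, a2)) => //; try by apply: vert; tauto.
    by rewrite /det2 /= !subrr !subr0 mul0r mul1r !sub0r opprK oner_neq0.
  have -> : (1, a2) = a2 *: (1, 1) + (1 - a2) *: (1, 0) :> R2 by pring.
  exact: conv_hull3_segment.
have a20 : a2 != 0.
  apply/eqP => aE; apply: ntri; rewrite aE in d1 d2 d3 d4 *.
  apply: (@frame_diamond_triangle _ _ _ (0, 0) (1, 0) (a1, 1)) => //; try by apply: vert; tauto.
    by rewrite /det2 /= !subr0 mul0r mul1r subr0 oner_neq0.
  have -> : (a1, 0) = a1 *: (1, 0) + (1 - a1) *: (0, 0) :> R2 by pring.
  exact: conv_hull3_segment.
have a21 : a2 != 1.
  apply/eqP => aE; apply: ntri; rewrite aE in d1 d2 d3 d4 *.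
  apply: (@frame_diamond_triangle _ _ _ (0, 1) (1, 1) (a1, 0)) => //; try by apply: vert; tauto.
    by rewrite /det2 /= !subrr !subr0 mul0r mul1r !sub0r subr0 oppr_eq0 oner_neq0.
  have -> : (a1, 1) = a1 *: (1, 1) + (1 - a1) *: (0, 1) :> R2 by pring.
  exact: conv_hull3_segment.
move: a1_01 a2_01 => /andP[h1 h2] /andP[h3 h4].
by rewrite !lt_neqAle ![0 == _]eq_sym a10 a11 a20 a21 h1 h2 h3 h4.
Qed.

Lemma central_diamond (c m1 m2 : R2) : det2 m1 m2 != 0 ->
  is_parallelogram (frame c m1 m2 @` diamond (1/2) (1/2)).
Proof.
move=> d0; exists (frame c m1 m2 (0, 1/2)), (frame c m1 m2 (1/2, 0)), (frame c m1 m2 (1, 1/2)),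
  (frame c m1 m2 (1/2, 1)); split.
- have e1 : orient (0, 1/2) (1/2, 0) (1, 1/2) = 1/2 :> R by rewrite /orient /det2 /=; field.
  have e2 : orient (1/2, 0) (1, 1/2) (1/2, 1) = 1/2 :> R by rewrite /orient /det2 /=; field.
  have e3 : orient (1, 1/2) (1/2, 1) (0, 1/2) = 1/2 :> R by rewrite /orient /det2 /=; field.
  have e4 : orient (1/2, 1) (0, 1/2) (1/2, 0) = 1/2 :> R by rewrite /orient /det2 /=; field.
  rewrite /convex_quad !orient_frame e1 e2 e3 e4.
  by have [d1|d1|dE] := ltgtP 0 (det2 m1 m2); [left | right | rewrite dE eqxx in d0]; do 3?split; lra.
- have [d1 d2 d3 d4] := @diamond_mem R (1/2) (1/2).
  apply/seteqP; split.
    by apply: frame_diamond_sub; [exact: conv_hull_convex | | | |]; apply: sub_conv_hull => /=; tauto.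
  apply: conv_hull_sub; first exact: frame_diamond_convex.
  by move=> x /= [->|[->|[->|->]]]; [exists (0, 1/2) | exists (1/2, 0) | exists (1, 1/2) | exists (1/2, 1)].
- by rewrite /frame; vring c m1 m2.
Qed.

Lemma mx_apply_frame (M : 'M[R]_2) (c p : R2) :
  mx_apply M p + c = frame c (M 0 0, M 1 0) (M 0 1, M 1 1) p.
Proof. by case: p c => [? ?] [? ?]; rewrite /mx_apply /frame; pring. Qed.

Lemma det_mx2 (M : 'M[R]_2) : \det M = det2 (M 0 0, M 1 0) (M 0 1, M 1 1).
Proof.
rewrite (expand_det_row _ 0) !big_ord_recl big_ord0 addr0 /cofactor !det_mx11 !mxE /=.
have l01 : lift ord0 ord0 = 1 :> 'I_2 by apply/val_inj.
have l10 : lift (1 : 'I_2) 0 = 0 by apply/val_inj.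
rewrite !l01 l10 /bump /= !addn0 expr0 expr1; have -> : ord0 = 0 :> 'I_2 by apply/val_inj.
rewrite /det2 /=. ring.
Qed.

Lemma inv_transpose_columns (M : 'M[R]_2) : M \in unitmx ->
  let N := invmx M^T in let m1 := (M 0 0, M 1 0) in let m2 := (M 0 1, M 1 1) in
  (N 0 0, N 1 0) = dual1 m1 m2 /\ (N 0 1, N 1 1) = dual2 m1 m2.
Proof.
move=> uM N m1 m2.
have d0 : det2 m1 m2 != 0 by rewrite -det_mx2 -unitfE -unitmxE.
have E i j : M 0 i * N 0 j + M 1 i * N 1 j = (i == j)%:R.
  have := congr1 (fun A : 'M[R]_2 => A i j) (mulmxV (_ : M^T \in unitmx)).
  rewrite unitmx_tr uM => /(_ isT); rewrite !mxE big_ord_recl big_ord1 !mxE => <-.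
  have l01 : lift ord0 ord0 = 1 :> 'I_2 by apply/val_inj.
  by rewrite l01.
have := E 0 0; have := E 1 0; have := E 0 1; have := E 1 1.
rewrite !eqxx /= => E11 E01 E10 E00.
split; congr pair; apply: (canRL (mulfK d0)); rewrite /det2 /m1 /m2 /=.
- transitivity (M 1 1 * (M 0 0 * N 0 0 + M 1 0 * N 1 0) - M 1 0 * (M 0 1 * N 0 0 + M 1 1 * N 1 0)).
    ring.
  by rewrite E00 E10; ring.
- transitivity (M 0 0 * (M 0 1 * N 0 0 + M 1 1 * N 1 0) - M 0 1 * (M 0 0 * N 0 0 + M 1 0 * N 1 0)).
    ring.
  by rewrite E00 E10; ring.
- transitivity (M 1 1 * (M 0 0 * N 0 1 + M 1 0 * N 1 1) - M 1 0 * (M 0 1 * N 0 1 + M 1 1 * N 1 1)).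
    ring.
  by rewrite E01 E11; ring.
- transitivity (M 0 0 * (M 0 1 * N 0 1 + M 1 1 * N 1 1) - M 0 1 * (M 0 0 * N 0 1 + M 1 0 * N 1 1)).
    ring.
  by rewrite E01 E11; ring.
Qed.

Lemma trapezoid_case (Q : set R2) (M : 'M[R]_2) (c : R2) (a1 a2 : R) :
  is_trapezoid Q -> ~ is_triangle Q -> ~ is_parallelogram Q ->
  M \in unitmx -> 0 <= a1 <= 1 -> 0 <= a2 <= 1 ->
  Q = [set mx_apply M p + c | p in diamond a1 a2] ->
  let P := [set mx_apply (invmx M^T) p | p in unit_square] in
  vol4 (Q `*` P) = ((cEHZ (Q `*` P)) ^+ 2 / 2)%:E /\
  (forall T : set R2, convex_body T ->
    (vol4 (Q `*` T) = ((cEHZ (Q `*` T)) ^+ 2 / 2)%:E <->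
     exists (lam : R) (s : R2), 0 < lam /\ T = translate (scale_set lam P) s)).
Proof.
move=> trQ ntri npar uM a1_01 a2_01 QE P.
pose m1 : R2 := (M 0 0, M 1 0); pose m2 : R2 := (M 0 1, M 1 1).
have d0 : det2 m1 m2 != 0 by rewrite -det_mx2 -unitfE -unitmxE.
have QF : Q = frame c m1 m2 @` diamond a1 a2.
  by rewrite QE; apply: eq_imagel => p _; exact: mx_apply_frame.
have [N1 N2] := inv_transpose_columns uM.
have PF : P = frame 0 (dual1 m1 m2) (dual2 m1 m2) @` unit_square.
  by apply: eq_imagel => p _; rewrite -N1 -N2 -mx_apply_frame addr0.
have PT lam s : translate (scale_set lam P) s =
    frame s (lam *: dual1 m1 m2) (lam *: dual2 m1 m2) @` unit_square.
  rewrite PF homothetE image_comp; apply: eq_imagel => -[x y] _ /=.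
  by rewrite /frame; vring s (dual1 m1 m2) (dual2 m1 m2).
have homE T : (exists (lam : R) (s : R2), 0 < lam /\ T = translate (scale_set lam P) s) <->
    homothetic_square (dual1 m1 m2) (dual2 m1 m2) T.
  by split=> -[lam [s [lam0 ->]]]; exists lam, s; split=> //; rewrite PT.
rewrite QF in trQ ntri npar *.
have [a1_o a2_o] := degenerate_diamond d0 a1_01 a2_01 ntri.
have aE : a1 = a2 \/ a1 + a2 = 1.
  by case: trQ => // trQ; exact: (trapezoid_diamond a1_o a2_o trQ).
have a_half : a1 != 1/2.
  apply/eqP => ah; apply: npar; have -> : a2 = 1/2 by case: aE; lra.
  by rewrite ah; exact: central_diamond.
have main T : convex_body T -> viterbo_equality (frame c m1 m2 @` diamond a1 a2) T <->
    exists (lam : R) (s : R2), 0 < lam /\ T = translate (scale_set lam P) s.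
  by move=> bT; rewrite homE; exact: viterbo_diamond.
split=> //; apply/main; last by exists 1, 0; split; [exact: ltr01 | exact: homothet_id].
rewrite PF; apply: frame_square_body.
have dE : det2 (dual1 m1 m2) (dual2 m1 m2) = (det2 m1 m2)^-1 by exact: det_dual.
by rewrite dE invr_eq0.
Qed.

End TrapezoidCase.

Theorem theorem1p2 (R : realType) :
  (* (i) triangles *)
  (forall D : set (R * R), is_triangle D ->
     (forall T, T_family D T ->
        vol4 (D `*` T) = ((cEHZ (D `*` T)) ^+ 2 / 2)%:E) /\
     (forall T : set (R * R), convex_body T ->
        (vol4 (D `*` T) = ((cEHZ (D `*` T)) ^+ 2 / 2)%:E <->
         exists (lam : R) (s : R * R) (Ts : set (R * R)),
           [/\ 0 < lam, T_family D Ts & T = translate (scale_set lam Ts) s]))) /\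
  (* (ii) axis-parallel squares *)
  (forall S : set (R * R), is_axis_square S ->
     (forall a1 a2 : R, 0 <= a1 <= 1 -> 0 <= a2 <= 1 ->
        vol4 (S `*` diamond a1 a2) =
          ((cEHZ (S `*` diamond a1 a2)) ^+ 2 / 2)%:E) /\
     (forall T : set (R * R), convex_body T ->
        (vol4 (S `*` T) = ((cEHZ (S `*` T)) ^+ 2 / 2)%:E <->
         exists (lam : R) (s : R * R) (a1 a2 : R),
           [/\ 0 < lam, 0 <= a1 <= 1, 0 <= a2 <= 1 &
               T = translate (scale_set lam (diamond a1 a2)) s]))) /\
  (* (iii) trapezoids that are neither triangles nor parallelograms *)
  (forall (Q : set (R * R)) (M : 'M[R]_2) (c : R * R) (a1 a2 : R),
     is_trapezoid Q -> ~ is_triangle Q -> ~ is_parallelogram Q ->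
     M \in unitmx -> 0 <= a1 <= 1 -> 0 <= a2 <= 1 ->
     Q = [set mx_apply M p + c | p in diamond a1 a2] ->
     let P := [set mx_apply (invmx M^T) p | p in unit_square] in
     vol4 (Q `*` P) = ((cEHZ (Q `*` P)) ^+ 2 / 2)%:E /\
     (forall T : set (R * R), convex_body T ->
        (vol4 (Q `*` T) = ((cEHZ (Q `*` T)) ^+ 2 / 2)%:E <->
         exists (lam : R) (s : R * R),
           0 < lam /\ T = translate (scale_set lam P) s))).
Proof.
split; first by move=> D; exact: triangle_case.
split=> [S [a [b [s [s0 ->]]]]|Q M c a1 a2]; last exact: trapezoid_case.
split=> [a1 a2 h1 h2|T bT].
  exact: (square_equality_intro a b s0 (diamond_body a1 a2) ltr01 h1 h2 (homothet_id _)).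
split; first exact: square_equality_elim.
by move=> [lam [s' [a1 [a2 [lam0 h1 h2 TE]]]]]; exact: (square_equality_intro a b s0 bT lam0 h1 h2 TE).
Qed.
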